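(* Let $N\ge2$, let $\mu_{\mathcal{S}_N}$ be the Haar probability measure on $\mathcal{S}_N$, and let $H=L^2(\mathcal{S}_N,\mu_{\mathcal{S}_N})$, $(Tf)((z_n)_n)=z_0f((z_n)_n)$, $Uf=f\circ S$ ($f\in H$, $(z_n)_n\in\mathcal{S}_N$). Let $\varphi$ be the constant function $1$ on $\mathcal{S}_N$. Then $(H,U,T,\varphi)$ is the wavelet representation of $BS(1,N)$ associated to $m_0=1$ (and $h=1$). The representation is irreducible.
   Context: $BS(1,N)=\langle u,t\mid utu^{-1}=t^N\rangle$. $\mathcal{S}_N=\{(z_n)_{n\in\mathbb{Z}}\mid z_{n+1}^N=z_n,\ |z_n|=1\}$ (compact group under coordinatewise multiplication), $S(z_n)_n=(z_{n-1})_n$. The wavelet representation associated to $m_0\in L^\infty(\mathbb{T})$ and $h=1$ (where $\frac1N\sum_{w^N=z}|m_0(w)|^2=1$ a.e.) is the (unique up to isomorphism) unitary representation of $BS(1,N)$ on a Hilbert space $H$, with $u\mapsto U$, $t\mapsto T$, such that the spectral measure of $T$ is absolutely continuous with respect to Lebesgue measure on the unit circle $\mathbb{T}$ (so that $\pi(f):=f(T)$ is defined for $f\in L^\infty(\mathbb{T})$), together with a vector $\varphi\in H$, cyclic for the representation of the group, such that $U\varphi=\pi(m_0)\varphi$ and $\langle\pi(f)\varphi\mid\varphi\rangle=\int_{\mathbb{T}}f\,dz$ for all $f\in L^\infty(\mathbb{T})$ ($dz$ normalized Lebesgue measure). *)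

(* Defs.v *)
From HB Require Import structures.
From mathcomp Require Import all_boot all_order all_algebra.
From mathcomp Require Import generic_quotient ring_quotient sesquilinear.
From mathcomp Require Import all_classical all_reals all_analysis.
From mathcomp Require Import measurable_realfun complex ring lra.
Set Implicit Arguments.
Unset Strict Implicit.
Unset Printing Implicit Defensive.
Import Order.TTheory GRing.Theory Num.Theory.
Import numFieldNormedType.Exports.
Import Normc.
Local Notation Re := complex.Re.
Local Notation Im := complex.Im.
Local Open Scope classical_set_scope.
Local Open Scope ring_scope.

Section ComplexIntegral.
Context d (T : measurableType d) (R : realType).
Implicit Types (mu : {measure set T -> \bar R}) (f g : T -> R[i]).

Definition cmeasurable f : Prop :=
  measurable_fun setT (fun x => Re (f x)) /\
  measurable_fun setT (fun x => Im (f x)).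

Definition cintegrable mu f : Prop :=
  mu.-integrable setT (fun x => (Re (f x))%:E) /\
  mu.-integrable setT (fun x => (Im (f x))%:E).

Definition cintegral mu f : R[i] :=
  Complex (\int[mu]_x Re (f x)) (\int[mu]_x Im (f x)).

Definition square_integrable mu f : Prop :=
  cmeasurable f /\ (\int[mu]_x ((normc (f x)) ^+ 2)%:E < +oo)%E.

Lemma sqr_normcE (z : R[i]) : normc z ^+ 2 = Re z ^+ 2 + Im z ^+ 2.
Proof. by case: z => a b /=; rewrite sqr_sqrtr// addr_ge0// sqr_ge0. Qed.

Lemma cintegralD mu f g : cintegrable mu f -> cintegrable mu g ->
  cintegral mu (fun x => f x + g x) = cintegral mu f + cintegral mu g.
Proof.
move=> [f1 f2] [g1 g2]; rewrite /cintegral; congr Complex.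
  by rewrite -RintegralD//; apply: eq_Rintegral => x _; case: (f x) (g x) => ? ? [].
by rewrite -RintegralD//; apply: eq_Rintegral => x _; case: (f x) (g x) => ? ? [].
Qed.

Lemma cintegralZ mu (a : R[i]) f : cintegrable mu f ->
  cintegral mu (fun x => a * f x) = a * cintegral mu f.
Proof.
case: a => a b [f1 f2]; rewrite /cintegral.
have iZ (k : R) h : mu.-integrable setT (fun x => (h x)%:E) ->
    mu.-integrable setT (EFin \o (fun x => k * h x)).
  by move=> /(integrableZl measurableT k); apply: eq_integrable => // x _.
congr Complex; rewrite -!RintegralZl//.
- rewrite -RintegralB//; [|exact: iZ|exact: iZ].
  by apply: eq_Rintegral => x _; case: (f x).
- rewrite -RintegralD//; [|exact: iZ|exact: iZ].
  by apply: eq_Rintegral => x _; case: (f x).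
Qed.

Lemma cintegralJ mu f : cintegrable mu f ->
  cintegral mu (fun x => Num.conj (f x)) = Num.conj (cintegral mu f).
Proof.
move=> [_ f2]; rewrite /cintegral; congr Complex.
  by apply: eq_Rintegral => x _; case: (f x).
rewrite -mulN1r -RintegralZl//; apply: eq_Rintegral => x _.
by case: (f x) => a b; rewrite mulN1r.
Qed.

Lemma ae_eq_cintegral mu f g : cintegrable mu f -> cintegrable mu g ->
  {ae mu, forall x, f x = g x} -> cintegral mu f = cintegral mu g.
Proof.
move=> [f1 f2] [g1 g2] fg; rewrite /cintegral /Rintegral.
congr (Complex (fine _) (fine _)); apply: ae_eq_integral => //;
  do ?[exact: measurable_int f1|exact: measurable_int f2
      |exact: measurable_int g1|exact: measurable_int g2].
all: by apply: filterS fg => x ->.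
Qed.

Lemma measurable_sqr_normc f : cmeasurable f ->
  measurable_fun setT (fun x => ((normc (f x)) ^+ 2)%:E).
Proof.
move=> [f1 f2]; apply/measurable_EFinP.
rewrite (_ : (fun _ => _) = (fun x => Re (f x) ^+ 2 + Im (f x) ^+ 2)).
  by apply: measurable_funD; exact: measurable_funX.
by apply/funext => x; rewrite sqr_normcE.
Qed.

Lemma square_integrableE mu f : square_integrable mu f <->
  cmeasurable f /\ mu.-integrable setT (fun x => ((normc (f x)) ^+ 2)%:E).
Proof.
have E : (\int[mu]_x `|((normc (f x)) ^+ 2)%:E| =
          \int[mu]_x ((normc (f x)) ^+ 2)%:E)%E.
  by apply: eq_integral => x _; rewrite gee0_abs// lee_fin sqr_ge0.
split => -[mf fi]; split => //.
  by apply/integrableP; split; [exact: measurable_sqr_normc|rewrite E].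
by move/integrableP : fi => [_]; rewrite E.
Qed.

Lemma cmeasurableD f g : cmeasurable f -> cmeasurable g ->
  cmeasurable (fun x => f x + g x).
Proof.
move=> [f1 f2] [g1 g2]; split.
  rewrite (_ : (fun _ => _) = (fun x => Re (f x) + Re (g x))).
    exact: measurable_funD.
  by apply/funext => x; case: (f x) (g x) => ? ? [].
rewrite (_ : (fun _ => _) = (fun x => Im (f x) + Im (g x))).
  exact: measurable_funD.
by apply/funext => x; case: (f x) (g x) => ? ? [].
Qed.

Lemma cmeasurableM f g : cmeasurable f -> cmeasurable g ->
  cmeasurable (fun x => f x * g x).
Proof.
move=> [f1 f2] [g1 g2]; split.
  rewrite (_ : (fun _ => _) =
      (fun x => Re (f x) * Re (g x) - Im (f x) * Im (g x))).
    by apply: measurable_funB; exact: measurable_funM.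
  by apply/funext => x; case: (f x) (g x) => ? ? [].
rewrite (_ : (fun _ => _) =
    (fun x => Re (f x) * Im (g x) + Im (f x) * Re (g x))).
  by apply: measurable_funD; exact: measurable_funM.
by apply/funext => x; case: (f x) (g x) => ? ? [].
Qed.

Lemma cmeasurableJ f : cmeasurable f -> cmeasurable (fun x => Num.conj (f x)).
Proof.
move=> [f1 f2]; split.
  rewrite (_ : (fun _ => _) = (fun x => Re (f x)))//.
  by apply/funext => x; case: (f x).
rewrite (_ : (fun _ => _) = (fun x => - Im (f x))).
  exact: measurable_funN.
by apply/funext => x; case: (f x).
Qed.

Lemma cmeasurable_cst (a : R[i]) : cmeasurable (fun=> a).
Proof. by split; exact: measurable_cst. Qed.

Lemma cintegrableM mu f g : square_integrable mu f -> square_integrable mu g ->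
  cintegrable mu (fun x => f x * Num.conj (g x)).
Proof.
move=> /square_integrableE[mf fi] /square_integrableE[mg gi].
have [m1 m2] := cmeasurableM mf (cmeasurableJ mg).
have fgi := integrableD measurableT fi gi.
split; apply: le_integrable fgi => //; do ?exact/measurable_EFinP;
  move=> x _; rewrite -EFinD/= lee_fin !sqr_normcE;
  case: (f x) (g x) => a b [c e]/=;
  rewrite ler_norml [`|_ + _|]ger0_norm ?addr_ge0 ?sqr_ge0//;
  move: (sqr_ge0 (a - c)) (sqr_ge0 (a + c)) (sqr_ge0 (b - e)) (sqr_ge0 (b + e))
    (sqr_ge0 (a - e)) (sqr_ge0 (a + e)) (sqr_ge0 (b - c)) (sqr_ge0 (b + c));
  move=> *; apply/andP; split; nra.
Qed.

Lemma square_integrableD mu f g :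
  square_integrable mu f -> square_integrable mu g ->
  square_integrable mu (fun x => f x + g x).
Proof.
move=> /square_integrableE[mf fi] /square_integrableE[mg gi].
apply/square_integrableE; split; first exact: cmeasurableD.
have := integrableZl measurableT 2 (integrableD measurableT fi gi).
apply: le_integrable => //; first exact/measurable_sqr_normc/cmeasurableD.
move=> x _; rewrite -EFinD -EFinM/= lee_fin !ger0_norm ?sqr_ge0//; last first.
  by rewrite mulr_ge0// addr_ge0// sqr_ge0.
rewrite !sqr_normcE; case: (f x) (g x) => a b [c e]/=.
by move: (sqr_ge0 (a - c)) (sqr_ge0 (b - e)) => *; nra.
Qed.

Lemma square_integrableZ mu (a : R[i]) f :
  square_integrable mu f -> square_integrable mu (fun x => a * f x).
Proof.
move=> /square_integrableE[mf fi]; apply/square_integrableE; split.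
  exact: cmeasurableM (cmeasurable_cst a) mf.
apply: eq_integrable (integrableZl measurableT (normc a ^+ 2) fi) => // x _.
by rewrite normcM exprMn EFinM.
Qed.

End ComplexIntegral.

Section L2.
Context d (T : measurableType d) (R : realType) (mu : {measure set T -> \bar R}).
Local Open Scope quotient_scope.

Definition L2pred : {pred T -> R[i]} := fun f => `[< square_integrable mu f >].

Lemma L2pred_submod_closed : submod_closed L2pred.
Proof.
split.
  apply/asboolP/square_integrableE; split; first exact: cmeasurable_cst.
  apply: eq_integrable (integrable0 mu setT) => // x _ /=.
  by rewrite expr0n/= addr0 sqrtr0 expr0n.
move=> a f g /asboolP f2 /asboolP g2; apply/asboolP.
exact: square_integrableD (square_integrableZ a f2) g2.
Qed.

HB.instance Definition _ :=
  GRing.isSubmodClosed.Build R[i] (T -> R[i]) L2pred L2pred_submod_closed.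

Record L2fun := MkL2fun { L2val :> T -> R[i]; L2valP : L2val \in L2pred }.

HB.instance Definition _ := [isSub for L2val].
HB.instance Definition _ := [Choice of L2fun by <:].
HB.instance Definition _ := [SubChoice_isSubLmodule of L2fun by <:].

Definition L2null : {pred L2fun} :=
  fun f => `[< {ae mu, forall x, f x = 0} >].

Lemma L2null_zmod_closed : zmod_closed L2null.
Proof.
split; first by apply/asboolP/aeW.
move=> f g /asboolP f0 /asboolP g0; apply/asboolP.
by apply: filterS2 f0 g0 => x /= fx gx; rewrite !fctE fx gx subr0.
Qed.

HB.instance Definition _ :=
  GRing.isZmodClosed.Build L2fun L2null L2null_zmod_closed.

Definition L2 := Quotient.quot L2null.
HB.instance Definition _ := GRing.Zmodule.on L2.
HB.instance Definition _ := EqQuotient.on L2.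

Definition L2class (f : L2fun) : L2 := \pi f.

Definition L2repr (F : L2) : T -> R[i] := L2val (repr F).
Coercion L2repr : L2 >-> Funclass.

Definition L2represents (F : L2) (f : T -> R[i]) : Prop :=
  {ae mu, forall x, F x = f x}.

Lemma L2class_eqP (f g : L2fun) :
  L2class f = L2class g <-> {ae mu, forall x, f x = g x}.
Proof.
rewrite /L2class; split.
  move=> /eqP; rewrite -Quotient.idealrBE => /asboolP.
  by apply: filterS => x /= /eqP; rewrite !fctE subr_eq0 => /eqP.
move=> fg; apply/eqP; rewrite -Quotient.idealrBE; apply/asboolP.
by apply: filterS fg => x /= fgx; rewrite !fctE fgx subrr.
Qed.

Lemma L2classK (f : L2fun) : {ae mu, forall x, L2class f x = f x}.
Proof. by apply/L2class_eqP; rewrite /L2class reprK. Qed.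

Definition L2scale (a : R[i]) (F : L2) : L2 := L2class (a *: repr F).

Lemma L2scaleE a f : L2scale a (L2class f) = L2class (a *: f).
Proof.
apply/L2class_eqP; apply: filterS (L2classK f) => x /= fx.
by rewrite !fctE -[X in _ *: X = _]/(L2class f x) fx.
Qed.

Lemma L2classD f g : L2class (f + g) = L2class f + L2class g.
Proof. exact: Quotient.pi_add. Qed.

Lemma L2class_repr F : L2class (repr F) = F. Proof. exact: reprK. Qed.

Lemma L2scaleA a b F : L2scale a (L2scale b F) = L2scale (a * b) F.
Proof. by rewrite -[F]L2class_repr !L2scaleE scalerA. Qed.

Lemma L2scale1 : left_id 1 L2scale.
Proof. by move=> F; rewrite -[F]L2class_repr !L2scaleE scale1r. Qed.

Lemma L2scaleDr : right_distributive L2scale +%R.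
Proof.
move=> a F G; rewrite -[F]L2class_repr -[G]L2class_repr.
by rewrite -L2classD !L2scaleE scalerDr L2classD.
Qed.

Lemma L2scaleDl F : {morph L2scale^~ F : a b / a + b}.
Proof.
by move=> a b; rewrite -[F]L2class_repr !L2scaleE scalerDl L2classD.
Qed.

HB.instance Definition _ :=
  GRing.Zmodule_isLmodule.Build R[i] L2 L2scaleA L2scale1 L2scaleDr L2scaleDl.

Definition L2dot (F G : L2) : R[i] :=
  cintegral mu (fun x => F x * Num.conj (G x)).

Lemma L2P (F : L2) : square_integrable mu F.
Proof. exact/asboolP/L2valP. Qed.

Lemma L2D_ae (F G : L2) : {ae mu, forall x, L2repr (F + G) x = F x + G x}.
Proof.
have -> : F + G = L2class (repr F + repr G) by rewrite L2classD !L2class_repr.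
exact: L2classK.
Qed.

Lemma L2Z_ae a (F : L2) : {ae mu, forall x, L2repr (a *: F) x = a * F x}.
Proof. exact: (L2classK (a *: repr F)). Qed.

Lemma L2dotC F G : L2dot F G = (-1) ^+ false * Num.conj (L2dot G F).
Proof.
rewrite mul1r -cintegralJ; last exact: cintegrableM (L2P G) (L2P F).
congr cintegral; apply/funext => x.
by rewrite rmorphM [RHS]mulrC; congr (_ * _); exact/esym/conjCK.
Qed.

Lemma L2dotPl G : linear_for *%R (L2dot^~ G).
Proof.
move=> a F F'; rewrite /L2dot -cintegralZ; last exact: cintegrableM (L2P _) (L2P _).
rewrite -cintegralD; last 2 first.
- have := cintegrableM (square_integrableZ a (L2P F)) (L2P G).
  by congr cintegrable; apply/funext => x; rewrite mulrA.
- exact: cintegrableM (L2P _) (L2P _).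
apply: ae_eq_cintegral; first exact: cintegrableM (L2P _) (L2P _).
  rewrite (_ : (fun _ => _) = (fun x => (a * L2repr F x + L2repr F' x) * Num.conj (L2repr G x))).
    by apply: cintegrableM (L2P _) => //; apply: square_integrableD (L2P _);
      exact: square_integrableZ (L2P _).
  by apply/funext => x; rewrite mulrDl mulrA.
apply: filterS2 (L2Z_ae a F) (L2D_ae (a *: F) F') => x e1 ->.
by rewrite e1 mulrDl mulrA.
Qed.

Lemma L2dotPr F : linear_for (Num.conj \; *%R) (L2dot F).
Proof.
move=> a G G'; rewrite L2dotC mul1r L2dotPl rmorphD rmorphM /=.
by rewrite [L2dot F G]L2dotC [L2dot F G']L2dotC !mul1r.
Qed.

Lemma L2dot_gt0 (F : L2) : F != 0 -> 0 < L2dot F F.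
Proof.
move=> F0; have /square_integrableE[mF iF] := L2P F.
have F2 x : F x * Num.conj (F x) = (normc (F x) ^+ 2)%:C%C.
  rewrite sqr_normcE; case: (F x) => a b.
  by apply/eqP; rewrite eq_complex /=; apply/andP; split; apply/eqP; ring.
have -> : L2dot F F = (\int[mu]_x (normc (F x) ^+ 2))%:C%C.
  rewrite /L2dot /cintegral; congr Complex.
    by apply: eq_Rintegral => x _; rewrite F2.
  rewrite (@eq_Rintegral _ _ _ _ _ (cst 0)); last by move=> x _; rewrite F2.
  by rewrite /Rintegral integral0.
rewrite ltcR lt_neqAle Rintegral_ge0 ?andbT; last by move=> x _; exact: sqr_ge0.
apply: contraNN F0 => /eqP/esym I0.
have : (\int[mu]_x `|(normc (F x) ^+ 2)%:E| = 0)%E.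
  under eq_integral do rewrite gee0_abs ?lee_fin ?sqr_ge0//.
  by rewrite -[LHS]fineK ?integrable_fin_num// -[fine _]/(Rintegral _ _ _) I0.
move/ae_eq_integral_abs => /(_ measurableT (measurable_sqr_normc mF)) F0.
have L20 : L2class 0 = 0.
  by apply: (addrI (L2class 0)); rewrite -L2classD !addr0.
apply/eqP; rewrite -[F]L2class_repr -L20; apply/L2class_eqP.
apply: filterS F0 => x /(_ I)/= [] /eqP.
by rewrite sqrf_eq0 => /eqP /eq0_normc.
Qed.

HB.instance Definition _ := isBilinear.Build R[i] L2 L2 R[i] _ _ L2dot
  (fun G => zmod_morphism_linear (L2dotPl G))
  (fun F => zmod_morphism_linear (L2dotPr F))
  (fun G => scalable_linear (L2dotPl G))
  (fun F => scalable_linear (L2dotPr F)).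
HB.instance Definition _ := isHermitianSesquilinear.Build R[i] L2 false Num.conj
  L2dot L2dotC.
HB.instance Definition _ := isDotProduct.Build R[i] L2 L2dot L2dot_gt0.
End L2.
Section Circle.
Variable R : realType.

Record circle : Type :=
  Circle { circle_val : R[i]; circle_norm : `|circle_val| = 1 }.

Lemma circle_inj (z w : circle) : circle_val z = circle_val w -> z = w.
Proof.
by case: z w => [z hz] [w hw] /= zw; subst w; congr Circle; exact: Prop_irrelevance.
Qed.

HB.instance Definition _ := gen_eqMixin circle.
HB.instance Definition _ := gen_choiceMixin circle.
HB.instance Definition _ := isPointed.Build circle (Circle (normr1 _)).
HB.instance Definition _ := Topological.copy circle
  (initial_topology (circle_val : circle -> R[i]^o)).
HB.instance Definition _ := Measurable.copy circle
  (g_sigma_algebraType (@open circle)).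

Lemma cis_norm (t : R) : `|Complex (cos t) (sin t)| = 1.
Proof. by rewrite normc_def /= cos2Dsin2 sqrtr1. Qed.

Definition expi (t : R) : circle := Circle (cis_norm (2 * pi * t)).

Lemma measurable_expi : measurable_fun [set: R] expi.
Proof.
apply: (@measurability _ _ _ _ _ _ (@open circle)) => // _ [B [V oV <-] <-].
rewrite setTI; apply: open_measurable.
have /continuousP : continuous (circle_val \o expi : R -> R[i]^o); last by exact.
move=> x; apply/(@cvgrPdist_lt _ R[i]^o) => /= -[r s].
rewrite ltcE /= => /andP[/eqP -> r0].
have c2 : continuous (fun t : R => 2 * pi * t).
  by move=> t; apply: cvgM; [exact: cvg_cst|exact: cvg_id].
have cc : (fun t : R => cos (2 * pi * t)) @ x --> cos (2 * pi * x).
  exact: (continuous_comp (@c2 x) (@continuous_cos _ _)).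
have cs : (fun t : R => sin (2 * pi * t)) @ x --> sin (2 * pi * x).
  exact: (continuous_comp (@c2 x) (@continuous_sin _ _)).
have r2 : 0 < r / 2 by rewrite divr_gt0.
move/cvgrPdist_lt : cc => /(_ _ r2) cc; move/cvgrPdist_lt : cs => /(_ _ r2) cs.
near=> t; rewrite normc_def ltcR /=.
rewrite -(ltr_pXn2r (n := 2)) ?nnegrE ?sqrtr_ge0 ?(ltW r0)//.
rewrite sqr_sqrtr ?addr_ge0 ?sqr_ge0//.
have : `|cos (2 * pi * x) - cos (2 * pi * t)| < r / 2 by near: t.
have : `|sin (2 * pi * x) - sin (2 * pi * t)| < r / 2 by near: t.
rewrite -(real_normK (num_real (cos _ - _))) -(real_normK (num_real (sin _ - _))).
move: (normr_ge0 (cos (2 * pi * x) - cos (2 * pi * t))).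
move: (normr_ge0 (sin (2 * pi * x) - sin (2 * pi * t))).
by move=> ? ? ? ?; nra.
Unshelve. all: by end_near. Qed.

Definition circle_measure : set circle -> \bar R :=
  pushforward (mrestr lebesgue_measure (measurable_itv (`[0, 1] : interval R))) expi.


Let circle_measure0 : circle_measure set0 = 0%E.
Proof. by have mf := measurable_expi; exact: measure0. Qed.

Let circle_measure_ge0 A : (0 <= circle_measure A)%E.
Proof. by have mf := measurable_expi; exact: measure_ge0. Qed.

Let circle_measure_sigma_additive : semi_sigma_additive circle_measure.
Proof. by have mf := measurable_expi; exact: measure_semi_sigma_additive. Qed.

HB.instance Definition _ := isMeasure.Build _ _ _ circle_measure
  circle_measure0 circle_measure_ge0 circle_measure_sigma_additive.

Let circle_measure_setT : circle_measure setT = 1%E.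
Proof.
rewrite /circle_measure /pushforward /mrestr preimage_setT setTI.
by rewrite lebesgue_measure_itv/= lte01 oppr0 adde0.
Qed.

HB.instance Definition _ := Measure_isProbability.Build _ _ _ circle_measure
  circle_measure_setT.

End Circle.

Section Solenoid.
Variables (R : realType) (N : nat).

Record solenoid : Type := Solenoid {
  solenoid_val :> int -> R[i] ;
  solenoidP : forall n : int,
    solenoid_val (n + 1) ^+ N = solenoid_val n /\ `|solenoid_val n| = 1 }.

Lemma solenoid_inj (z w : solenoid) : solenoid_val z =1 solenoid_val w -> z = w.
Proof.
case: z w => [z hz] [w hw] /= /funext zw; subst w.
by congr Solenoid; exact: Prop_irrelevance.
Qed.

Fact solenoid_mul_subproof (z w : solenoid) (n : int) :
  (z (n + 1) * w (n + 1)) ^+ N = z n * w n /\ `|z n * w n| = 1.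
Proof.
have [z1 z2] := solenoidP z n; have [w1 w2] := solenoidP w n.
by rewrite exprMn z1 w1 normrM z2 w2 mul1r.
Qed.

Fact solenoid_one_subproof (n : int) : 1 ^+ N = 1 :> R[i] /\ `|1 : R[i]| = 1.
Proof. by rewrite expr1n normr1. Qed.

Fact solenoid_inv_subproof (z : solenoid) (n : int) :
  (z (n + 1))^-1 ^+ N = (z n)^-1 /\ `|(z n)^-1| = 1.
Proof. by have [z1 z2] := solenoidP z n; rewrite exprVn z1 normfV z2 invr1. Qed.

Definition solenoid_mul z w := Solenoid (solenoid_mul_subproof z w).
Definition solenoid_one := Solenoid solenoid_one_subproof.
Definition solenoid_inv z := Solenoid (solenoid_inv_subproof z).

Lemma solenoid_neq0 (z : solenoid) n : z n != 0.
Proof. by rewrite -normr_eq0 (solenoidP z n).2 oner_neq0. Qed.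

Fact solenoid_mulA : associative solenoid_mul.
Proof. by move=> x y z; apply: solenoid_inj => n /=; rewrite mulrA. Qed.

Fact solenoid_mul1g : left_id solenoid_one solenoid_mul.
Proof. by move=> z; apply: solenoid_inj => n /=; rewrite mul1r. Qed.

Fact solenoid_mulg1 : right_id solenoid_one solenoid_mul.
Proof. by move=> z; apply: solenoid_inj => n /=; rewrite mulr1. Qed.

Fact solenoid_mulVg : left_inverse solenoid_one solenoid_inv solenoid_mul.
Proof.
by move=> z; apply: solenoid_inj => n /=; rewrite mulVf// solenoid_neq0.
Qed.

Fact solenoid_mulgV : right_inverse solenoid_one solenoid_inv solenoid_mul.
Proof.
by move=> z; apply: solenoid_inj => n /=; rewrite mulfV// solenoid_neq0.
Qed.

HB.instance Definition _ := gen_eqMixin solenoid.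
HB.instance Definition _ := gen_choiceMixin solenoid.
HB.instance Definition _ := isPointed.Build solenoid solenoid_one.
HB.instance Definition _ := isGroup.Build solenoid solenoid_mulA
  solenoid_mul1g solenoid_mulg1 solenoid_mulVg solenoid_mulgV.
HB.instance Definition _ := Topological.copy solenoid
  (initial_topology (solenoid_val : solenoid -> prod_topology (fun _ : int => R[i]^o))).
HB.instance Definition _ := Measurable.copy solenoid
  (g_sigma_algebraType (@open solenoid)).

Fact solenoid_shift_subproof (z : solenoid) (n : int) :
  z (n + 1 - 1) ^+ N = z (n - 1) /\ `|z (n - 1)| = 1.
Proof. by have := solenoidP z (n - 1); rewrite subrK addrK. Qed.

Definition solenoid_shift (z : solenoid) : solenoid :=
  @Solenoid (fun n => z (n - 1)) (solenoid_shift_subproof z).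

(* By compactness, invariance under left translations and total mass 1
   determine [mu]; regularity is automatic, [solenoid] being metrizable. *)
Definition is_haar (mu : probability solenoid R) : Prop :=
  forall (g : solenoid) (A : set solenoid), measurable A ->
    mu [set (g * z)%g | z in A] = mu A.

End Solenoid.

Section Presentation.
Variables (X : choiceType).
Definition word := seq (X * bool).
Variable rels : word -> word -> Prop.

Inductive pres_eq : word -> word -> Prop :=
| pres_refl v : pres_eq v v
| pres_sym v w : pres_eq v w -> pres_eq w v
| pres_trans w v x : pres_eq v w -> pres_eq w x -> pres_eq v x
| pres_cancel a x e b : pres_eq (a ++ [:: (x, e), (x, ~~ e) & b]) (a ++ b)
| pres_rel a v w b : rels v w -> pres_eq (a ++ v ++ b) (a ++ w ++ b).

Definition pres_eqb : rel word := fun v w => `[< pres_eq v w >].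

Fact pres_eqb_equiv : equiv_class_of pres_eqb.
Proof.
split=> [v|v w|w v x]; first exact/asboolP/pres_refl.
  by apply/asboolP/asboolP => /pres_sym.
by move=> /asboolP vw /asboolP wx; apply/asboolP; exact: pres_trans wx.
Qed.

Local Open Scope quotient_scope.
Canonical pres_equiv := EquivRelPack pres_eqb_equiv.

Definition presented : Type := {eq_quot pres_eqb}.
HB.instance Definition _ := Choice.on presented.
HB.instance Definition _ := EqQuotient.on presented.

Definition pres_class (v : word) : presented := \pi v.

Lemma pres_classP v w : pres_class v = pres_class w <-> pres_eq v w.
Proof.
rewrite /pres_class; split; first by move/eqmodP/asboolP.
by move=> vw; apply/eqmodP/asboolP.
Qed.

Lemma pres_class_repr (g : presented) : pres_class (repr g) = g.
Proof. exact: reprK. Qed.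

Lemma pres_eq_catl a v w : pres_eq v w -> pres_eq (a ++ v) (a ++ w).
Proof.
elim=> {v w} [v|v w _|v w x _ h _|b x e c|b v w c h].
- exact: pres_refl.
- exact: pres_sym.
- exact: pres_trans.
- by rewrite !catA; exact: pres_cancel.
- by rewrite !catA -!(catA _ _ c); exact: pres_rel.
Qed.

Lemma pres_eq_catr a v w : pres_eq v w -> pres_eq (v ++ a) (w ++ a).
Proof.
elim=> {v w} [v|v w _|v w x _ h _|b x e c|b v w c h].
- exact: pres_refl.
- exact: pres_sym.
- exact: pres_trans.
- by rewrite -!catA /=; exact: pres_cancel.
- by rewrite -!catA; exact: pres_rel.
Qed.

Definition word_inv (v : word) : word := rev [seq (l.1, ~~ l.2) | l <- v].

Lemma word_invK : involutive word_inv.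
Proof.
move=> v; rewrite /word_inv map_rev revK -map_comp map_id_in// => -[x e] _ /=.
by rewrite negbK.
Qed.

Lemma word_inv_cat v w : word_inv (v ++ w) = word_inv w ++ word_inv v.
Proof. by rewrite /word_inv map_cat rev_cat. Qed.

Lemma pres_mulwV v : pres_eq (v ++ word_inv v) [::].
Proof.
elim: v => [|[x e] v IH]; first exact: pres_refl.
rewrite -cat1s word_inv_cat -catA.
apply: (@pres_trans ([:: (x, e)] ++ [:: (x, ~~ e)])).
  by apply: pres_eq_catl; rewrite catA; exact: (pres_eq_catr _ IH).
exact: (pres_cancel [::] x e [::]).
Qed.

Lemma pres_mulVw v : pres_eq (word_inv v ++ v) [::].
Proof. by rewrite -{2}[v]word_invK; exact: pres_mulwV. Qed.

Lemma pres_eq_inv v w : pres_eq v w -> pres_eq (word_inv v) (word_inv w).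
Proof.
move=> vw.
apply: (@pres_trans (word_inv v ++ (w ++ word_inv w))).
  rewrite -{1}[word_inv v]cats0; apply: pres_eq_catl.
  exact/pres_sym/pres_mulwV.
rewrite catA -[X in pres_eq _ X]cat0s; apply: pres_eq_catr.
apply: pres_trans (pres_mulVw v).
exact/pres_eq_catl/pres_sym.
Qed.

Definition pres_mul (g h : presented) : presented :=
  pres_class (repr g ++ repr h).
Definition pres_one : presented := pres_class [::].
Definition pres_inv (g : presented) : presented := pres_class (word_inv (repr g)).

Lemma pres_mulE v w : pres_mul (pres_class v) (pres_class w) = pres_class (v ++ w).
Proof.
apply/pres_classP; apply: (@pres_trans (v ++ repr (pres_class w))).
  by apply: pres_eq_catr; apply/pres_classP; rewrite pres_class_repr.
by apply: pres_eq_catl; apply/pres_classP; rewrite pres_class_repr.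
Qed.

Lemma pres_invE v : pres_inv (pres_class v) = pres_class (word_inv v).
Proof.
by apply/pres_classP/pres_eq_inv/pres_classP; rewrite pres_class_repr.
Qed.

Fact pres_mulA : associative pres_mul.
Proof.
move=> g h k; rewrite -[g]pres_class_repr -[h]pres_class_repr.
by rewrite -[k]pres_class_repr !pres_mulE catA.
Qed.

Fact pres_mul1g : left_id pres_one pres_mul.
Proof. by move=> g; rewrite -[g]pres_class_repr pres_mulE. Qed.

Fact pres_mulg1 : right_id pres_one pres_mul.
Proof. by move=> g; rewrite -[g]pres_class_repr pres_mulE cats0. Qed.

Fact pres_mulVg : left_inverse pres_one pres_inv pres_mul.
Proof.
move=> g; rewrite -[g]pres_class_repr pres_invE pres_mulE.
exact/pres_classP/pres_mulVw.
Qed.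

Fact pres_mulgV : right_inverse pres_one pres_inv pres_mul.
Proof.
move=> g; rewrite -[g]pres_class_repr pres_invE pres_mulE.
exact/pres_classP/pres_mulwV.
Qed.

HB.instance Definition _ := isGroup.Build presented
  pres_mulA pres_mul1g pres_mulg1 pres_mulVg pres_mulgV.

Lemma pres_classM v w :
  (pres_class v * pres_class w)%g = pres_class (v ++ w).
Proof. exact: pres_mulE. Qed.

Definition pres_gen (x : X) : presented := pres_class [:: (x, true)].

End Presentation.

(* The letter [(x, e)] is the generator [x] if [e], its inverse otherwise;
   here [true] is the generator [u] and [false] is the generator [t]. *)
Inductive BS_rel (N : nat) : word bool -> word bool -> Prop :=
  BS_relator : BS_rel N [:: (true, true); (false, true); (true, false)]
                        (nseq N (false, true)).

Definition BS (N : nat) : Type := presented (BS_rel N).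
HB.instance Definition _ N := Group.on (BS N).
Definition BS_u (N : nat) : BS N := pres_gen (BS_rel N) true.
Definition BS_t (N : nat) : BS N := pres_gen (BS_rel N) false.

Lemma BS_relation N : (BS_u N * BS_t N * (BS_u N)^-1 = BS_t N ^+ N)%g.
Proof.
have pw k : (BS_t N ^+ k)%g = pres_class (BS_rel N) (nseq k (false, true)).
  by elim: k => // k IH; rewrite expgS IH; exact: pres_classM.
rewrite pw.
have -> : ((BS_u N)^-1)%g = pres_class (BS_rel N) [:: (true, false)].
  exact: pres_invE.
have M v w : ((pres_class (BS_rel N) v : BS N) *
    (pres_class (BS_rel N) w : BS N) = pres_class (BS_rel N) (v ++ w))%g.
  exact: pres_classM.
rewrite /BS_u /BS_t /pres_gen !M.
apply/pres_classP.
by have := @pres_rel _ _ [::] _ _ [::] (BS_relator N); rewrite /= cats0.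
Qed.

Section Hilbert.
Variables (R : realType) (H : lmodType R[i]) (dot : {dot H for Num.conj}).
Implicit Types (x y : H) (u : nat -> H) (A : H -> H) (V : set H).

Definition hnorm x : R := Num.sqrt (Re (dot x x)).

Definition hcvg u x : Prop := hnorm (u n - x) @[n --> \oo] --> (0 : R).

Definition hcauchy u : Prop :=
  forall e : R, 0 < e ->
    exists k, forall m n, (k <= m)%N -> (k <= n)%N -> hnorm (u m - u n) < e.

Definition hilbert : Prop := forall u, hcauchy u -> exists x, hcvg u x.

Definition closed_subspace V : Prop :=
  [/\ V 0,
      forall (a : R[i]) x y, V x -> V y -> V (a *: x + y) &
      forall u x, (forall n, V (u n)) -> hcvg u x -> V x].

Definition bounded_operator A : Prop :=
  linear A /\ exists M : R, forall x, hnorm (A x) <= M * hnorm x.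

Definition unitary_operator A : Prop :=
  [/\ linear A, forall x y, dot (A x) (A y) = dot x y &
      forall y, exists x, A x = y].

Definition orthogonal_projection A : Prop :=
  [/\ linear A, forall x, A (A x) = A x &
      forall x y, dot (A x) y = dot x (A y)].

Section Representation.
Variables (G : groupType) (rho : G -> H -> H).

Definition unitary_representation : Prop :=
  [/\ hilbert, forall g, unitary_operator (rho g),
      forall x, rho 1%g x = x &
      forall g h x, rho (g * h)%g x = rho g (rho h x)].

Definition cyclic_vector x : Prop :=
  forall V, closed_subspace V -> (forall g, V (rho g x)) -> V = setT.

Definition irreducible_representation : Prop :=
  (exists x, x != 0) /\
  forall V, closed_subspace V -> (forall g x, V x -> V (rho g x)) ->
    V = [set 0] \/ V = setT.

End Representation.

(* [pvm_scalar x] is the scalar measure [E_{x,x} = <E(.) x | x>]; having it in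
   [{measure set _ -> \bar R}] is the countable additivity of [E]. *)
Record pvm : Type := PVM {
  pvm_proj :> set (circle R) -> H -> H ;
  pvm_scalar : H -> {measure set (circle R) -> \bar R} ;
  pvm_orth : forall B, measurable B -> orthogonal_projection (pvm_proj B) ;
  pvm_setT : forall x, pvm_proj setT x = x ;
  pvm_setI : forall B C, measurable B -> measurable C ->
    forall x, pvm_proj (B `&` C) x = pvm_proj B (pvm_proj C x) ;
  pvm_scalarE : forall x B, measurable B ->
    pvm_scalar x B = (Re (dot (pvm_proj B x) x))%:E }.

(* [A] is the operator [\int f dE], which its quadratic form determines because
   [H] is complex. *)
Definition is_pvm_integral (E : pvm) (f : circle R -> R[i]) A : Prop :=
  bounded_operator A /\ forall x, dot (A x) x = cintegral (pvm_scalar E x) f.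

Definition is_spectral_measure A (E : pvm) : Prop :=
  is_pvm_integral E (@circle_val R) A.

Definition pvm_abs_continuous (E : pvm) : Prop :=
  forall B, measurable B -> circle_measure B = 0%E -> forall x, E B x = 0.

End Hilbert.

Section Wavelet.
Variable R : realType.
Implicit Types f : circle R -> R[i].

Definition Linfty f : Prop :=
  cmeasurable f /\
  exists M : R, {ae @circle_measure R, forall z, normc (f z) <= M}.

Definition quadrature_mirror (N : nat) (m0 : circle R -> R[i]) : Prop :=
  Linfty m0 /\
  {ae @circle_measure R, forall z : circle R,
    N%:R^-1 * \sum_(w \in [set w : circle R | circle_val w ^+ N = circle_val z])
      normc (m0 w) ^+ 2 = 1}.

Definition wavelet_representation (N : nat) (m0 : circle R -> R[i])
    (H : lmodType R[i]) (dot : {dot H for Num.conj})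
    (rho : BS N -> H -> H) (phi : H) : Prop :=
  [/\ quadrature_mirror N m0,
      unitary_representation dot rho,
      cyclic_vector dot rho phi &
      exists (E : pvm dot) (pi_ : (circle R -> R[i]) -> H -> H),
        [/\ is_spectral_measure (rho (BS_t N)) E,
            pvm_abs_continuous E,
            forall f, Linfty f -> is_pvm_integral E f (pi_ f),
            rho (BS_u N) phi = pi_ m0 phi &
            forall f, Linfty f ->
              dot (pi_ f phi) phi = cintegral (@circle_measure R) f]].

End Wavelet.

(* Main.v *)
(* A bounded function class closed under linear combinations, bounded pointwise
   limits and multiplication by the characters z |-> z_n^k is closed under
   multiplication by every indicator function, since (1 - f^m)^(2^m) tends to the
   indicator of {f < 1/2} for 0 <= f <= 1. This is the only density argument
   needed. It shows first that a finite measure on the solenoid is determined by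
   its Fourier coefficients. A Haar measure has coefficient 0 at every nontrivial
   character (translate by a point of the one-parameter subgroup
   n |-> exp(2 pi i s N^-n) where the character is -1), so it is shift invariant
   and its image under z |-> z_0 is Lebesgue measure, which yields the unitaries
   and the spectral measure. The shift is ergodic: the coefficients of an
   invariant set are constant along the infinite orbits of the nontrivial
   characters, hence vanish by Bessel's inequality.

   Conjugating T by powers of U gives multiplication by every z_n, so a closed
   subspace V invariant under the group is stable under multiplication by
   indicators, hence by all of L-infinity. If 1 is in V, then V is everything:
   this is cyclicity. If V contains F <> 0, it contains the indicator of some
   {|F|^2 > c} of positive measure, hence that of the union of its shifts, which
   has full measure by ergodicity; so V contains 1: this is irreducibility. *)
From HB Require Import structures.
Require Import Defs.
From mathcomp Require Import all_boot all_order all_algebra.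
From mathcomp Require Import all_classical all_reals all_analysis.
From mathcomp Require Import measurable_realfun complex separable zify ring lra.
Set Implicit Arguments.
Unset Strict Implicit.
Unset Printing Implicit Defensive.
Import Order.TTheory GRing.Theory Num.Theory.
Import numFieldNormedType.Exports.
Import Normc.
Local Notation Re := complex.Re.
Local Notation Im := complex.Im.
Local Open Scope classical_set_scope.
Local Open Scope ring_scope.

(** * Bounded monotone classes *)

(** One abstract class [Q] of functions serves twice: as the bounded functions against which two
    measures agree, and as the square-integrable functions whose class lies in a closed subspace.
    The obstacle is that the second class need be neither an algebra nor known to contain the
    constants, so Stone-Weierstrass does not apply to it directly. Closure is therefore expressed
    through multipliers: real factors that map every [h] in [Q] back into [Q]. Multipliers do form
    an algebra, and factors bounded by 1 keep each product below the fixed |h|, which is exactly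
    what dominated convergence needs in both uses. The powers (1 - t^m)^(2^m) come from an
    elementary proof of the Stone-Weierstrass theorem: Bernoulli's inequality compares them with
    (2t)^m, whence the threshold 1/2. On the solenoid the coordinates z_n with n >= 0 suffice, each
    earlier coordinate being a power of a later one. This is why measurability, the topology and the
    invariant subspaces are all handled through natural indices. *)

Section PowerLimits.
Variable R : realType.
Implicit Types t : R.

Lemma bernoulli_ge n t : 0 <= t -> 1 + n%:R * t <= (1 + t) ^+ n.
Proof.
move=> t0; elim: n => [|n IH]; first by rewrite expr0 mul0r addr0.
rewrite exprS; apply: le_trans (ler_wpM2l _ IH); last lra.
rewrite -natr1; have := ler0n R n; nra.
Qed.

Lemma bernoulli_le n t : 0 <= t <= 1 -> 1 - n%:R * t <= (1 - t) ^+ n.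
Proof.
move=> /andP[t0 t1]; elim: n => [|n IH]; first by rewrite expr0 mul0r subr0.
rewrite exprS; apply: le_trans (ler_wpM2l _ IH); last lra.
rewrite -natr1; have := ler0n R n; nra.
Qed.

(** By Bernoulli the term lies between 1 - (2t)^n and 1, and 2t < 1. *)
Lemma cvg_step_lt t : 0 <= t < 2^-1 ->
  (1 - t ^+ n) ^+ (2 ^ n) @[n --> \oo] --> (1 : R).
Proof.
move=> /andP[t0 t1].
apply: (@squeeze_cvgr _ _ _ _ (fun n => 1 - (2 * t) ^+ n) (cst 1)).
- near=> n.
  have tn : 0 <= t ^+ n <= 1 by rewrite exprn_ge0// exprn_ile1//; lra.
  apply/andP; split.
    by have := bernoulli_le (2 ^ n) tn; rewrite natrX exprMn.
  by apply: exprn_ile1; lra.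
- rewrite -[X in _ --> X]subr0; apply: cvgB; first exact: cvg_cst.
  by apply: cvg_expr; rewrite ger0_norm; lra.
- exact: cvg_cst.
Unshelve. all: by end_near. Qed.

(** The term is at most (2t)^(-n), and 2t > 1. *)
Lemma cvg_step_gt t : 2^-1 < t <= 1 ->
  (1 - t ^+ n) ^+ (2 ^ n) @[n --> \oo] --> (0 : R).
Proof.
move=> /andP[t0 t1].
apply: (@squeeze_cvgr _ _ _ _ (cst 0) (fun n => (2 * t)^-1 ^+ n)).
- near=> n.
  have t00 : 0 <= t by lra.
  have tn : 0 <= t ^+ n <= 1 by rewrite exprn_ge0// exprn_ile1.
  apply/andP; split; first by apply: exprn_ge0; lra.
  have tn0 : 0 < (2 * t) ^+ n by apply: exprn_gt0; lra.
  rewrite exprVn -[leRHS]mul1r ler_pdivlMr//.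
  (* Bernoulli gives (2t)^n <= (1 + t^n)^(2^n), and the product of the two powers is (1 -
     t^(2n))^(2^n) <= 1. *)
  apply: (@le_trans _ _ ((1 - t ^+ n) ^+ (2 ^ n) * (1 + t ^+ n) ^+ (2 ^ n))).
    apply: ler_wpM2l; first by apply: exprn_ge0; lra.
    apply: le_trans (bernoulli_ge _ _); last lra.
    by rewrite natrX exprMn; lra.
  by rewrite -exprMn; apply: exprn_ile1; nra.
- exact: cvg_cst.
- apply: cvg_expr; rewrite ger0_norm ?invr_ge0; last lra.
  by rewrite invf_lt1; lra.
Unshelve. all: by end_near. Qed.

End PowerLimits.

Lemma cvg_indic_bigcup (X : Type) (R : realType) (F : nat -> set X) (x : X) :
  \1_(\bigcup_(i < n) F i) x @[n --> \oo] --> (\1_(\bigcup_i F i) x : R).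
Proof.
rewrite indicE; have [[i _ Fix]|nF] := pselect ((\bigcup_i F i) x).
  rewrite mem_set/=; last by exists i.
  apply: cvg_near_cst; near=> n.
  rewrite indicE mem_set//; exists i => //=.
  by near: n; exact: nbhs_infty_gt.
rewrite memNset//; apply: cvg_near_cst; near=> n.
by rewrite indicE memNset//= => -[i _ Fix]; apply: nF; exists i.
Unshelve. all: by end_near. Qed.

Section MonotoneClass.
Variables (X : Type) (R : realType) (Q : (X -> R[i]) -> Prop).
Hypothesis Qlin : forall (a : R[i]) f g, Q f -> Q g -> Q (fun x => a * f x + g x).
Hypothesis Qlim : forall (f : nat -> X -> R) (l : X -> R) h, Q h ->
  (forall n x, `|f n x| <= 1) -> (forall n, Q (fun x => (f n x)%:C%C * h x)) ->
  (forall x, f ^~ x @ \oo --> l x) -> Q (fun x => (l x)%:C%C * h x).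

(** Quantifying over every [h] in [Q] makes products of multipliers compositions, so multipliers
    form an algebra even when [Q] does not. *)
Definition multiplier (f : X -> R) : Prop :=
  forall h, Q h -> Q (fun x => (f x)%:C%C * h x).

Lemma multiplier_cst (c : R) : multiplier (fun=> c).
Proof.
move=> h Qh; have := Qlin (c - 1)%:C%C Qh Qh.
rewrite (_ : (fun x => _ + _) = (fun x => c%:C%C * h x))//.
by apply/funext => x; rewrite rmorphB rmorph1; ring.
Qed.

Lemma multiplierD f g : multiplier f -> multiplier g ->
  multiplier (fun x => f x + g x).
Proof.
move=> mf mg h Qh; have := Qlin 1 (mf _ Qh) (mg _ Qh).
rewrite (_ : (fun x => 1 * _ + _) = (fun x => (f x + g x)%:C%C * h x))//.
by apply/funext => x; rewrite rmorphD; ring.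
Qed.

Lemma multiplierM f g : multiplier f -> multiplier g ->
  multiplier (fun x => f x * g x).
Proof.
move=> mf mg h Qh; have := mf _ (mg _ Qh).
rewrite (_ : (fun x => _ * (_ * _)) = (fun x => (f x * g x)%:C%C * h x))//.
by apply/funext => x; rewrite rmorphM; ring.
Qed.

Lemma multiplierZ c f : multiplier f -> multiplier (fun x => c * f x).
Proof. exact: multiplierM (multiplier_cst c). Qed.

Lemma multiplierB f g : multiplier f -> multiplier g ->
  multiplier (fun x => f x - g x).
Proof.
move=> mf mg; have := multiplierD mf (multiplierZ (-1) mg).
rewrite (_ : (fun x => _) = (fun x => f x - g x))//.
by apply/funext => x; ring.
Qed.

Lemma multiplierX f n : multiplier f -> multiplier (fun x => f x ^+ n).
Proof.
move=> mf; elim: n => [|n IH]; first exact: multiplier_cst.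
have := multiplierM mf IH.
rewrite (_ : (fun x => _) = (fun x => f x ^+ n.+1))//.
by apply/funext => x; rewrite exprS.
Qed.

Lemma multiplier_lim (f : nat -> X -> R) l : (forall n x, `|f n x| <= 1) ->
  (forall n, multiplier (f n)) -> (forall x, f ^~ x @ \oo --> l x) ->
  multiplier l.
Proof. by move=> f1 mf fl h Qh; apply: (Qlim Qh f1) => // n; exact: mf. Qed.

(** The powers of 1 - (f - 1/2)^2 decrease to this indicator. The level 1/2 needs its own treatment
    because there (1 - t^n)^(2^n) tends to 1/e, neither 0 nor 1. *)
Lemma multiplier_eq_half (f : X -> R) : (forall x, 0 <= f x <= 1) ->
  multiplier f -> multiplier \1_[set x | f x = 2^-1].
Proof.
move=> f01 mf.
have s01 x : 0 <= (f x - 2^-1) ^+ 2 <= 1.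
  have /andP[? ?] := f01 x.
  by rewrite sqr_ge0 -real_normK ?num_real// exprn_ile1// ler_norml; lra.
apply: (@multiplier_lim (fun n x => (1 - (f x - 2^-1) ^+ 2) ^+ n)).
- move=> n x; have := s01 x => ?.
  by rewrite normrX exprn_ile1// ger0_norm; lra.
- move=> n; apply: multiplierX; apply: multiplierB; first exact: multiplier_cst.
  by apply: multiplierX; apply: multiplierB => //; exact: multiplier_cst.
- move=> x; rewrite indicE; have := s01 x => ?.
  have [e|ne] := eqVneq (f x) 2^-1.
    rewrite mem_set//= e subrr expr0n/= subr0.
    by under eq_fun do rewrite expr1n; exact: cvg_cst.
  rewrite memNset/=; last by move=> /eqP; rewrite (negbTE ne).
  apply: cvg_expr; rewrite ger0_norm; last lra.
  have : 0 < (f x - 2^-1) ^+ 2 by rewrite exprn_even_gt0//= subr_eq0.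
  lra.
Qed.

Lemma multiplier_lt_half (f : X -> R) : (forall x, 0 <= f x <= 1) ->
  multiplier f -> multiplier \1_[set x | f x < 2^-1].
Proof.
move=> f01 mf; have me := multiplier_eq_half f01 mf.
(* The second factor kills the level set {f = 1/2}, on which the step functions have the wrong
   limit. *)
apply: (@multiplier_lim (fun n x =>
    (1 - f x ^+ n) ^+ (2 ^ n) * (1 - \1_[set x | f x = 2^-1] x))).
- move=> n x; have /andP[f0 f1] := f01 x.
  have fn : 0 <= f x ^+ n <= 1 by rewrite exprn_ge0// exprn_ile1.
  rewrite normrM mulr_ile1//.
    by rewrite normrX exprn_ile1// ger0_norm; lra.
  by rewrite indicE; case: (_ \in _); rewrite ?subrr ?subr0 ?normr0 ?normr1.
- move=> n; apply: multiplierM.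
    apply: multiplierX; apply: multiplierB; first exact: multiplier_cst.
    exact: multiplierX.
  by apply: multiplierB => //; exact: multiplier_cst.
- move=> x; have /andP[f0 f1] := f01 x; rewrite !indicE.
  have [lt|gt|e] := ltgtP (f x) 2^-1.
  + rewrite memNset/=; last by move=> e; rewrite e ltxx in lt.
    rewrite mem_set// subr0; under eq_fun do rewrite mulr1.
    by apply: cvg_step_lt; rewrite f0.
  + rewrite memNset/=; last by move=> e; rewrite e ltxx in gt.
    rewrite memNset/=; last by rewrite ltNge (ltW gt).
    rewrite subr0; under eq_fun do rewrite mulr1.
    by apply: cvg_step_gt; rewrite gt.
  + rewrite mem_set// memNset/=; last by rewrite e ltxx.
    by rewrite subrr; under eq_fun do rewrite mulr0; exact: cvg_cst.
Qed.

Lemma multiplier_lt (f : X -> R) (M c : R) : (forall x, `|f x| <= M) ->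
  multiplier f -> multiplier \1_[set x | f x < c].
Proof.
(* Since |f - c| <= K/2, the function g = 1/2 + (f - c)/K takes values in [0, 1] and is below 1/2
   exactly where f < c; the summand 1 keeps K positive. *)
move=> fM mf; pose K := 2 * (`|M| + `|c| + 1).
have K0 : 0 < K by rewrite /K; have := normr_ge0 M; have := normr_ge0 c; lra.
pose g x := 2^-1 + K^-1 * (f x - c).
have KE : K^-1 * (2 * (`|M| + `|c| + 1)) = 1 by rewrite mulVf// gt_eqF.
have iK0 : 0 < K^-1 by rewrite invr_gt0.
have mg : multiplier g.
  apply: multiplierD; first exact: multiplier_cst.
  by apply: multiplierZ; apply: multiplierB => //; exact: multiplier_cst.
rewrite (_ : [set x | f x < c] = [set x | g x < 2^-1]).
  apply: multiplier_lt_half mg => x.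
  have : `|f x - c| <= `|M| + `|c| + 1.
    apply: le_trans (ler_normB _ _) _; have := fM x; have := ler_norm M; lra.
  by rewrite ler_norml /g => /andP[? ?]; apply/andP; split; nra.
apply/seteqP; split => x; rewrite /g /=.
  by move=> ?; nra.
by move=> h; have : K^-1 * (f x - c) < 0 by [lra]; rewrite pmulr_rlt0// subr_lt0.
Qed.

Definition multiplier_set (A : set X) : Prop := multiplier \1_A.

Lemma multiplier_setU A B : multiplier_set A -> multiplier_set B ->
  multiplier_set (A `|` B).
Proof.
move=> mA mB; have := multiplierB (multiplierD mA mB) (multiplierM mA mB).
rewrite (_ : (fun x => _) = \1_(A `|` B))//.
apply/funext => x; rewrite !indicE in_setU.
by case: (_ \in A); case: (_ \in B) => /=; ring.
Qed.

Lemma sigma_algebra_multiplier_set : sigma_algebra [set: X] multiplier_set.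
Proof.
split.
- have := multiplier_cst 0.
  by rewrite /multiplier_set (_ : (fun=> _) = \1_set0)//; apply/funext => x; rewrite indic0.
- move=> A mA; have := multiplierB (multiplier_cst 1) mA.
  rewrite /multiplier_set (_ : (fun x => _) = \1_([set: X] `\` A))//.
  apply/funext => x; rewrite !indicE setTD in_setC.
  by case: (_ \in A) => /=; ring.
- move=> F mF.
  have mU n : multiplier_set (\bigcup_(i < n) F i).
    elim: n => [|n IH].
      rewrite bigcup_mkord big_ord0.
      have := multiplier_cst 0.
      by rewrite /multiplier_set (_ : (fun=> _) = \1_set0)//; apply/funext => x; rewrite indic0.
    by rewrite bigcup_mkord big_ord_recr/= -bigcup_mkord; exact: multiplier_setU.
  apply: (@multiplier_lim (fun n => \1_(\bigcup_(i < n) F i))) => //.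
    by move=> n x; rewrite indicE ger0_norm// lern1; case: (_ \in _).
  by move=> x; exact: cvg_indic_bigcup.
Qed.

End MonotoneClass.

(** * Topology and Borel sets of the circle and the solenoid *)

Section Coordinates.
Variable R : realType.
Implicit Types z w : R[i].

(** The squared distance is polynomial in the real coordinates, so discs are sublevel sets of
    measurable functions and of multipliers without any square root. *)
Definition sqdist z w : R := (Re z - Re w) ^+ 2 + (Im z - Im w) ^+ 2.

Lemma sqdistE z w : sqdist z w = normc (z - w) ^+ 2.
Proof. by rewrite sqr_normcE; case: z w => a b [c d]. Qed.

Lemma normr_normc z : `|z| = (normc z)%:C%C.
Proof. by []. Qed.

Lemma normc_circle z : `|z| = 1 -> normc z = 1.
Proof. by rewrite normr_normc => -[]. Qed.

Lemma normc_ge0 z : 0 <= normc z.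
Proof. by case: z => a b; exact: sqrtr_ge0. Qed.

(** Second countability in concrete form: an open set is the countable union of the rational discs,
    in one of the coordinates [p n], that it contains. *)
Lemma open_coordinate_sigma (X : topologicalType) (p : nat -> X -> R[i])
    (S : set (set X)) : sigma_algebra setT S ->
  (forall O x, open O -> O x -> exists n (e : R), 0 < e /\
    forall y, sqdist (p n y) (p n x) < e -> O y) ->
  (forall n q r, S [set y | sqdist (p n y) q < r]) ->
  forall O, open O -> S O.
Proof.
move=> [S0 SC SU] pO pS O oO.
pose I := (nat * (rat * rat) * nat)%type.
pose B (i : I) : set X := [set y | sqdist (p i.1.1 y)
  (Complex (ratr i.1.2.1) (ratr i.1.2.2)) < i.2.+1%:R^-1].
(* Codes of no disc, and discs not contained in [O], contribute the empty set. *)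
pose F (m : nat) : set X := if unpickle m is Some i then
  if `[< B i `<=` O >] then B i else set0 else set0.
have -> : O = \bigcup_m F m.
  apply/seteqP; split => [x Ox|x [m _]]; last first.
    by rewrite /F; case: unpickle => // i; case: asboolP => // BO /BO.
  have [n [e [e0 nO]]] := pO O x oO Ox.
  have e40 : 0 < e / 4 by rewrite divr_gt0.
  pose k := Num.bound ((e / 4)^-1).
  (* If [p n x] and [p n y] are both within squared distance d of the centre, they are within 2d +
     2d = 4d < e of each other. The centre is chosen with error below d/2 in each real
     coordinate. *)
  have kd : k.+1%:R^-1 < e / 4.
    rewrite invf_plt ?posrE// ?ltr0n// -natr1.
    have /archi_boundP : 0 <= (e / 4)^-1 by rewrite invr_ge0 ltW.
    rewrite -/k; lra.
  set d : R := k.+1%:R^-1 in kd.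
  have d0 : 0 < d by rewrite invr_gt0 ltr0n.
  have sd1 : 0 < Num.sqrt (d / 2) by rewrite sqrtr_gt0 divr_gt0.
  have sd2 : Num.sqrt (d / 2) ^+ 2 = d / 2 by rewrite sqr_sqrtr// ltW// divr_gt0.
  move: sd1 sd2; set s := Num.sqrt _ => s0 s2.
  have rd (t : R) : exists a : rat, (t - ratr a) ^+ 2 < d / 2.
    have /rat_in_itvoo[a] : t - s < t + s by lra.
    by rewrite in_itv/= => /andP[? ?]; exists a; rewrite -s2; nra.
  have [a ha] := rd (Re (p n x)); have [b hb] := rd (Im (p n x)).
  exists (pickle ((n, (a, b), k) : I)) => //.
  rewrite /F pickleK asboolT; first by rewrite /B/= /sqdist/= -/d; lra.
  move=> y; rewrite /B/= -/d /sqdist/= => yd; apply: nO; rewrite /sqdist.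
  move: (Re (p n x)) (Re (p n y)) (Im (p n x)) (Im (p n y)) ha hb yd.
  move: (ratr a) (ratr b) => {}a {}b x1 y1 x2 y2 ha hb yd.
  have : (y1 - x1) ^+ 2 <= 2 * (y1 - a) ^+ 2 + 2 * (x1 - a) ^+ 2.
    by have := sqr_ge0 (y1 - a + (x1 - a)); nra.
  have : (y2 - x2) ^+ 2 <= 2 * (y2 - b) ^+ 2 + 2 * (x2 - b) ^+ 2.
    by have := sqr_ge0 (y2 - b + (x2 - b)); nra.
  lra.
apply: SU => m; rewrite /F; case: unpickle => [i|]; last exact: S0.
by case: asboolP => _; [exact: pS|exact: S0].
Qed.

Lemma nbhs_sqdist (z : R[i]) (A : set R[i]) :
  nbhs (z : R[i]^o) A ->
  exists2 e : R, 0 < e & forall w, sqdist w z < e -> A w.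
Proof.
(* Radii of balls in [R[i]] are themselves complex; positivity forces the imaginary part to
   vanish. *)
move=> /nbhs_ballP[/= [e e']]; rewrite ltcE /= => /andP[/eqP -> e0] zA.
exists (e ^+ 2) => [|w wz]; first by rewrite exprn_gt0.
apply: zA; rewrite /ball/= normr_normc ltcR.
rewrite -(ltr_pXn2r (n := 2)) ?nnegrE ?normc_ge0 ?(ltW e0)//.
by rewrite -sqdistE /sqdist -sqrrN opprB -[X in _ + X]sqrrN opprB.
Qed.

Lemma circle_nbhs (O : set (circle R)) (z : circle R) : open O -> O z ->
  exists2 e : R, 0 < e &
    forall w : circle R, sqdist (circle_val w) (circle_val z) < e -> O w.
Proof.
move=> [V oV <-] Vz.
have /nbhs_sqdist[e e0 he] : nbhs (circle_val z : R[i]^o) V.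
  exact: open_nbhs_nbhs.
by exists e => // w /he.
Qed.

(** On the unit circle the k-th power is k-Lipschitz; hence a coordinate of the solenoid is
    controlled by any later one. *)
Lemma normc_subX (k : nat) z w : normc z = 1 -> normc w = 1 ->
  normc (z ^+ k - w ^+ k) <= k%:R * normc (z - w).
Proof.
move=> z1 w1; elim: k => [|k IH]; first by rewrite !expr0 subrr normc0 mul0r.
have -> : z ^+ k.+1 - w ^+ k.+1 = z ^+ k * (z - w) + (z ^+ k - w ^+ k) * w.
  by rewrite !exprSr; ring.
apply: le_trans (le_normcD _ _) _; rewrite !normcM w1 mulr1.
have -> : normc (z ^+ k) = 1.
  by elim: (k) => [|j IHj]; rewrite ?expr0 ?normc1// exprS normcM z1 IHj mulr1.
by rewrite mul1r -natr1 mulrDl mul1r addrC lerD2r.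
Qed.

Variable N : nat.
Hypothesis N0 : (0 < N)%N.
Local Notation sol := (solenoid R N).
Implicit Types x y : sol.

Lemma solenoid_coordS x (i : int) (m : nat) : x i = x (i + m%:Z) ^+ (N ^ m).
Proof.
elim: m => [|m IH]; first by rewrite addr0 expr1.
rewrite IH expnS exprM; congr (_ ^+ _).
by rewrite -(solenoidP x (i + m%:Z)).1 -addrA [m%:Z + 1]addrC -intS.
Qed.

(** Because i <= |i|, each coordinate is a power of one with a natural index. *)
Lemma solenoid_coord_nat x (i : int) : x i = x (`|i|%N%:Z) ^+ (N ^ (absz (`|i|%N%:Z - i))).
Proof.
rewrite [LHS](solenoid_coordS x i (absz (`|i|%N%:Z - i))); congr (x _ ^+ _).
have : 0 <= `|i|%N%:Z - i by rewrite subr_ge0 abszE ler_norm.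
by move=> /gez0_abs ->; rewrite addrC subrK.
Qed.

(** It lives on the ambient product because the topology of the solenoid is induced from there. A
    single coordinate describes a basic neighbourhood, since it controls all the earlier ones. *)
Definition cylinder_filter x : set_system (prod_topology (fun _ : int => R[i]^o)) :=
  [set A | exists n (e : R), 0 < e /\
    forall y, sqdist (y (n : nat)%:Z) (x n%:Z) < e -> A (solenoid_val y)].

Lemma sqdist_coord x (n : nat) (m : nat) (e : R) : (n <= m)%N -> 0 < e ->
  exists2 e' : R, 0 < e' & forall y, sqdist (y m%:Z) (x m%:Z) < e' ->
    sqdist (y n%:Z) (x n%:Z) < e.
Proof.
move=> nm e0; pose K : R := (N ^ (m - n))%:R.
have K0 : 0 < K by rewrite ltr0n expn_gt0 N0.
exists (e / K ^+ 2) => [|y]; first by rewrite divr_gt0// exprn_gt0.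
rewrite !sqdistE ltr_pdivlMr ?exprn_gt0// -exprMn => yx.
have yn (w : sol) : w n%:Z = w m%:Z ^+ (N ^ (m - n)).
  by rewrite [LHS](solenoid_coordS w n%:Z (m - n)) -PoszD subnKC.
apply: le_lt_trans yx; rewrite !yn mulrC; apply: lerXn2r.
- by rewrite nnegrE normc_ge0.
- by rewrite nnegrE mulr_ge0 ?normc_ge0// ltW.
- by apply: normc_subX; apply: normc_circle; exact: (solenoidP _ _).2.
Qed.

Lemma cylinder_filter_filter x : Filter (cylinder_filter x).
Proof.
split.
- by exists 0%N, 1.
- move=> A B [n [e [e0 hA]]] [m [f [f0 hB]]].
  have [e' e'0 he] := sqdist_coord x (leq_maxl n m) e0.
  have [f' f'0 hf] := sqdist_coord x (leq_maxr n m) f0.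
  exists (maxn n m), (Num.min e' f'); split; first by rewrite lt_min e'0.
  by move=> y; rewrite lt_min => /andP[/he/hA ? /hf/hB ?].
- by move=> A B AB [n [e [e0 hA]]]; exists n, e; split => // y /hA /AB.
Qed.

(** Product convergence is tested one coordinate at a time, and coordinate i is a Lipschitz function
    of coordinate |i|. *)
Lemma cvg_cylinder_filter x :
  cylinder_filter x --> (solenoid_val x : prod_topology (fun _ : int => R[i]^o)).
Proof.
have FF := cylinder_filter_filter x.
apply/cvg_sup => i A [B [[V oV <-] Vx VA]].
have /nbhs_sqdist[e e0 he] : nbhs (solenoid_val x i : R[i]^o) V.
  exact: open_nbhs_nbhs.
pose K : R := (N ^ (absz (`|i|%N%:Z - i)))%:R.
have K0 : 0 < K by rewrite ltr0n expn_gt0 N0.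
exists `|i|%N, (e / K ^+ 2); split; first by rewrite divr_gt0// exprn_gt0.
move=> y yx; apply/VA/he; apply: le_lt_trans (_ : _ < e); last first.
  move: yx; rewrite sqdistE ltr_pdivlMr ?exprn_gt0// -exprMn; exact.
rewrite sqdistE !(solenoid_coord_nat _ i) mulrC; apply: lerXn2r.
- by rewrite nnegrE normc_ge0.
- by rewrite nnegrE mulr_ge0 ?normc_ge0// ltW.
- by apply: normc_subX; apply: normc_circle; exact: (solenoidP _ _).2.
Qed.

Lemma solenoid_nbhs (O : set sol) x : open O -> O x ->
  exists n (e : R), 0 < e /\
    forall y, sqdist (y (n : nat)%:Z) (x n%:Z) < e -> O y.
Proof.
move=> [V oV <-] Vx.
by apply: (cvg_cylinder_filter (open_nbhs_nbhs (conj oV Vx))).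
Qed.

End Coordinates.

Section Measurability.
Variable R : realType.
Implicit Types z w : R[i].

Lemma open_Re_gt (c : R) : open [set z : R[i]^o | c < Re z].
Proof.
rewrite openE => z /= cz; apply/nbhs_ballP; exists (Re z - c)%:C%C => /=.
  by rewrite ltcR subr_gt0.
move=> w; rewrite /ball/= normr_normc ltcR => zw.
have : (Re z - Re w) ^+ 2 <= normc (z - w) ^+ 2.
  by rewrite -sqdistE /sqdist lerDl sqr_ge0.
rewrite -real_normK ?num_real// ler_pXn2r ?nnegrE ?normc_ge0//.
by rewrite ler_norml => /andP[_ ?]; lra.
Qed.

Lemma open_Im_gt (c : R) : open [set z : R[i]^o | c < Im z].
Proof.
rewrite openE => z /= cz; apply/nbhs_ballP; exists (Im z - c)%:C%C => /=.
  by rewrite ltcR subr_gt0.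
move=> w; rewrite /ball/= normr_normc ltcR => zw.
have : (Im z - Im w) ^+ 2 <= normc (z - w) ^+ 2.
  by rewrite -sqdistE /sqdist lerDr sqr_ge0.
rewrite -real_normK ?num_real// ler_pXn2r ?nnegrE ?normc_ge0//.
by rewrite ler_norml => /andP[_ ?]; lra.
Qed.

Lemma cmeasurable_gt d (T : measurableType d) (f : T -> R[i]) :
  (forall c, measurable [set x | c < Re (f x)]) ->
  (forall c, measurable [set x | c < Im (f x)]) -> cmeasurable f.
Proof.
move=> fr fi; split.
  apply: (measurability _ (RGenOInfty.measurableE R)) => // _ [_ [c ->] <-].
  rewrite setTI (_ : _ @^-1` _ = [set x | c < Re (f x)])//.
  by apply/seteqP; split => x /=; rewrite in_itv/= andbT.
apply: (measurability _ (RGenOInfty.measurableE R)) => // _ [_ [c ->] <-].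
rewrite setTI (_ : _ @^-1` _ = [set x | c < Im (f x)])//.
by apply/seteqP; split => x /=; rewrite in_itv/= andbT.
Qed.

Lemma cmeasurable_circle_val : cmeasurable (@circle_val R).
Proof.
by apply: cmeasurable_gt => c; apply: sub_sigma_algebra;
  [exists [set z | c < Re z]; first exact: open_Re_gt
  |exists [set z | c < Im z]; first exact: open_Im_gt].
Qed.

Lemma cmeasurable_coord N (n : int) : cmeasurable (fun z : solenoid R N => z n).
Proof.
have oc (V : set R[i]^o) : open V ->
    open [set z : prod_topology (fun _ : int => R[i]^o) | V (z n)].
  move=> oV; apply: open_comp => // z _.
  exact: (@proj_continuous int (fun=> R[i]^o) n z).
by apply: cmeasurable_gt => c; apply: sub_sigma_algebra;
  [exists [set z | c < Re (z n)]; first exact/(oc [set z | c < Re z])/open_Re_gt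
  |exists [set z | c < Im (z n)]; first exact/(oc [set z | c < Im z])/open_Im_gt].
Qed.

Lemma measurable_sqdist d (T : measurableType d) (f : T -> R[i]) q r :
  cmeasurable f -> measurable [set x | sqdist (f x) q < r].
Proof.
move=> [fr fi]; rewrite -[X in measurable X]setTI.
apply: (measurable_fun_ltr (g := cst r)) => //.
by apply: measurable_funD; apply: measurable_funX; apply: measurable_funB.
Qed.

Lemma sigma_algebra_preimage d (T : measurableType d) (X : Type) (f : T -> X) :
  sigma_algebra setT [set B | measurable (f @^-1` B)].
Proof.
split => /=.
- by rewrite preimage_set0.
- by move=> A mA; rewrite setTD preimage_setC; exact: measurableC.
- by move=> F mF; rewrite preimage_bigcup; exact: bigcup_measurable.
Qed.

Lemma measurable_fun_circle d (T : measurableType d) (f : T -> circle R) :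
  cmeasurable (fun x => circle_val (f x)) -> measurable_fun setT f.
Proof.
move=> mf; apply: (@measurability _ _ _ _ _ _ (@open (circle R))) => // _ [B oB <-].
rewrite setTI.
apply: (open_coordinate_sigma (p := fun=> @circle_val R)
  (sigma_algebra_preimage f) _ _ oB) =>  [V z oV Vz|n q r].
  by have [e e0 h] := circle_nbhs oV Vz; exists 0%N, e.
exact: measurable_sqdist mf.
Qed.

Lemma measurable_fun_solenoid N (N0 : (0 < N)%N) d (T : measurableType d)
    (f : T -> solenoid R N) :
  (forall n : nat, cmeasurable (fun x => f x n%:Z)) -> measurable_fun setT f.
Proof.
move=> mf.
apply: (@measurability _ _ _ _ _ _ (@open (solenoid R N))) => // _ [B oB <-].
rewrite setTI.
apply: (open_coordinate_sigma (p := fun (n : nat) (z : solenoid R N) => z n%:Z)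
  (sigma_algebra_preimage f) _ _ oB) =>  [V z oV Vz|n q r].
  exact: solenoid_nbhs oV Vz.
exact: measurable_sqdist (mf n).
Qed.

Lemma sigma_circle (S : set (set (circle R))) : sigma_algebra setT S ->
  (forall q r, S [set z | sqdist (circle_val z) q < r]) ->
  forall A, measurable A -> S A.
Proof.
move=> sS Sb A; apply: smallest_sub => // O oO.
apply: (open_coordinate_sigma (p := fun=> @circle_val R) sS _ _ oO) => //.
by move=> U z oU Uz; have [e e0 h] := circle_nbhs oU Uz; exists 0%N, e.
Qed.

Lemma sigma_solenoid N (N0 : (0 < N)%N) (S : set (set (solenoid R N))) :
  sigma_algebra setT S ->
  (forall (n : nat) q r, S [set z : solenoid R N | sqdist (z n%:Z) q < r]) ->
  forall A, measurable A -> S A.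
Proof.
move=> sS Sb A; apply: smallest_sub => // O oO.
apply: (open_coordinate_sigma (p := fun (n : nat) (z : solenoid R N) => z n%:Z)
  sS _ _ oO) => // U z oU Uz.
exact: solenoid_nbhs oU Uz.
Qed.

End Measurability.

(** * Uniqueness of measures *)

Section Generated.
Variables (X : Type) (R : realType) (Q : (X -> R[i]) -> Prop).
Hypothesis Qlin : forall (a : R[i]) f g, Q f -> Q g -> Q (fun x => a * f x + g x).
Hypothesis Qlim : forall (f : nat -> X -> R) (l : X -> R) h, Q h ->
  (forall n x, `|f n x| <= 1) -> (forall n, Q (fun x => (f n x)%:C%C * h x)) ->
  (forall x, f ^~ x @ \oo --> l x) -> Q (fun x => (l x)%:C%C * h x).

Lemma ler_Re_normc (z : R[i]) : `|Re z| <= normc z.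
Proof.
rewrite -(ler_pXn2r (n := 2)) ?nnegrE ?normc_ge0// real_normK ?num_real//.
by rewrite sqr_normcE lerDl sqr_ge0.
Qed.

Lemma ler_Im_normc (z : R[i]) : `|Im z| <= normc z.
Proof.
rewrite -(ler_pXn2r (n := 2)) ?nnegrE ?normc_ge0// real_normK ?num_real//.
by rewrite sqr_normcE lerDr sqr_ge0.
Qed.

(** Re g and Im g are combinations of g and its conjugate, and [sqdist (g x) q] is a bounded
    polynomial in them. *)
Lemma multiplier_sqdist (g : X -> R[i]) q r :
  (forall x, normc (g x) <= 1) ->
  (forall h, Q h -> Q (fun x => g x * h x)) ->
  (forall h, Q h -> Q (fun x => Num.conj (g x) * h x)) ->
  multiplier_set Q [set x | sqdist (g x) q < r].
Proof.
move=> g1 Qg Qgc.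
have mRe : multiplier Q (fun x => Re (g x)).
  move=> h Qh; have := Qlin 1 (Qg _ (multiplier_cst Qlin 2^-1 Qh))
    (Qgc _ (multiplier_cst Qlin 2^-1 Qh)).
  congr Q; apply/funext => x; case: (g x) (h x) => a b [c d].
  by apply/eqP; rewrite eq_complex /=; apply/andP; split; apply/eqP; field.
have mIm : multiplier Q (fun x => Im (g x)).
  (* Im g = -i (g/2) + i (conj g)/2; the term 0 h only brings the sum into the form [a * f + g] of
     [Qlin]. *)
  move=> h Qh; have := Qlin (Complex 0 (- 1)) (Qg _ (multiplier_cst Qlin 2^-1 Qh))
    (Qlin (Complex 0 1) (Qgc _ (multiplier_cst Qlin 2^-1 Qh)) (multiplier_cst Qlin 0 Qh)).
  congr Q; apply/funext => x; case: (g x) (h x) => a b [c d].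
  by apply/eqP; rewrite eq_complex /=; apply/andP; split; apply/eqP; field.
apply: (multiplier_lt Qlin Qlim (f := fun x => sqdist (g x) q)
    (M := (1 + `|Re q|) ^+ 2 + (1 + `|Im q|) ^+ 2)) => [x|].
  rewrite ger0_norm /sqdist ?addr_ge0 ?sqr_ge0//.
  apply: lerD; rewrite -[leLHS]real_normK ?num_real// lerXn2r ?nnegrE ?addr_ge0//;
    apply: le_trans (ler_normB _ _) _; rewrite lerD2r; apply: le_trans (g1 x).
    exact: ler_Re_normc.
  exact: ler_Im_normc.
apply: multiplierD => //; apply: multiplierX => //; apply: multiplierB => //;
  exact: multiplier_cst.
Qed.

End Generated.

Section BoundedIntegral.
Context d (T : measurableType d) (R : realType) (mu : {measure set T -> \bar R}).
Hypothesis mu_fin : (mu setT < +oo)%E.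
Implicit Types f g h : T -> R[i].

Definition cbounded h : Prop :=
  cmeasurable h /\ exists M : R, forall x, normc (h x) <= M.

Lemma bounded_integrable (g : T -> R) M : measurable_fun setT g ->
  (forall x, `|g x| <= M) -> mu.-integrable setT (EFin \o g).
Proof.
move=> mg gM; apply: measurable_bounded_integrable => //.
exists M; split; first exact: num_real.
by move=> y My x _; apply: le_trans (gM x) (ltW My).
Qed.

Lemma bounded_cintegrable h : cbounded h -> cintegrable mu h.
Proof.
move=> [[h1 h2] [M hM]]; split; apply: (bounded_integrable (M := M)) => // x.
  exact: le_trans (ler_Re_normc _) (hM x).
exact: le_trans (ler_Im_normc _) (hM x).
Qed.

Lemma bounded_Rintegral_cvg (g : nat -> T -> R) (l : T -> R) M :
  (forall n, measurable_fun setT (g n)) -> (forall n x, `|g n x| <= M) ->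
  (forall x, g ^~ x @ \oo --> l x) ->
  \int[mu]_x g n x @[n --> \oo] --> \int[mu]_x l x.
Proof.
move=> mg gM gl.
have ml : measurable_fun setT l by apply: measurable_fun_cvg mg _ => x _; exact: gl.
have [//|||||il _ H] := @dominated_convergence _ _ _ mu setT measurableT
  (fun n x => (g n x)%:E) (fun x => (l x)%:E) (cst M%:E).
- by move=> n; exact/measurable_EFinP.
- exact/measurable_EFinP.
- by apply: aeW => x _; apply: cvg_EFin => //; [exact: nearW|exact: gl].
- have M0 : mu.-integrable setT (EFin \o cst M).
    by apply: (bounded_integrable (M := `|M|)) => //; exact: measurable_cst.
  exact: M0.
- by apply: aeW => x n _; rewrite lee_fin.
rewrite /Rintegral; apply: fine_cvg; rewrite fineK//.
exact: integrable_fin_num.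
Qed.

Lemma cboundedD (a : R[i]) f g : cbounded f -> cbounded g ->
  cbounded (fun x => a * f x + g x).
Proof.
move=> [mf [M fM]] [mg [K gK]]; split.
  by apply: cmeasurableD => //; apply: cmeasurableM => //; exact: cmeasurable_cst.
exists (normc a * M + K) => x; apply: le_trans (le_normcD _ _) _.
by rewrite normcM lerD// ler_wpM2l// normc_ge0.
Qed.

Lemma cboundedM f g : cbounded f -> cbounded g -> cbounded (fun x => f x * g x).
Proof.
move=> [mf [M fM]] [mg [K gK]]; split; first exact: cmeasurableM.
by exists (M * K) => x; rewrite normcM ler_pM// normc_ge0.
Qed.

Lemma normc_conj (z : R[i]) : normc (Num.conj z) = normc z.
Proof. by case: z => a b /=; rewrite sqrrN. Qed.

Lemma cboundedJ f : cbounded f -> cbounded (fun x => Num.conj (f x)).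
Proof.
by move=> [mf [M fM]]; split; [exact: cmeasurableJ|exists M => x; rewrite normc_conj].
Qed.

Lemma cbounded_cst (a : R[i]) : cbounded (fun=> a).
Proof. by split; [exact: cmeasurable_cst|exists (normc a)]. Qed.

Lemma Re_realM (x : R) (z : R[i]) : Re (x%:C%C * z) = x * Re z.
Proof. by case: z => a b /=; rewrite mul0r subr0. Qed.

Lemma Im_realM (x : R) (z : R[i]) : Im (x%:C%C * z) = x * Im z.
Proof. by case: z => a b /=; rewrite mul0r addr0. Qed.

Lemma normc_real (x : R) : normc x%:C%C = `|x|.
Proof. by rewrite /= expr0n/= addr0 sqrtr_sqr. Qed.

Lemma cmeasurable_lim (f : nat -> T -> R) (l : T -> R) h :
  (forall n, cmeasurable (fun x => (f n x)%:C%C * h x)) ->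
  (forall x, f ^~ x @ \oo --> l x) -> cmeasurable (fun x => (l x)%:C%C * h x).
Proof.
move=> mf fl; split.
  apply: (measurable_fun_cvg (h := fun n x => Re ((f n x)%:C%C * h x))).
    by move=> n; exact: (mf n).1.
  move=> x _; rewrite Re_realM; under eq_fun do rewrite Re_realM.
  by apply: cvgM => //; exact: cvg_cst.
apply: (measurable_fun_cvg (h := fun n x => Im ((f n x)%:C%C * h x))).
  by move=> n; exact: (mf n).2.
move=> x _; rewrite Im_realM; under eq_fun do rewrite Im_realM.
by apply: cvgM => //; exact: cvg_cst.
Qed.

Lemma normr_lim_le1 (f : nat -> R) l : (forall n, `|f n| <= 1) ->
  f @ \oo --> l -> `|l| <= 1.
Proof.
move=> f1 fl; have fl' : `|f n| @[n --> \oo] --> `|l| by exact: cvg_norm.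
rewrite -(cvg_lim (@Rhausdorff R) fl'); apply: limr_le.
  by apply/cvg_ex; eexists; exact: fl'.
exact: nearW.
Qed.

Lemma cbounded_lim (f : nat -> T -> R) (l : T -> R) h : cbounded h ->
  (forall n x, `|f n x| <= 1) ->
  (forall n, cbounded (fun x => (f n x)%:C%C * h x)) ->
  (forall x, f ^~ x @ \oo --> l x) -> cbounded (fun x => (l x)%:C%C * h x).
Proof.
move=> [mh [M hM]] f1 mf fl; split.
  by apply: cmeasurable_lim fl => n; exact: (mf n).1.
exists M => x; apply: le_trans (hM x); rewrite normcM normc_real.
by rewrite ler_piMl ?normc_ge0//; apply: normr_lim_le1 (fl x) => n; exact: f1.
Qed.

Lemma cintegral_lim (f : nat -> T -> R) (l : T -> R) h : cbounded h ->
  (forall n x, `|f n x| <= 1) ->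
  (forall n, cbounded (fun x => (f n x)%:C%C * h x)) ->
  (forall x, f ^~ x @ \oo --> l x) ->
  Re (cintegral mu (fun x => (f n x)%:C%C * h x)) @[n --> \oo] -->
    Re (cintegral mu (fun x => (l x)%:C%C * h x)) /\
  Im (cintegral mu (fun x => (f n x)%:C%C * h x)) @[n --> \oo] -->
    Im (cintegral mu (fun x => (l x)%:C%C * h x)).
Proof.
move=> [mh [M hM]] f1 mf fl; rewrite /cintegral; split => /=.
  apply: (bounded_Rintegral_cvg (M := M)).
  - by move=> n; exact: (mf n).1.1.
  - move=> n x; apply: le_trans (ler_Re_normc _) _; apply: le_trans (hM x).
    by rewrite normcM normc_real ler_piMl ?normc_ge0.
  - move=> x; rewrite Re_realM; under eq_fun do rewrite Re_realM.
    by apply: cvgM => //; exact: cvg_cst.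
apply: (bounded_Rintegral_cvg (M := M)).
- by move=> n; exact: (mf n).1.2.
- move=> n x; apply: le_trans (ler_Im_normc _) _; apply: le_trans (hM x).
  by rewrite normcM normc_real ler_piMl ?normc_ge0.
- move=> x; rewrite Im_realM; under eq_fun do rewrite Im_realM.
  by apply: cvgM => //; exact: cvg_cst.
Qed.

End BoundedIntegral.

Section Uniqueness.
Context d (T : measurableType d) (R : realType).
Variables (nu1 nu2 : {measure set T -> \bar R}).
Hypotheses (fin1 : (nu1 setT < +oo)%E) (fin2 : (nu2 setT < +oo)%E).
Variable G : set (T -> R[i]).
Hypothesis G1 : G (fun=> 1).
Hypothesis GM : forall g h, G g -> G h -> G (fun x => g x * h x).
Hypothesis GJ : forall g, G g -> G (fun x => Num.conj (g x)).
Hypothesis Gb : forall g, G g -> cmeasurable g /\ forall x, normc (g x) <= 1.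
Hypothesis Gint : forall g, G g -> cintegral nu1 g = cintegral nu2 g.

(** The hypothesis on [A] is membership in the sigma-algebra generated by the discs of functions of
    [G], written impredicatively so that it applies at once to the sigma-algebra of multiplier
    sets. *)
Lemma measure_uniqueness A : measurable A ->
  (forall S, sigma_algebra setT S ->
    (forall g q r, G g -> S [set x | sqdist (g x) q < r]) -> S A) ->
  nu1 A = nu2 A.
Proof.
move=> mA GA.
(* Testing against every [g] in [G], and not only 1, makes [Q] stable under multiplication by
   [G]. *)
pose Q h := cbounded h /\ forall g, G g ->
  cintegral nu1 (fun x => g x * h x) = cintegral nu2 (fun x => g x * h x).
have Gbd g : G g -> cbounded g by move=> /Gb[? ?]; split => //; exists 1.
have Qlin (a : R[i]) f g : Q f -> Q g -> Q (fun x => a * f x + g x).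
  move=> [bf fE] [bg gE]; split; first exact: cboundedD.
  move=> k Gk.
  have -> : (fun x => k x * (a * f x + g x)) = (fun x => a * (k x * f x) + k x * g x).
    by apply/funext => x; ring.
  have kf := cboundedM (Gbd _ Gk) bf; have kg := cboundedM (Gbd _ Gk) bg.
  have akf := cboundedM (cbounded_cst _ a) kf.
  do 2 (rewrite cintegralD; [|exact: bounded_cintegrable|exact: bounded_cintegrable]).
  do 2 (rewrite cintegralZ; last exact: bounded_cintegrable).
  by rewrite fE// gE.
have Qlim (f : nat -> T -> R) (l : T -> R) h : Q h ->
    (forall n x, `|f n x| <= 1) -> (forall n, Q (fun x => (f n x)%:C%C * h x)) ->
    (forall x, f ^~ x @ \oo --> l x) -> Q (fun x => (l x)%:C%C * h x).
  move=> [bh hE] f1 Qf fl; split.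
    by apply: cbounded_lim fl => // n; exact: (Qf n).1.
  move=> g Gg.
  have gC (k : T -> R) : (fun x => g x * ((k x)%:C%C * h x)) =
      (fun x => (k x)%:C%C * (g x * h x)) by apply/funext => x; ring.
  have gh := cboundedM (Gbd _ Gg) bh.
  have fgh n : cbounded (fun x => (f n x)%:C%C * (g x * h x)).
    by rewrite -gC; apply: cboundedM (Gbd _ Gg) (Qf n).1.
  have [r1 i1] := cintegral_lim fin1 gh f1 fgh fl.
  have [r2 i2] := cintegral_lim fin2 gh f1 fgh fl.
  have E n : cintegral nu1 (fun x => (f n x)%:C%C * (g x * h x)) =
             cintegral nu2 (fun x => (f n x)%:C%C * (g x * h x)).
    by rewrite -gC (Qf n).2.
  rewrite gC; apply/eqP; rewrite eq_complex; apply/andP; split; apply/eqP.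
    apply: cvg_unique r1 _ => //; rewrite (_ : (fun n => _) = (fun n =>
      Re (cintegral nu2 (fun x => (f n x)%:C%C * (g x * h x)))))//.
    by apply/funext => n; rewrite E.
  apply: cvg_unique i1 _ => //; rewrite (_ : (fun n => _) = (fun n =>
    Im (cintegral nu2 (fun x => (f n x)%:C%C * (g x * h x)))))//.
  by apply/funext => n; rewrite E.
have QG g h : G g -> Q h -> Q (fun x => g x * h x).
  move=> Gg [bh hE]; split; first exact: cboundedM (Gbd _ Gg) bh.
  move=> k Gk; have := hE _ (GM Gk Gg).
  by under eq_fun do rewrite -mulrA.
have Q1 : Q (fun=> 1).
  split; first exact: cbounded_cst.
  by move=> g Gg; under eq_fun do rewrite mulr1; exact: Gint.
have : multiplier_set Q A.
  apply: GA; first exact: sigma_algebra_multiplier_set.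
  move=> g q r Gg; apply: multiplier_sqdist => //; first exact: (Gb Gg).2.
    by move=> h; exact: QG.
  by move=> h; apply: QG; exact: GJ.
(* The multiplier property applied to h = 1 and tested against g = 1 compares the two masses of
   [A]. *)
move=> /(_ _ Q1) [_ /(_ _ G1)]; rewrite /cintegral => -[+ _].
have E : (fun x : T => Re (1 * ((\1_A x)%:C%C * 1) : R[i])) = \1_A.
  by apply/funext => x; rewrite mul1r mulr1.
rewrite E /Rintegral !integral_indic// setIT => h.
have nuA (nu : {measure set T -> \bar R}) : (nu setT < +oo)%E -> nu A \is a fin_num.
  move=> nuT; rewrite ge0_fin_numE//; apply: le_lt_trans nuT.
  by apply: le_measure; rewrite ?inE.
by rewrite -[LHS]fineK ?nuA// h fineK ?nuA.
Qed.

End Uniqueness.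

(** * Characters and Haar measure *)

Lemma integral_mrestr d (T : measurableType d) (R : realType)
    (mu : {measure set T -> \bar R}) (D : set T) (mD : measurable D)
    (f : T -> \bar R) : (mrestr mu mD).-integrable setT f ->
  (\int[mrestr mu mD]_x f x = \int[mu]_(x in D) f x)%E.
Proof.
move=> fi; rewrite [LHS](negligible_integral (N := ~` D))//.
- rewrite setTD setCK; apply: eq_measure_integral => A mA AD.
  by rewrite -[LHS]/(mu (A `&` D)) setIidl.
- exact: measurableC.
- by rewrite -[LHS]/(mu (~` D `&` D)) setICl measure0.
Qed.

Section CircleIntegral.
Variable R : realType.

Lemma continuous_scale (f : R -> R) (w : R) : continuous f ->
  continuous (fun t : R => f (w * t)).
Proof.
move=> cf t; apply: (continuous_comp (f := fun t : R => w * t)); last exact: cf.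
by apply: cvgM; [exact: cvg_cst|exact: cvg_id].
Qed.

(** The antiderivative F(wt)/w takes equal values at 0 and 1. Applied with w = 2 pi k to the real
    and imaginary parts of the characters of the circle. *)
Lemma integral_period (f F : R -> R) (w : R) : w != 0 -> continuous f ->
  (forall t : R, is_derive t 1 F (f t)) -> F w = F 0 ->
  \int[lebesgue_measure]_(t in `[0, 1]) f (w * t) = 0.
Proof.
move=> w0 cf dF Fw.
pose G (t : R) := w^-1 * F (w * t).
have dG (t : R) : is_derive t 1 G (f (w * t)).
  have dw : is_derive t 1 (fun t : R => w * t) w.
    have : is_derive (t : R^o) (1 : R^o) (w \*: (id : R^o -> R^o)) (w *: (1 : R^o)).
      exact: is_deriveZ.
    by rewrite /GRing.scale/= mulr1.
  have dFw := is_derive1_comp (dF _) dw.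
  have : is_derive (t : R^o) (1 : R^o)
      (w^-1 \*: ((F \o (fun t : R => w * t)) : R^o -> R^o)) (w^-1 *: (f (w * t) * w : R^o)).
    exact: is_deriveZ.
  by rewrite /GRing.scale/= [f _ * w]mulrC mulKf.
have cG : continuous G.
  by move=> t; apply: differentiable_continuous; apply/derivable1_diffP; case: (dG t).
rewrite /Rintegral (continuous_FTC2 (F := G))//.
- by rewrite /G mulr1 mulr0 Fw subee.
- by apply: continuous_subspaceT; exact: continuous_scale.
- split.
  + by move=> x _; case: (dG x).
  + exact/cvg_at_right_filter/cG.
  + exact/cvg_at_left_filter/cG.
- by move=> x _; rewrite derive1E; case: (dG x).
Qed.
End CircleIntegral.

Section ImageMeasure.
Context d1 d2 (X : measurableType d1) (Y : measurableType d2) (R : realType).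
Variables (phi : X -> Y) (mphi : measurable_fun setT phi).
Variable mu : {measure set X -> \bar R}.

Definition image_measure : {measure set Y -> \bar R} :=
  measure_function_pushforward__canonical__measure_function_Measure mu mphi.

Lemma image_measureE A : image_measure A = mu (phi @^-1` A).
Proof. by []. Qed.

Lemma cmeasurable_comp (f : Y -> R[i]) :
  cmeasurable f -> cmeasurable (fun x => f (phi x)).
Proof.
move=> [fr fi]; split.
  exact: (measurableT_comp fr mphi).
exact: (measurableT_comp fi mphi).
Qed.

Lemma cbounded_comp (f : Y -> R[i]) : cbounded f -> cbounded (fun x => f (phi x)).
Proof.
by move=> [mf [M fM]]; split; [exact: cmeasurable_comp|exists M => x].
Qed.

Lemma cintegral_image (f : Y -> R[i]) : cmeasurable f ->
  cintegrable mu (fun x => f (phi x)) ->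
  cintegral image_measure f = cintegral mu (fun x => f (phi x)).
Proof.
move=> [fr fi] [ir ii]; congr Complex; congr fine.
  apply: (integral_pushforward mphi) => //; exact/measurable_EFinP.
apply: (integral_pushforward mphi) => //; exact/measurable_EFinP.
Qed.

End ImageMeasure.

Lemma eq_measure_cintegral d (T : measurableType d) (R : realType)
    (nu1 nu2 : {measure set T -> \bar R}) (f : T -> R[i]) :
  (forall A, measurable A -> nu1 A = nu2 A) -> cintegral nu1 f = cintegral nu2 f.
Proof.
by move=> E; congr Complex; congr fine; apply: eq_measure_integral => A mA _; exact: E.
Qed.

Section Characters.
Variable R : realType.
Implicit Types u v : R[i].

Lemma conj_unit (z : R[i]) : `|z| = 1 -> Num.conj z = z^-1.
Proof.
move=> z1; have z0 : z != 0 by rewrite -normr_eq0 z1 oner_neq0.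
by apply: (mulfI z0); rewrite divff// -normCK z1 expr1n.
Qed.

Lemma normr_exprz (z : R[i]) (k : int) : `|z| = 1 -> `|z ^ k| = 1.
Proof.
by move=> z1; case: k => n; rewrite ?NegzE -?exprnN ?normfV normrX z1 expr1n ?invr1.
Qed.

Lemma normc_exprz (z : R[i]) (k : int) : `|z| = 1 -> normc (z ^ k) = 1.
Proof. by move=> z1; apply: normc_circle; rewrite normr_exprz. Qed.

Lemma cmeasurable_exprz d (T : measurableType d) (f : T -> R[i]) (k : int) :
  (forall x, `|f x| = 1) -> cmeasurable f -> cmeasurable (fun x => f x ^ k).
Proof.
move=> f1 mf.
have mX n : cmeasurable (fun x => f x ^+ n).
  elim: n => [|n IH]; first exact: cmeasurable_cst.
  by have := cmeasurableM mf IH; congr cmeasurable; apply/funext => x; rewrite exprS.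
case: k => n; first exact: mX.
have := cmeasurableJ (mX n.+1).
congr cmeasurable; apply/funext => x; rewrite conj_unit ?NegzE//.
by rewrite normrX f1 expr1n.
Qed.

Definition cis (t : R) : R[i] := circle_val (expi t).

Lemma cisD s t : cis (s + t) = cis s * cis t.
Proof.
by rewrite /cis/= mulrDr cosD sinD; apply/eqP; rewrite eq_complex/=; apply/andP;
  split; apply/eqP; ring.
Qed.

Lemma cis0 : cis 0 = 1.
Proof. by rewrite /cis/= mulr0 cos0 sin0. Qed.

Lemma cisMn t (n : nat) : cis (n%:R * t) = cis t ^+ n.
Proof.
elim: n => [|n IH]; first by rewrite mul0r cis0.
by rewrite -natr1 mulrDl mul1r cisD IH exprSr.
Qed.

Lemma cis_half : cis 2^-1 = -1.
Proof.
rewrite /cis/= (_ : 2 * pi * 2^-1 = pi); last by rewrite mulrAC divff ?mul1r.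
by rewrite cospi sinpi; apply/eqP; rewrite eq_complex/= oppr0 !eqxx.
Qed.

Lemma cisMz t (k : int) : cis (k%:~R * t) = cis t ^ k.
Proof.
case: k => n; first by rewrite -exprnP -cisMn.
have c0 s : cis s != 0 by rewrite -normr_eq0 (circle_norm (expi s)) oner_neq0.
rewrite NegzE mulrNz mulNr; apply: (mulfI (c0 (n.+1%:~R * t))).
rewrite -cisD subrr cis0 -[n.+1%:~R]/(n.+1%:R) cisMn.
by rewrite -exprnN mulfV// expf_neq0.
Qed.

Lemma integral_cis (k : int) : k != 0 ->
  cintegral (@circle_measure R) (fun x : circle R => circle_val x ^ k) = 0.
Proof.
move=> k0; pose I01 : set R := [set` `[0, 1]].
pose leb : {measure set (measurableTypeR R) -> \bar R} :=
  mrestr (@lebesgue_measure R) (measurable_itv (`[0, 1] : interval R)).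
have lebT : (leb setT < +oo)%E.
  rewrite (_ : leb setT = lebesgue_measure (setT `&` I01))// setTI.
  by rewrite lebesgue_measure_itv/= lte01 oppr0 adde0 ltry.
have mk : cmeasurable (fun x : circle R => circle_val x ^ k).
  exact: (@cmeasurable_exprz _ _ (@circle_val R) k (@circle_norm R)
    (@cmeasurable_circle_val R)).
have bk : cbounded (fun x : circle R => circle_val x ^ k).
  by split => //; exists 1 => x; rewrite normc_exprz// circle_norm.
have me : measurable_fun [set: measurableTypeR R] (@expi R) by exact: measurable_expi.
have bc := cbounded_comp me bk.
have [ir ii] := bounded_cintegrable lebT bc.
rewrite (@eq_measure_cintegral _ _ _ _ (image_measure me leb))//.
rewrite cintegral_image//.
pose w : R := 2 * pi * k%:~R.
have w0 : w != 0.
  by rewrite !mulf_neq0 ?intr_eq0// gt_eqF// pi_gt0.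
have wE t : circle_val (expi t) ^ k = Complex (cos (w * t)) (sin (w * t)).
  by rewrite -[circle_val _]/(cis t) -cisMz /cis/= mulrA.
(* cis 1 is the square of cis(1/2) = -1; this supplies the periodicity of cos and sin at w. *)
have w1 : cis k%:~R = 1.
  rewrite -[k%:~R]mulr1 cisMz (_ : cis 1 = 1) ?exp1rz//.
  have -> : 1 = 2^-1 + 2^-1 :> R by lra.
  by rewrite cisD cis_half mulN1r opprK.
have [cw sw] : cos w = 1 /\ sin w = 0 by move: w1; rewrite /cis/= => -[].
rewrite /cintegral; apply/eqP; rewrite eq_complex/=; apply/andP; split; apply/eqP.
  rewrite [LHS](_ : _ = \int[lebesgue_measure]_(t in `[0, 1]) cos (w * t)).
    apply: (@integral_period _ cos sin) => //; first exact: continuous_cos.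
    by rewrite sw sin0.
  rewrite /Rintegral integral_mrestr//; congr fine.
  by apply: eq_integral => t _; rewrite wE.
rewrite [LHS](_ : _ = \int[lebesgue_measure]_(t in `[0, 1]) sin (w * t)).
  apply: (@integral_period _ sin (fun t => - cos t)) => //; first exact: continuous_sin.
    move=> t; have : is_derive (t : R^o) (1 : R^o) (- (cos : R^o -> R^o)) (- (- sin t) : R^o).
      by apply: is_deriveN; exact: is_derive_cos.
    by rewrite opprK.
  by rewrite cw cos0.
rewrite /Rintegral integral_mrestr//; congr fine.
by apply: eq_integral => t _; rewrite wE.
Qed.

Variable N : nat.
Hypothesis N_ge2 : (2 <= N)%N.
Local Notation sol := (solenoid R N).

Fact one_parameter_subproof (s : R) (n : int) :
  cis (s * N%:R ^ (- (n + 1))) ^+ N = cis (s * N%:R ^ (- n)) /\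
  `|cis (s * N%:R ^ (- n))| = 1.
Proof.
split; last exact: circle_norm.
rewrite -cisMn; congr cis.
have N0 : N%:R != 0 :> R by rewrite pnatr_eq0; lia.
rewrite mulrCA; congr (_ * _).
by rewrite -[X in X * _]expr1z -expfzDr//; congr (_ ^ _); lia.
Qed.

Definition one_parameter s : sol := Solenoid (one_parameter_subproof s).

Lemma exists_coord (n : int) (t : R) : exists g : sol, g n = cis t.
Proof.
exists (one_parameter (t * N%:R ^ n)) => /=; congr cis.
have N0 : N%:R != 0 :> R by rewrite pnatr_eq0; lia.
by rewrite -mulrA -expfzDr// subrr expr0z mulr1.
Qed.

Definition schar (n k : int) (z : sol) : R[i] := z n ^ k.

Lemma scharM n k (g z : sol) : schar n k (g * z)%g = schar n k g * schar n k z.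
Proof. exact: expfzMl. Qed.

Lemma normc_schar n k z : normc (schar n k z) = 1.
Proof. by apply: normc_exprz; exact: (solenoidP _ _).2. Qed.

Lemma cmeasurable_schar n k : cmeasurable (schar n k).
Proof.
apply: cmeasurable_exprz; last exact: cmeasurable_coord.
by move=> z; exact: (solenoidP _ _).2.
Qed.

Lemma cbounded_schar n k : cbounded (schar n k).
Proof.
by split; [exact: cmeasurable_schar|exists 1 => z; rewrite normc_schar].
Qed.

Lemma schar_refine n k (m : nat) : schar n k = schar (n + m%:Z) (k * (N ^ m)%N%:Z).
Proof.
apply/funext => z; rewrite /schar (solenoid_coordS z n m).
by rewrite exprnP exprz_exp mulrC.
Qed.

(** Adding fractions over a common denominator: both characters are refined to the larger of the two
    indices. *)
Lemma schar_mul n k m l : exists p q,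
  (fun z => schar n k z * schar m l z) = schar p q.
Proof.
wlog nm : n k m l / n <= m.
  move=> H; have [/H//|/ltW /H h] := leP n m.
  have [p [q E]] := h l k; exists p, q; rewrite -E.
  by apply/funext => z; rewrite mulrC.
have [a am] : exists a : nat, m = n + a%:Z.
  by exists `|m - n|%N; lia.
exists m, (k * (N ^ a)%N%:Z + l).
rewrite (schar_refine n k a) -am; apply/funext => z.
by rewrite /schar expfzDr// solenoid_neq0.
Qed.

Lemma schar_conj n k : (fun z => Num.conj (schar n k z)) = schar n (- k).
Proof.
apply/funext => z; rewrite conj_unit /schar ?invr_expz//.
by rewrite normr_exprz ?(solenoidP _ _).2.
Qed.

Lemma schar0 n : schar n 0 = fun=> 1.
Proof. by []. Qed.

Lemma schar_coord n : schar n 1 = fun z => z n.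
Proof. by apply/funext => z; rewrite /schar expr1z. Qed.

Lemma measurable_mulg (g : sol) : measurable_fun setT (fun z : sol => (g * z)%g).
Proof.
apply: measurable_fun_solenoid => [|n]; first exact: ltnW.
apply: cmeasurableM; first exact: cmeasurable_cst.
exact: cmeasurable_coord.
Qed.

Lemma measurable_shift : measurable_fun setT (@solenoid_shift R N).
Proof.
apply: measurable_fun_solenoid => [|n]; first exact: ltnW.
exact: cmeasurable_coord.
Qed.

Definition circle_coord (n : int) (z : sol) : circle R :=
  Circle (solenoidP z n).2.

Lemma measurable_circle_coord n : measurable_fun setT (circle_coord n).
Proof. by apply: measurable_fun_circle; exact: cmeasurable_coord. Qed.

Variable mu : probability sol R.
Hypothesis mu_haar : is_haar mu.

Lemma mu_finite : (mu setT < +oo)%E.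
Proof. by rewrite probability_setT ltry. Qed.

Lemma haar_preimage (g : sol) (A : set sol) : measurable A ->
  mu ((fun z : sol => (g * z)%g) @^-1` A) = mu A.
Proof.
move=> mA; rewrite -(mu_haar (g^-1)%g mA); congr (mu _).
apply/seteqP; split => z /= => [Az|[w Aw <-]]; last by rewrite mulgA mulgV mul1g.
by exists (g * z)%g => //; rewrite mulgA mulVg mul1g.
Qed.

Lemma haar_cintegral (g : sol) (f : sol -> R[i]) : cbounded f ->
  cintegral mu (fun z : sol => f (g * z)%g) = cintegral mu f.
Proof.
move=> bf; rewrite -(cintegral_image (measurable_mulg g) bf.1); last first.
  apply: (bounded_cintegrable mu_finite).
  exact: (cbounded_comp (measurable_mulg g) bf).
by apply: eq_measure_cintegral => A mA; exact: haar_preimage.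
Qed.

(** Taking g_n = cis(1/(2k)) makes the character equal to -1 at g, so translation by g shows that
    the integral is its own opposite. *)
Lemma cintegral_schar n k : k != 0 -> cintegral mu (schar n k) = 0.
Proof.
move=> k0; have k0' : k%:~R != 0 :> R by rewrite intr_eq0.
have [g gn] := exists_coord n (2^-1 / k%:~R).
have g1 : schar n k g = -1.
  by rewrite /schar gn -cisMz mulrCA divff// mulr1 cis_half.
have := haar_cintegral g (cbounded_schar n k).
rewrite (_ : (fun z => _) = (fun z => -1 * schar n k z)); last first.
  by apply/funext => z; rewrite scharM g1.
rewrite cintegralZ; last exact: (bounded_cintegrable mu_finite (cbounded_schar n k)).
move=> h; have /eqP : cintegral mu (schar n k) *+ 2 = 0.
  by rewrite mulr2n -{1}h mulN1r addNr.
by rewrite mulrn_eq0/= => /eqP.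
Qed.

Lemma cintegral_schar0 n (nu : {measure set sol -> \bar R}) :
  cintegral nu (schar n 0) = (fine (nu setT))%:C%C.
Proof.
rewrite schar0 /cintegral/= /Rintegral integral_cst//= mul1e.
by rewrite integral0.
Qed.

Lemma solenoid_measure_unique (nu1 nu2 : {measure set sol -> \bar R}) :
  (nu1 setT < +oo)%E -> (nu2 setT < +oo)%E ->
  (forall n k, cintegral nu1 (schar n k) = cintegral nu2 (schar n k)) ->
  forall A, measurable A -> nu1 A = nu2 A.
Proof.
move=> f1 f2 E A mA.
apply: (measure_uniqueness f1 f2 (G := [set f | exists n k, f = schar n k])) => //.
- by exists 0, 0.
- by move=> _ _ [n [k ->]] [m [l ->]]; exact: schar_mul.
- by move=> _ [n [k ->]]; exists n, (- k); rewrite schar_conj.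
- move=> _ [n [k ->]]; split => [|x]; first exact: cmeasurable_schar.
  by rewrite normc_schar.
- by move=> _ [n [k ->]].
- move=> S sS GS; apply: (sigma_solenoid _ sS) => // [|n q r]; first exact: ltnW.
  have := GS (schar n%:Z 1) q r; rewrite schar_coord; apply.
  by exists n%:Z, 1; rewrite schar_coord.
Qed.

Lemma circle_measure_unique (nu1 nu2 : {measure set circle R -> \bar R}) :
  (nu1 setT < +oo)%E -> (nu2 setT < +oo)%E ->
  (forall k : int, cintegral nu1 (fun x : circle R => circle_val x ^ k) =
            cintegral nu2 (fun x : circle R => circle_val x ^ k)) ->
  forall A, measurable A -> nu1 A = nu2 A.
Proof.
move=> f1 f2 E A mA.
apply: (measure_uniqueness f1 f2
  (G := [set f | exists k : int, f = fun x : circle R => circle_val x ^ k])) => //.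
- by exists 0.
- move=> _ _ [k ->] [l ->]; exists (k + l); apply/funext => z.
  by rewrite expfzDr// -normr_eq0 circle_norm oner_neq0.
- move=> _ [k ->]; exists (- k); apply/funext => z.
  by rewrite conj_unit ?invr_expz// normr_exprz ?circle_norm.
- move=> _ [k ->]; split => [|x].
    exact: (@cmeasurable_exprz _ _ (@circle_val R) k (@circle_norm R)
      (@cmeasurable_circle_val R)).
  by rewrite normc_exprz// circle_norm.
- by move=> _ [k ->].
- move=> S sS GS; apply: (sigma_circle sS) => // q r.
  apply: (GS (@circle_val R)); exists 1.
  by apply/funext => x; rewrite expr1z.
Qed.

Lemma circle_measure_setT : @circle_measure R setT = 1%E.
Proof. exact: probability_setT. Qed.

(** The law of z_n and Lebesgue measure have the same Fourier coefficients: 0 for k <> 0, and 1 for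
    k = 0. *)
Lemma haar_circle_coord n A : measurable A ->
  mu (circle_coord n @^-1` A) = circle_measure A.
Proof.
rewrite -(image_measureE (measurable_circle_coord n)).
apply: circle_measure_unique => [||k].
- by have := mu_finite.
- by rewrite /= circle_measure_setT ltry.
- have mk : cmeasurable (fun x : circle R => circle_val x ^ k).
    exact: (@cmeasurable_exprz _ _ (@circle_val R) k (@circle_norm R)
      (@cmeasurable_circle_val R)).
  rewrite cintegral_image//; last first.
    exact: (bounded_cintegrable mu_finite (cbounded_schar n k)).
  have [->|k0] := eqVneq k 0; last by rewrite (cintegral_schar n k0) integral_cis.
  by rewrite (cintegral_schar0 n mu) /cintegral/= /Rintegral integral_cst//=
    mul1e integral0 circle_measure_setT probability_setT.
Qed.

(** Composition with the shift turns [schar n k] into [schar (n - 1) k], and for k <> 0 both have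
    integral 0. *)
Lemma haar_shift A : measurable A -> mu (@solenoid_shift R N @^-1` A) = mu A.
Proof.
rewrite -(image_measureE measurable_shift).
apply: solenoid_measure_unique => [||n k].
- by have := mu_finite.
- exact: mu_finite.
- rewrite cintegral_image; last 2 first.
  + exact: cmeasurable_schar.
  + exact: (bounded_cintegrable mu_finite (cbounded_schar (n - 1) k)).
  have [->//|k0] := eqVneq k 0.
  by rewrite (cintegral_schar n k0) -(cintegral_schar (n - 1) k0).
Qed.

End Characters.

(** * Ergodicity of the shift *)

Lemma cbounded_sum d (T : measurableType d) (R : realType) (F : nat -> T -> R[i]) M :
  (forall i, cbounded (F i)) -> cbounded (fun x => \sum_(i < M) F i x).
Proof.
move=> bF; elim: M => [|M IH].
  by under eq_fun do rewrite big_ord0; exact: cbounded_cst.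
under eq_fun do rewrite big_ord_recr/=.
have := cboundedD 1 IH (bF M); congr cbounded.
by apply/funext => x; rewrite mul1r.
Qed.

Lemma cintegral_sum d (T : measurableType d) (R : realType)
    (nu : {measure set T -> \bar R}) (F : nat -> T -> R[i]) M :
  (nu setT < +oo)%E -> (forall i, cbounded (F i)) ->
  cintegral nu (fun x => \sum_(i < M) F i x) = \sum_(i < M) cintegral nu (F i).
Proof.
move=> nuT bF; elim: M => [|M IH].
  rewrite big_ord0; under eq_fun do rewrite big_ord0.
  by rewrite /cintegral/= /Rintegral !integral0.
rewrite big_ord_recr/= -IH -cintegralD; last 2 first.
- exact: (bounded_cintegrable nuT (cbounded_sum _ bF)).
- exact: (bounded_cintegrable nuT (bF M)).
by congr cintegral; apply/funext => x; rewrite big_ord_recr.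
Qed.

Lemma cintegral_mscale d (T : measurableType d) (R : realType)
    (mu : {measure set T -> \bar R}) (p : {nonneg R}) (f : T -> R[i]) :
  cintegrable mu f -> cintegral (mscale p mu) f = (p%:num)%:C%C * cintegral mu f.
Proof.
have iE (g : T -> R) : mu.-integrable setT (EFin \o g) ->
    \int[mscale p mu]_x g x = p%:num * \int[mu]_x g x.
  move=> gi; have mg := measurable_int _ gi; rewrite /Rintegral integralE.
  have m1 := measurable_funepos mg; have m2 := measurable_funeneg mg.
  have f1 : (\int[mu]_x (EFin \o g)^\+ x)%E \is a fin_num.
    exact: integrable_pos_fin_num.
  have f2 : (\int[mu]_x (EFin \o g)^\- x)%E \is a fin_num.
    exact: integrable_neg_fin_num.
  (* Scaling the measure is available for nonnegative integrands, hence the split into positive and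
     negative parts. *)
  rewrite !ge0_integral_mscale// [in RHS]integralE.
  by rewrite -muleBr// ?fin_num_adde_defr// fineM// fin_numB f1.
move=> [fr fi]; rewrite /cintegral !iE//.
by apply/eqP; rewrite eq_complex/= !mul0r subr0 addr0 !eqxx.
Qed.

Section Ergodicity.
Variables (R : realType) (N : nat).
Hypothesis N_ge2 : (2 <= N)%N.
Local Notation sol := (solenoid R N).
Variable mu : probability sol R.
Hypothesis mu_haar : is_haar mu.

(** Since z_(n-i) = z_n^(N^i), the integrand is a character of exponent k (N^i - N^j), nonzero for i
    <> j because N >= 2. *)
Lemma cintegral_schar_orthonormal n k (i j : nat) : k != 0 ->
  cintegral mu (fun z => schar (n - i%:Z) k z * Num.conj (schar (n - j%:Z) k z)) =
  (i == j)%:R.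
Proof.
move=> k0.
have sN (m : nat) : schar (n - m%:Z) k = schar n (k * (N ^ m)%N%:Z) :> (sol -> R[i]).
  by rewrite (schar_refine R N _ k m) subrK.
have -> : (fun z => schar (n - i%:Z) k z * Num.conj (schar (n - j%:Z) k z)) =
    schar n (k * ((N ^ i)%N%:Z - (N ^ j)%N%:Z)) :> (sol -> R[i]).
  apply/funext => z; rewrite !sN.
  have /(congr1 (@^~ z)) /= -> := schar_conj R N n (k * (N ^ j)%N%:Z).
  by rewrite /schar -expfzDr ?solenoid_neq0// mulrBr.
have [->|ij] := eqVneq i j.
  rewrite subrr mulr0 schar0 /cintegral/= /Rintegral integral_cst//= mul1e.
  by rewrite integral0 probability_setT.
rewrite cintegral_schar// mulf_neq0// subr_eq0; apply: contra ij => /eqP[] /eqP.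
by rewrite eqn_exp2l.
Qed.

Section InvariantSet.
Variables (E : set sol) (mE : measurable E).
Hypothesis shiftE : @solenoid_shift R N @^-1` E = E.

Let nu : {measure set sol -> \bar R} := mrestr mu mE.

Let nuT : (nu setT < +oo)%E.
Proof. by rewrite -[nu _]/(mu (setT `&` E)) setTI -ge0_fin_numE// fin_num_measure. Qed.

Let nuE A : nu A = mu (A `&` E). Proof. by []. Qed.

(** The restriction of a shift-invariant measure to an invariant set is shift invariant, and one
    shift lowers the index by 1. *)
Lemma invariant_schar n k (m : nat) :
  cintegral nu (schar (n - m%:Z) k) = cintegral nu (schar n k).
Proof.
elim: m => [|m IH]; first by rewrite subr0.
rewrite -{}IH (_ : n - m.+1%:Z = n - m%:Z - 1); last lia.
set l := n - m%:Z.
rewrite -[LHS](@cintegral_image _ _ _ _ _ _ (measurable_shift N_ge2) nu (schar l k)).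
- apply: eq_measure_cintegral => A mA; rewrite image_measureE !nuE.
  rewrite -[in RHS](haar_shift N_ge2 mu_haar (measurableI _ _ mA mE)).
  by rewrite preimage_setI shiftE.
- exact: cmeasurable_schar.
- exact: (bounded_cintegrable nuT (@cbounded_schar R N (l - 1) k)).
Qed.

(* Bessel's inequality for the orthonormal family [schar (n - i) k], all of
   whose coefficients against the indicator of [E] coincide. *)
Lemma invariant_schar0 n k : k != 0 -> cintegral nu (schar n k) = 0.
Proof.
move=> k0; set c := cintegral nu _.
pose p : R := fine (mu E).
have p1 : p <= 1.
  by rewrite -lee_fin fineK ?fin_num_measure// probability_le1.
(* Bessel for the sum f of M orthonormal characters: its integral over [E] is M c, and its squared
   norm is M. *)
have key (M : nat) : M%:R ^+ 2 * normc c ^+ 2 <= M%:R.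
  pose f (z : sol) : R[i] := \sum_(i < M) schar (n - i%:Z) k z.
  have bs i : cbounded (schar (n - i%:Z) k : sol -> R[i]) by exact: cbounded_schar.
  have bf : cbounded f := cbounded_sum M bs.
  have bff := cboundedM bf (cboundedJ bf).
  have fc : cintegral nu f = M%:R * c.
    rewrite /f (cintegral_sum (F := fun (i : nat) (z : sol) => schar (n - i%:Z) k z))//.
    under eq_bigr do rewrite invariant_schar.
    by rewrite sumr_const card_ord mulr_natl.
  have ff : cintegral mu (fun z => f z * Num.conj (f z)) = M%:R.
    have bij i j : cbounded (fun z : sol =>
        schar (n - i%:Z) k z * Num.conj (schar (n - j%:Z) k z)).
      by apply: cboundedM => //; exact: cboundedJ.
    rewrite (_ : (fun z => _) = fun z => \sum_(i < M) \sum_(j < M)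
        (schar (n - i%:Z) k z * Num.conj (schar (n - j%:Z) k z))).
      rewrite (cintegral_sum (F := fun i z => \sum_(j < M)
        (schar (n - i%:Z) k z * Num.conj (schar (n - j%:Z) k z)))).
      - under eq_bigr => i _.
          rewrite (cintegral_sum (F := fun j z => schar (n - i%:Z) k z *
            Num.conj (schar (n - j%:Z) k z))) ?(mu_finite mu)//.
          under eq_bigr do rewrite cintegral_schar_orthonormal//.
          rewrite (bigD1 i)//= eqxx big1 ?addr0; last first.
            by move=> j ji; rewrite -val_eqE eq_sym/= in ji; rewrite (negbTE ji).
          over.
        by rewrite sumr_const card_ord.
      - exact: mu_finite.
      - by move=> i; exact: (cbounded_sum M (bij i)).
    apply/funext => z; rewrite /f rmorph_sum/= mulr_suml.
    by apply: eq_bigr => i _; rewrite mulr_sumr.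
  have ffnu : Re (cintegral nu (fun z => f z * Num.conj (f z))) <= M%:R.
    have -> : M%:R = Re (M%:R : R[i]) :> R by rewrite raddfMn.
    rewrite -ff /cintegral/=.
    have [ri _] := bounded_cintegrable nuT bff.
    have [rmu _] := bounded_cintegrable (mu_finite mu) bff.
    have ff0 z : 0 <= Re (f z * Num.conj (f z)).
      by case: (f z) => a b /=; rewrite mulrN opprK -!expr2 addr_ge0 ?sqr_ge0.
    rewrite /Rintegral integral_mrestr//; apply: fine_le.
    - by apply: integrable_fin_num => //; exact: integrableS rmu.
    - exact: integrable_fin_num.
    - apply: ge0_subset_integral => //; first exact: measurable_int rmu.
      by move=> x _; rewrite lee_fin.
  (* With a the integral of f over [E], expanding the integral of |a - f|^2 over [E] gives 0 <=
     |a|^2 mu(E) - 2|a|^2 + M at most; since mu(E) <= 1, |a|^2 <= M. *)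
  pose a : R[i] := M%:R * c.
  pose u (z : sol) : R[i] := a * 1 + -1 * f z.
  have u0 : 0 <= Re (cintegral nu (fun z => u z * Num.conj (u z))).
    apply: Rintegral_ge0 => x _; case: (u x) => s t /=.
    by rewrite mulrN opprK -!expr2 addr_ge0 ?sqr_ge0.
  have Eu : cintegral nu (fun z => u z * Num.conj (u z)) =
      a * Num.conj a * p%:C%C - a * Num.conj a - Num.conj a * a
      + cintegral nu (fun z => f z * Num.conj (f z)).
    have b1 : cbounded (fun=> 1 : R[i]) := cbounded_cst _ 1.
    rewrite (_ : (fun z => _) = (fun z => a * Num.conj a * 1 + (- a * Num.conj (f z) +
      (- Num.conj a * f z + f z * Num.conj (f z))))); last first.
      by apply/funext => z; rewrite /u rmorphD !rmorphM rmorphN rmorph1; ring.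
    have bZ b g : cbounded g -> cbounded (fun z : sol => b * g z).
      by move=> bg; apply: (cboundedM (cbounded_cst _ b)).
    have bD g h : cbounded g -> cbounded h -> cbounded (fun z : sol => g z + h z).
      move=> bg bh; have := cboundedD 1 bg bh; congr cbounded.
      by apply/funext => z; rewrite mul1r.
    have bi g : cbounded g -> cintegrable nu g := @bounded_cintegrable _ _ _ nu nuT g.
    have fcn := cboundedJ bf.
    rewrite cintegralD; [|by apply/bi/bZ|by apply/bi/bD; [exact: bZ|apply: bD => //; exact: bZ]].
    rewrite cintegralD; [|by apply/bi/bZ|by apply/bi/bD => //; exact: bZ].
    rewrite cintegralD; [|by apply/bi/bZ|exact: bi].
    rewrite !cintegralZ; do ?exact: bi.
    rewrite cintegralJ; last exact: bi.
    rewrite fc -[M%:R * c]/a.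
    have -> : cintegral nu (fun=> 1) = p%:C%C.
      rewrite /cintegral/= /Rintegral integral_cst//= mul1e integral0.
      by rewrite -[mrestr _ _ _]/(mu (setT `&` E)) setTI.
    by ring.
  move: u0; rewrite Eu => u0.
  have aa : a * Num.conj a = (normc a ^+ 2)%:C%C.
    rewrite sqr_normcE; case: (a) => s t /=.
    by apply/eqP; rewrite eq_complex/=; apply/andP; split; apply/eqP; ring.
  have na : normc a ^+ 2 = M%:R ^+ 2 * normc c ^+ 2.
    rewrite normcM exprMn; congr (_ * _).
    have -> : (M%:R : R[i]) = M%:R%:C%C by rewrite rmorph_nat.
    by rewrite normc_real real_normK ?num_real.
  move: u0; rewrite [Num.conj a * a]mulrC aa.
  have -> (X q : R) (I : R[i]) : Re (X%:C%C * q%:C%C - X%:C%C - X%:C%C + I) =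
      X * q - X - X + Re I by case: I => s t /=; ring.
  move=> u0.
  rewrite -na; have := sqr_ge0 (normc a); nra.
apply: eq0_normc; apply/eqP; rewrite -sqrf_eq0; apply/negPn/negP => c0.
have cc : 0 < normc c ^+ 2 by rewrite lt_neqAle eq_sym c0 sqr_ge0.
(* Any M > 1/|c|^2 contradicts M |c|^2 <= 1. *)
have /archi_boundP : 0 <= (normc c ^+ 2)^-1 by rewrite invr_ge0 ltW.
set M := Num.bound _ => cM; have := key M.
have M0 : 0 < M%:R :> R by apply: lt_trans cM; rewrite invr_gt0.
rewrite expr2 -mulrA -[leRHS]mulr1 ler_pM2l//.
by rewrite leNgt -ltr_pdivrMr// mul1r cM.
Qed.

(** The restriction of mu to [E] and the multiple mu(E) mu have the same Fourier coefficients, so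
    they coincide; evaluated at [E] they give mu(E) = mu(E)^2. *)
Lemma solenoid_ergodic : mu E = 0%E \/ mu E = 1%E.
Proof.
pose p : {nonneg R} := NngNum (fine_ge0 (measure_ge0 mu E)).
pose nu2 : {measure set sol -> \bar R} := mscale p mu.
have pE : p%:num%:E = mu E by rewrite /= fineK// fin_num_measure.
have nu2T : (nu2 setT < +oo)%E.
  by rewrite /nu2/= /mscale/= probability_setT mule1 ltry.
have : nu E = nu2 E.
  apply: solenoid_measure_unique => // n k.
  have [->|k0] := eqVneq k 0.
    rewrite !cintegral_schar0 /nu2/= /mscale/= probability_setT mule1.
    by rewrite -[mrestr _ _ _]/(mu (setT `&` E)) setTI.
  rewrite invariant_schar0//; apply/esym.
  rewrite cintegral_mscale ?(cintegral_schar N_ge2 mu_haar n k0) ?mulr0//.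
  exact: (bounded_cintegrable (mu_finite mu) (@cbounded_schar R N n k)).
rewrite nuE setIid -[nu2 E]/(p%:num%:E * mu E)%E -pE => -[pE2].
have {}pE2 : p%:num * p%:num = p%:num :> R by rewrite [RHS]pE2.
have /eqP : p%:num * (1 - p%:num) = 0 by rewrite mulrBr mulr1 pE2 subrr.
rewrite mulf_eq0 subr_eq0 => /orP[/eqP ->|/eqP <-]; first by left.
by right.
Qed.

End InvariantSet.
End Ergodicity.

(** * The Hilbert space L2 *)

Section L2basics.
Context d (T : measurableType d) (R : realType) (mu : {measure set T -> \bar R}).
Local Notation L2 := (L2 mu).
Local Notation dot := (@L2dot _ _ _ mu).
Implicit Types (F G : L2) (f g : T -> R[i]).

(** Total by convention: a function that is not square integrable is sent to the class of 0, so
    operators can be written on plain functions. *)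
Definition mkL2 f : L2 := L2class (insubd (0 : L2fun mu) f).

Lemma mkL2P f : square_integrable mu f -> L2represents (mkL2 f) f.
Proof.
move=> f2; apply: filterS (L2classK (insubd (0 : L2fun mu) f)) => x ->.
have -> : L2val (insubd (0 : L2fun mu) f) = f; last by [].
by apply: insubdK; apply/asboolP.
Qed.

Lemma L2_eq F G : {ae mu, forall x, F x = G x} -> F = G.
Proof. by move=> FG; rewrite -[F]L2class_repr -[G]L2class_repr; exact/L2class_eqP. Qed.

Lemma L2repr0_ae : {ae mu, forall x, L2repr (0 : L2) x = 0}.
Proof.
by have := L2Z_ae 0 (0 : L2); rewrite scale0r; apply: filterS => x ->; rewrite mul0r.
Qed.

Lemma L2represents_eq F f : square_integrable mu f -> L2represents F f -> F = mkL2 f.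
Proof.
move=> f2 Ff; apply: L2_eq; apply: filterS2 Ff (mkL2P f2) => x -> ->; by [].
Qed.

Lemma mkL2_repr F : mkL2 F = F.
Proof. by apply/esym/L2represents_eq; [exact: L2P|exact: aeW]. Qed.

Lemma eq_mkL2 f g : square_integrable mu f -> square_integrable mu g ->
  {ae mu, forall x, f x = g x} -> mkL2 f = mkL2 g.
Proof.
move=> f2 g2 fg; apply: L2represents_eq => //.
by apply: filterS2 fg (mkL2P f2) => x -> ->.
Qed.

Lemma filterS4 (X : Type) (F : set_system X) (FF : Filter F) (P1 P2 P3 P4 Q : set X) :
  (forall x, P1 x -> P2 x -> P3 x -> P4 x -> Q x) ->
  F P1 -> F P2 -> F P3 -> F P4 -> F Q.
Proof.
move=> PQ f1 f2 f3 f4; apply: filterS2 (filterI f1 f2) (filterI f3 f4).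
by move=> x [? ?] [? ?]; exact: PQ.
Qed.

Lemma mkL2_lin a f g : square_integrable mu f -> square_integrable mu g ->
  mkL2 (fun x => a * f x + g x) = a *: mkL2 f + mkL2 g.
Proof.
move=> f2 g2; apply/esym/L2represents_eq.
  exact/square_integrableD/g2/square_integrableZ.
apply: filterS4 (L2D_ae (a *: mkL2 f) (mkL2 g)) (L2Z_ae a (mkL2 f)) (mkL2P f2)
  (mkL2P g2) => x.
by move=> -> -> -> ->.
Qed.

Lemma L2dot_mk f g : square_integrable mu f -> square_integrable mu g ->
  dot (mkL2 f) (mkL2 g) = cintegral mu (fun x => f x * Num.conj (g x)).
Proof.
move=> f2 g2; apply: ae_eq_cintegral.
- exact: cintegrableM (L2P _) (L2P _).
- exact: cintegrableM.
- by apply: filterS2 (mkL2P f2) (mkL2P g2) => x -> ->.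
Qed.

Lemma mulcJ (z : R[i]) : z * Num.conj z = (normc z ^+ 2)%:C%C.
Proof.
rewrite sqr_normcE; case: z => a b.
by apply/eqP; rewrite eq_complex /=; apply/andP; split; apply/eqP; ring.
Qed.

Lemma sqr_hnorm F : hnorm dot F ^+ 2 = \int[mu]_x normc (F x) ^+ 2.
Proof.
have E : Re (dot F F) = \int[mu]_x normc (F x) ^+ 2.
  by apply: eq_Rintegral => x _; rewrite mulcJ.
rewrite /hnorm sqr_sqrtr E//.
by apply: Rintegral_ge0 => x _; exact: sqr_ge0.
Qed.

Lemma sqr_hnorm_mk f : square_integrable mu f ->
  hnorm dot (mkL2 f) ^+ 2 = \int[mu]_x normc (f x) ^+ 2.
Proof.
move=> f2; have E : Re (dot (mkL2 f) (mkL2 f)) = \int[mu]_x normc (f x) ^+ 2.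
  by rewrite L2dot_mk//; apply: eq_Rintegral => x _; rewrite mulcJ.
rewrite /hnorm sqr_sqrtr E//.
by apply: Rintegral_ge0 => x _; exact: sqr_ge0.
Qed.

Lemma hnorm_ge0 F : 0 <= hnorm dot F.
Proof. exact: sqrtr_ge0. Qed.

Lemma EFin_Rintegral_sqr f : square_integrable mu f ->
  (\int[mu]_x normc (f x) ^+ 2)%:E = (\int[mu]_x (normc (f x) ^+ 2)%:E)%E.
Proof.
move=> /square_integrableE[_ fi]; rewrite /Rintegral fineK//.
exact: integrable_fin_num.
Qed.

(** A crude substitute for the triangle inequality, obtained pointwise from |a + b|^2 <= 2|a|^2 +
    2|b|^2; it is enough for completeness and avoids Cauchy-Schwarz. *)
Lemma sqr_hnormD F G :
  hnorm dot (F + G) ^+ 2 <= 2 * hnorm dot F ^+ 2 + 2 * hnorm dot G ^+ 2.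
Proof.
have fi h : square_integrable mu h ->
    mu.-integrable setT (EFin \o (fun x => normc (h x) ^+ 2)).
  by move=> /square_integrableE[].
have FG2 := square_integrableD (L2P F) (L2P G).
have -> : F + G = mkL2 (fun x => F x + G x).
  have := mkL2_lin 1 (L2P F) (L2P G); rewrite !mkL2_repr scale1r => <-.
  by congr mkL2; apply/funext => x; rewrite mul1r.
rewrite sqr_hnorm_mk// !sqr_hnorm.
rewrite -!RintegralZl//; try exact/fi/L2P.
have iZ h : square_integrable mu h ->
    mu.-integrable setT (EFin \o (fun x => 2 * normc (h x) ^+ 2)).
  move=> /fi hi; have := integrableZl measurableT 2 hi.
  by congr integrable; apply/funext => x; rewrite /= EFinM.
have iF := iZ _ (L2P F); have iG := iZ _ (L2P G).
rewrite -RintegralD//; apply: le_Rintegral => //; first exact: fi.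
  have := integrableD measurableT iF iG.
  by congr integrable; apply/funext => x; rewrite /= EFinD.
move=> x _; rewrite !sqr_normcE; case: (F x) (G x) => a b [c e] /=.
by have := sqr_ge0 (a - c); have := sqr_ge0 (b - e); nra.
Qed.

Lemma square_integrable_bounded f : (mu setT < +oo)%E -> cbounded f ->
  square_integrable mu f.
Proof.
move=> muT [mf [M fM]]; apply/square_integrableE; split => //.
apply: (bounded_integrable muT (M := M ^+ 2)).
  by have /measurable_EFinP := measurable_sqr_normc mf.
move=> x; rewrite ger0_norm ?sqr_ge0// lerXn2r// ?nnegrE ?normc_ge0//.
exact: le_trans (normc_ge0 _) (fM x).
Qed.

(** Boundedness only almost everywhere, to match [Linfty], from which the multipliers f(z_0)
    arise. *)
Definition ae_cbounded (m : T -> R[i]) : Prop :=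
  cmeasurable m /\ exists M : R, {ae mu, forall x, normc (m x) <= M}.

Lemma cbounded_ae m : cbounded m -> ae_cbounded m.
Proof. by move=> [mm [M mM]]; split => //; exists M; exact: aeW. Qed.

Lemma integral_mul_le m f (M : R) : cmeasurable m ->
  {ae mu, forall x, normc (m x) <= M} -> square_integrable mu f ->
  (\int[mu]_x (normc (m x * f x) ^+ 2)%:E <=
   (M ^+ 2)%:E * \int[mu]_x (normc (f x) ^+ 2)%:E)%E.
Proof.
move=> mm mM [mf fi].
rewrite -ge0_integralZl//; last 3 first.
- exact: measurable_sqr_normc.
- by move=> x _; rewrite lee_fin sqr_ge0.
- by rewrite lee_fin sqr_ge0.
apply: ae_ge0_le_integral => //.
- by move=> x _; rewrite lee_fin sqr_ge0.
- exact/measurable_sqr_normc/cmeasurableM.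
- by move=> x _; rewrite -EFinM lee_fin mulr_ge0 ?sqr_ge0.
- by apply: emeasurable_funM => //; exact: measurable_sqr_normc.
apply: filterS mM => x mxM _; rewrite -EFinM lee_fin normcM exprMn.
rewrite ler_wpM2r ?sqr_ge0// lerXn2r ?nnegrE ?normc_ge0//.
exact: le_trans (normc_ge0 _) mxM.
Qed.

Lemma square_integrableM m f : ae_cbounded m -> square_integrable mu f ->
  square_integrable mu (fun x => m x * f x).
Proof.
move=> [mm [M mM]] f2; split; first exact: cmeasurableM f2.1.
apply: le_lt_trans (integral_mul_le mm mM f2) _.
by rewrite lte_mul_pinfty ?lee_fin ?sqr_ge0//; exact: f2.2.
Qed.

Lemma hcvg_sqr (u : nat -> L2) F :
  hnorm dot (u n - F) ^+ 2 @[n --> \oo] --> (0 : R) -> hcvg dot u F.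
Proof.
move=> c2; apply/cvgr0Pnorm_lt => e e0.
have e20 : 0 < e ^+ 2 by rewrite exprn_gt0.
move/cvgr0Pnorm_lt : c2 => /(_ _ e20); apply: filterS => n.
rewrite !ger0_norm ?sqr_ge0 ?hnorm_ge0//.
by rewrite ltr_pXn2r ?nnegrE ?hnorm_ge0// ltW.
Qed.

(** This turns the bounded pointwise limits of the monotone class into norm limits, under which
    closed subspaces are stable. *)
Lemma mkL2_cvg (f : nat -> T -> R) (l : T -> R) h : square_integrable mu h ->
  (forall n x, `|f n x| <= 1) ->
  (forall n, square_integrable mu (fun x => (f n x)%:C%C * h x)) ->
  (forall x, f ^~ x @ \oo --> l x) ->
  square_integrable mu (fun x => (l x)%:C%C * h x) /\
  hcvg dot (fun n => mkL2 (fun x => (f n x)%:C%C * h x))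
    (mkL2 (fun x => (l x)%:C%C * h x)).
Proof.
move=> h2 f1 fh fl.
have l1 x : `|l x| <= 1 by apply: normr_lim_le1 (fl x) => n; exact: f1.
have ml : cmeasurable (fun x => (l x)%:C%C * h x).
  by apply: cmeasurable_lim fl => n; exact: (fh n).1.
have [_ hi] := (square_integrableE mu h).1 h2.
have lh : square_integrable mu (fun x => (l x)%:C%C * h x).
  apply/square_integrableE; split => //; apply: le_integrable hi => //.
    exact: measurable_sqr_normc.
  move=> x _; rewrite /= lee_fin !ger0_norm ?sqr_ge0// normcM exprMn normc_real.
  by rewrite ler_piMl ?sqr_ge0// exprn_ile1.
split => //.
have d2 n : square_integrable mu (fun x => -1 * ((l x)%:C%C * h x) + (f n x)%:C%C * h x).
  exact/square_integrableD/fh/square_integrableZ.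
have E n : hnorm dot (mkL2 (fun x => (f n x)%:C%C * h x) -
      mkL2 (fun x => (l x)%:C%C * h x)) ^+ 2 =
    \int[mu]_x (`|f n x - l x| ^+ 2 * normc (h x) ^+ 2).
  rewrite addrC -scaleN1r -mkL2_lin// sqr_hnorm_mk//.
  apply: eq_Rintegral => x _.
  have -> : -1 * ((l x)%:C%C * h x) + (f n x)%:C%C * h x = (f n x - l x)%:C%C * h x.
    by rewrite rmorphB; ring.
  by rewrite normcM normc_real exprMn.
rewrite /hcvg.
have c2 : hnorm dot (mkL2 (fun x => (f n x)%:C%C * h x) -
      mkL2 (fun x => (l x)%:C%C * h x)) ^+ 2 @[n --> \oo] --> (0 : R).
  under eq_fun do rewrite E.
  (* The dominating function is 4 |h|^2, because |f_n - l| <= 2. *)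
  have [|||||_ _ H] := @dominated_convergence _ _ _ mu setT measurableT
    (fun n x => (`|f n x - l x| ^+ 2 * normc (h x) ^+ 2)%:E) (cst 0%E)
    (fun x => 4%:E * (normc (h x) ^+ 2)%:E)%E.
  - move=> n; rewrite (_ : (fun x => _) = (fun x => (normc
      (-1 * ((l x)%:C%C * h x) + (f n x)%:C%C * h x) ^+ 2)%:E)).
      exact/measurable_sqr_normc/(d2 n).1.
    apply/funext => x; rewrite (_ : _ + _ = (f n x - l x)%:C%C * h x).
      by rewrite normcM normc_real exprMn.
    by rewrite rmorphB; ring.
  - exact: measurable_cst.
  - apply: aeW => x _; apply: cvg_EFin; first exact: nearW.
    rewrite [X in _ --> X](_ : _ = `|l x - l x| ^+ 2 * normc (h x) ^+ 2); last first.
      by rewrite subrr normr0 expr0n mul0r.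
    apply: cvgM; last exact: cvg_cst.
    rewrite /GRing.exp/=; apply: cvgM; apply: cvg_norm; apply: cvgB;
      by [exact: fl|exact: cvg_cst].
  - exact: integrableZl.
  - apply: aeW => x n _; rewrite -EFinM lee_fin.
    rewrite ger0_norm; last by rewrite mulr_ge0 ?exprn_even_ge0.
    rewrite ler_wpM2r ?sqr_ge0//.
    have : `|f n x - l x| <= 2.
      by apply: le_trans (ler_normB _ _) _; have := f1 n x; have := l1 x; lra.
    by have := normr_ge0 (f n x - l x); nra.
  by rewrite /Rintegral; apply: fine_cvg; move: H; rewrite integral0.
exact: hcvg_sqr c2.
Qed.

End L2basics.

(** * Completeness of L2 *)

Section Completeness.
Context d (T : measurableType d) (R : realType) (mu : probability T R).
Local Notation L2 := (L2 mu).
Local Notation dot := (@L2dot _ _ _ mu).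

Lemma sqr_hnormB (F G : L2) : hnorm dot (F - G) ^+ 2 =
  \int[mu]_x normc (F x - G x) ^+ 2.
Proof.
have FG : F - G = mkL2 mu (fun x => -1 * G x + F x).
  by rewrite mkL2_lin ?mkL2_repr ?scaleN1r 1?addrC//; exact: L2P.
rewrite FG sqr_hnorm_mk.
  by apply: eq_Rintegral => x _; rewrite mulN1r addrC.
by apply: square_integrableD (L2P F); exact: square_integrableZ (L2P G).
Qed.

Lemma square_integrableB (f g : T -> R[i]) : square_integrable mu f ->
  square_integrable mu g -> square_integrable mu (fun x => f x - g x).
Proof.
move=> f2 g2; have := square_integrableD f2 (square_integrableZ (-1) g2).
by congr square_integrable; apply/funext => x; rewrite mulN1r.
Qed.

Lemma hnormB (F G : L2) : hnorm dot (F - G) = hnorm dot (G - F).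
Proof.
apply/eqP; rewrite -(eqrXn2 (n := 2)) ?hnorm_ge0// !sqr_hnormB; apply/eqP.
apply: eq_Rintegral => x _; congr (_ ^+ 2).
by rewrite -[in LHS]opprB; exact: normcN.
Qed.

Lemma EFin_sqr_hnormB (F G : L2) :
  (\int[mu]_x (normc (F x - G x) ^+ 2)%:E = (hnorm dot (F - G) ^+ 2)%:E)%E.
Proof.
rewrite sqr_hnormB (EFin_Rintegral_sqr (f := fun x => F x - G x))//.
exact: square_integrableB (L2P _) (L2P _).
Qed.

Lemma is_cvg_telescope (a : nat -> R) (b : nat -> R) (S : R) :
  (forall k, `|a k.+1 - a k| <= b k) -> (forall n, \sum_(k < n) b k <= S) ->
  cvgn a.
Proof.
move=> ab bS; have b0 k : 0 <= b k := le_trans (normr_ge0 _) (ab k).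
pose c k := a k.+1 - a k.
have cc : cvgn (series (fun k => `|c k|)).
  apply: nondecreasing_is_cvgn.
    by apply: nondecreasing_series => n _ _; exact: normr_ge0.
  exists S => _ [n _ <-]; apply: le_trans (bS n).
  by rewrite /series/= big_mkord; apply: ler_sum => i _; exact: ab.
have cs := normed_cvg cc.
rewrite (_ : a = (fun n => a 0%N + series c n)).
  by apply: is_cvgD => //; exact: is_cvg_cst.
apply/funext => n; rewrite /series/= /c telescope_sumr//.
by rewrite addrCA subrr addr0.
Qed.

Lemma fatou_real (f : nat -> T -> R) (l : T -> R) (c : R) :
  (forall n, measurable_fun setT (f n)) -> (forall n x, 0 <= f n x) ->
  (forall x, f ^~ x @ \oo --> l x) ->
  (forall n, (\int[mu]_x (f n x)%:E <= c%:E)%E) ->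
  (\int[mu]_x (l x)%:E <= c%:E)%E.
Proof.
move=> mf f0 fl fc.
have -> : (fun x => (l x)%:E) = (fun x => limn_einf (fun n => (f n x)%:E)).
  apply/funext => x; have fx : (f n x)%:E @[n --> \oo] --> (l x)%:E.
    by apply: cvg_EFin; [exact: nearW|exact: fl].
  by rewrite is_cvg_limn_einfE; [exact/esym/cvg_lim|apply/cvg_ex; exists (l x)%:E].
apply: le_trans (fatou _ _ _ _) _ => //.
- by move=> n; exact/measurable_EFinP.
- by move=> n x _; rewrite lee_fin.
rewrite limn_einf_lim; apply: lime_le; first exact: is_cvg_einfs.
apply: nearW => n; apply: le_trans (fc n).
by apply: ereal_inf_lbound; exists n => /=.
Qed.

(* Along a subsequence with [|v_(k+1) - v_k| < 2^-k] the functions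
   [sum_k normc (v_(k+1) - v_k)] have finite integral, so [v] converges almost
   everywhere; Fatou's lemma turns this into convergence in L2. *)
Lemma L2_fast_cauchy (v : nat -> L2) :
  (forall k m n, (k <= m)%N -> (k <= n)%N -> hnorm dot (v m - v n) < 2^-1 ^+ k) ->
  exists F : L2, forall k, hnorm dot (v k - F) <= 2^-1 ^+ k.
Proof.
move=> vc.
have v2 k := L2P (v k).
pose dd k x := v k.+1 x - v k x.
have d2 k : square_integrable mu (dd k) := square_integrableB (v2 _) (v2 _).
have mnd k : measurable_fun setT (fun x => (normc (dd k x))%:E).
  have /measurable_EFinP m := measurable_sqr_normc (d2 k).1.
  apply/measurable_EFinP.
  rewrite (_ : (fun x => _) = (fun x => Num.sqrt (normc (dd k x) ^+ 2))).
    exact: (measurableT_comp (continuous_measurable_fun (@sqrt_continuous R)) m).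
  by apply/funext => x; rewrite sqrtr_sqr ger0_norm ?normc_ge0.
(* From L2 to L1 by t <= t^2/(2q) + q/2 with q = 2^-k: as the total mass is 1, each term contributes
   at most q/2. *)
have intd k : (\int[mu]_x (normc (dd k x))%:E <= (2^-1 ^+ k)%:E)%E.
  pose q : R := 2^-1 ^+ k.
  have q0 : 0 < q by rewrite exprn_gt0.
  have q1 : 0 <= q^-1 / 2 by rewrite divr_ge0// invr_ge0 ltW.
  have mq : measurable_fun setT (fun x => ((q^-1 / 2)%:E * (normc (dd k x) ^+ 2)%:E)%E).
    by apply: emeasurable_funM => //; exact: measurable_sqr_normc (d2 k).1.
  apply: (@le_trans _ _ (\int[mu]_x ((q^-1 / 2)%:E * (normc (dd k x) ^+ 2)%:E + (q / 2)%:E))%E).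
    apply: ge0_le_integral => //.
    - by move=> x _; rewrite lee_fin normc_ge0.
    - exact: emeasurable_funD.
    - move=> x _; rewrite -EFinM -EFinD lee_fin.
      set t := normc _; have -> : q^-1 / 2 * t ^+ 2 + q / 2 =
          t + q^-1 / 2 * (t - q) ^+ 2 by field; rewrite gt_eqF.
      by rewrite lerDl mulr_ge0 ?sqr_ge0 ?divr_ge0 ?invr_ge0 ?ltW.
  rewrite ge0_integralD//; last 2 first.
  - by move=> x _; rewrite -EFinM lee_fin mulr_ge0 ?sqr_ge0 ?divr_ge0 ?invr_ge0 ?ltW.
  - by move=> x _; rewrite lee_fin divr_ge0 ?ltW.
  rewrite ge0_integralZl//; last 2 first.
  - exact: (measurable_sqr_normc (d2 k).1).
  - by move=> x _; rewrite lee_fin sqr_ge0.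
  have -> : (\int[mu]__ (q / 2)%:E = (q / 2)%:E)%E.
    by rewrite integral_cst//= probability_setT mule1.
  rewrite EFin_sqr_hnormB -EFinM -EFinD lee_fin.
  have : hnorm dot (v k.+1 - v k) ^+ 2 <= q ^+ 2.
    by rewrite lerXn2r ?nnegrE ?hnorm_ge0 ?ltW//; apply: vc.
  move=> h; have : q^-1 / 2 * hnorm dot (v k.+1 - v k) ^+ 2 <= q^-1 / 2 * q ^+ 2.
    exact: ler_wpM2l.
  have -> : q^-1 / 2 * q ^+ 2 = q / 2 by field; rewrite gt_eqF.
  by rewrite -/q; lra.
pose S x := (\sum_(k <oo) (normc (dd k x))%:E)%E.
have S0 x : (0 <= S x)%E by apply: nneseries_ge0 => n _ _; rewrite lee_fin normc_ge0.
have mS : measurable_fun setT S.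
  by apply: ge0_emeasurable_sum => // k x _ _; rewrite lee_fin normc_ge0.
have intS : (\int[mu]_x S x < +oo)%E.
  rewrite integral_nneseries//; last by move=> n x _; rewrite lee_fin normc_ge0.
  apply: (@le_lt_trans _ _ (\sum_(k <oo) (2^-1 ^+ k)%:E)%E).
    apply: lee_nneseries => [n _ _|n _]; last exact: intd.
    by apply: integral_ge0 => x _; rewrite lee_fin normc_ge0.
  have := @cvg_geometric_series R 1 2^-1; rewrite ger0_norm// => /(_ _) h.
  apply: (@le_lt_trans _ _ 2%:E); last exact: ltry.
  apply: lime_le.
    by apply: is_cvg_nneseries => n _ _; rewrite lee_fin exprn_ge0.
  apply: nearW => n; rewrite /= big_mkord sumEFin lee_fin.
  have -> : \sum_(i < n) 2^-1 ^+ i = 2 - 2 * 2^-1 ^+ n :> R.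
    elim: n => [|n IH]; first by rewrite big_ord0 expr0; lra.
    by rewrite big_ord_recr/= IH exprS; lra.
  have : 0 <= 2^-1 ^+ n :> R by rewrite exprn_ge0.
  lra.
have iS : mu.-integrable setT S.
  apply/integrableP; split => //.
  by under eq_integral do rewrite gee0_abs//.
pose G := [set x | (S x < +oo)%E].
have mG : measurable G.
  rewrite (_ : G = setT `&` [set x | (S x < cst +oo x)%E]); last by rewrite setTI.
  exact: measurable_lte.
have aeG : {ae mu, forall x, G x}.
  apply: filterS (integrable_ae measurableT iS) => x /(_ I) fx.
  by rewrite /G/= ltey_eq fx.
(* Cutting off outside [G] makes the sequences converge everywhere, so the limit is measurable
   without modification on a null set. *)
pose r k x : R := \1_G x * Re (v k x).
pose s k x : R := \1_G x * Im (v k x).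
have partial x : G x -> forall n, \sum_(k < n) normc (dd k x) <= fine (S x).
  move=> Gx n; rewrite -lee_fin fineK ?ge0_fin_numE// -sumEFin.
  rewrite -(big_mkord xpredT (fun k => (normc (dd k x))%:E)).
  by apply: nneseries_lim_ge => k _; rewrite lee_fin normc_ge0.
have cr x : cvgn (r ^~ x).
  have [Gx|nGx] := pselect (G x).
    apply: (is_cvg_telescope (b := fun k => normc (dd k x)) _ (partial _ Gx)) => k.
    rewrite /r indicE mem_set//= !mul1r; apply: le_trans (ler_Re_normc _).
    by rewrite /dd; case: (v k.+1 x) (v k x) => a b [c e].
  rewrite /r indicE memNset//=; under eq_fun do rewrite mul0r; exact: is_cvg_cst.
have cs x : cvgn (s ^~ x).
  have [Gx|nGx] := pselect (G x).
    apply: (is_cvg_telescope (b := fun k => normc (dd k x)) _ (partial _ Gx)) => k.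
    rewrite /s indicE mem_set//= !mul1r; apply: le_trans (ler_Im_normc _).
    by rewrite /dd; case: (v k.+1 x) (v k x) => a b [c e].
  rewrite /s indicE memNset//=; under eq_fun do rewrite mul0r; exact: is_cvg_cst.
pose w x : R[i] := Complex (limn (r ^~ x)) (limn (s ^~ x)).
have mr k : measurable_fun setT (r k).
  by apply: measurable_funM; [exact: measurable_indic|exact: (v2 k).1.1].
have ms k : measurable_fun setT (s k).
  by apply: measurable_funM; [exact: measurable_indic|exact: (v2 k).1.2].
have mw : cmeasurable w.
  split; [apply: measurable_fun_cvg mr _ => x _; exact: cr|].
  by apply: measurable_fun_cvg ms _ => x _; exact: cs.
have bound k : (\int[mu]_x (normc (w x - v k x) ^+ 2)%:E <= (2^-1 ^+ k ^+ 2)%:E)%E.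
  (* Starting at index k leaves the limit unchanged and puts every term of the Fatou sequence under
     the bound for k. *)
  pose f j x : R := (r (j + k)%N x - Re (v k x)) ^+ 2 + (s (j + k)%N x - Im (v k x)) ^+ 2.
  have -> : (fun x => (normc (w x - v k x) ^+ 2)%:E) =
      (fun x => ((limn (r ^~ x) - Re (v k x)) ^+ 2 + (limn (s ^~ x) - Im (v k x)) ^+ 2)%:E).
    apply/funext => x; rewrite sqr_normcE /w.
    by case: (v k x).
  apply: (fatou_real (f := f)).
  - move=> j; apply: measurable_funD; apply: measurable_funX; apply: measurable_funB => //.
      exact: (v2 k).1.1.
    exact: (v2 k).1.2.
  - by move=> j x; rewrite addr_ge0 ?sqr_ge0.
  - move=> x.
    have c1 : r (j + k)%N x - Re (v k x) @[j --> \oo] --> limn (r ^~ x) - Re (v k x).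
      apply: cvgB; last exact: cvg_cst.
      by rewrite (cvg_shiftn k (r ^~ x)); exact: cr.
    have c2 : s (j + k)%N x - Im (v k x) @[j --> \oo] --> limn (s ^~ x) - Im (v k x).
      apply: cvgB; last exact: cvg_cst.
      by rewrite (cvg_shiftn k (s ^~ x)); exact: cs.
    exact: cvgD (cvgM c1 c1) (cvgM c2 c2).
  - move=> j; apply: (@le_trans _ _ (\int[mu]_x (normc (v (j + k)%N x - v k x) ^+ 2)%:E)%E).
      rewrite le_eqVlt; apply/orP; left; apply/eqP.
      apply: ae_eq_integral => //.
      + apply/measurable_EFinP; apply: measurable_funD; apply: measurable_funX;
          apply: measurable_funB => //.
          exact: (v2 k).1.1.
        exact: (v2 k).1.2.
      + exact/measurable_sqr_normc/(square_integrableB (v2 _) (v2 _)).1.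
      + apply: filterS aeG => x Gx _; congr EFin.
        rewrite sqr_normcE /f /r /s indicE mem_set//= !mul1r.
        by case: (v (j + k)%N x) (v k x) => a b [c e].
    rewrite EFin_sqr_hnormB lee_fin lerXn2r ?nnegrE ?hnorm_ge0 ?exprn_ge0//.
    by apply/ltW/vc => //; exact: leq_addl.
have wv2 k : square_integrable mu (fun x => w x - v k x).
  split; last exact: le_lt_trans (bound k) (ltry _).
  have := cmeasurableD mw (square_integrableZ (-1) (v2 k)).1.
  by congr cmeasurable; apply/funext => x; rewrite mulN1r.
have w2 : square_integrable mu w.
  have := square_integrableD (wv2 0%N) (v2 0%N).
  by congr square_integrable; apply/funext => x; rewrite subrK.
exists (mkL2 mu w) => k; rewrite hnormB.
rewrite -(ler_pXn2r (n := 2)) ?nnegrE ?hnorm_ge0 ?exprn_ge0//.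
rewrite -lee_fin -EFin_sqr_hnormB; apply: le_trans (bound k).
rewrite le_eqVlt; apply/orP; left; apply/eqP; apply: ae_eq_integral => //.
- exact/measurable_sqr_normc/(square_integrableB (L2P _) (L2P _)).1.
- exact/measurable_sqr_normc/(wv2 k).1.
- by apply: filterS (mkL2P w2) => x -> _.
Qed.

Lemma L2_hilbert : hilbert dot.
Proof.
move=> u uc.
have e0 k : 0 < 2^-1 ^+ k :> R by rewrite exprn_gt0.
have [K hK] : exists K : nat -> nat, forall k m n, (K k <= m)%N -> (K k <= n)%N ->
    hnorm dot (u m - u n) < 2^-1 ^+ k.
  have [K hK] := choice (fun k => uc _ (e0 k)).
  by exists K => k m n; exact: hK.
(* Partial sums give indices that are nondecreasing in k and at least [K k]. *)
pose m k := \sum_(j < k.+1) K j.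
have Km k : (K k <= m k)%N by rewrite /m big_ord_recr leq_addl.
have mm k l : (k <= l)%N -> (m k <= m l)%N.
  move=> kl; rewrite -(subnKC kl); elim: (l - k)%N => [|n IH]; first by rewrite addn0.
  by apply: leq_trans IH _; rewrite addnS /m [leqRHS]big_ord_recr leq_addr.
have [F hF] := @L2_fast_cauchy (fun k => u (m k)) (fun k a b ka kb =>
  hK k _ _ (leq_trans (Km k) (mm _ _ ka)) (leq_trans (Km k) (mm _ _ kb))).
exists F; apply: hcvg_sqr; apply/cvgr0Pnorm_lt => e ee.
(* With q = 2^-k <= 1 the squared distance is at most 2q^2 + 2q^2 <= 4q, which is below e once q <
   e/8. *)
have ee4 : 0 < e / 8 by rewrite divr_gt0.
have : (2^-1 ^+ k : R) @[k --> \oo] --> 0 by apply: cvg_expr; rewrite ger0_norm; lra.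
move/cvgr0Pnorm_lt => /(_ _ ee4)[k _ /(_ k (leqnn k))]; rewrite ger0_norm ?ltW// => hk.
exists (m k) => // n /= mn; rewrite ger0_norm ?sqr_ge0//.
have -> : u n - F = (u n - u (m k)) + (u (m k) - F) by rewrite addrA subrK.
apply: le_lt_trans (sqr_hnormD _ _) _.
have h1 := hK k n (m k) (leq_trans (Km k) mn) (Km k).
have h2 := hF k; have h3 := hnorm_ge0 (u n - u (m k)); have h4 := hnorm_ge0 (u (m k) - F).
have q1 : 2^-1 ^+ k <= 1 :> R by apply: exprn_ile1; lra.
have q0 := e0 k.
nra.
Qed.

End Completeness.

(** * Multiplication and composition operators *)

Section Density.
Context d (T : measurableType d) (R : realType) (mu : probability T R).
Variable h : T -> R.
Hypothesis h0 : forall x, 0 <= h x.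
Hypothesis ih : mu.-integrable setT (EFin \o h).

Definition density (A : set T) : \bar R := (\int[mu]_(x in A) (h x)%:E)%E.

Let density0 : density set0 = 0%E.
Proof. exact: integral_set0. Qed.

Let density_ge0 A : (0 <= density A)%E.
Proof. by apply: integral_ge0 => x _; rewrite lee_fin. Qed.

Let density_sigma_additive : semi_sigma_additive density.
Proof.
apply: semi_sigma_additive_nng_induced; first exact: measurable_int ih.
by move=> x; rewrite lee_fin.
Qed.

HB.instance Definition _ := isMeasure.Build _ _ _ density
  density0 density_ge0 density_sigma_additive.

Let density_fin : fin_num_fun density.
Proof.
move=> A mA; apply: integrable_fin_num => //.
exact: (integrableS measurableT mA (@subsetT _ _) ih).
Qed.

HB.instance Definition _ := Measure_isFinite.Build _ _ _ density density_fin.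

Definition density_measure : {finite_measure set T -> \bar R} := density.

Lemma density_dominated : density_measure `<< mu.
Proof.
apply/null_content_dominatesP => A mA A0.
rewrite -[LHS]/(density A) /density.
apply: null_set_integral => //; exact: (measurable_funTS (measurable_int _ ih)).
Qed.

Lemma density_ae (P : set T) : {ae mu, forall x, P x} ->
  {ae density_measure, forall x, P x}.
Proof.
move=> [A [mA A0 PA]]; exists A; split => //.
by move/null_content_dominatesP : density_dominated => /(_ A mA A0).
Qed.

(** The Radon-Nikodym derivative equals [h] almost everywhere, both having the same integral over
    every measurable set; the change of variables then applies. *)
Lemma integral_density (f : T -> \bar R) : density_measure.-integrable setT f ->
  (\int[density_measure]_x f x = \int[mu]_x (f x * (h x)%:E))%E.
Proof.
move=> fi; rewrite -(Radon_Nikodym_change_of_variables density_dominated)//.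
have mf := measurable_int _ fi.
have mh := measurable_int _ ih.
have iRN : mu.-integrable setT
    (Radon_Nikodym (charge_of_finite_measure density_measure) mu).
  by apply: Radon_Nikodym_integrable; exact: density_dominated.
have mRN := measurable_int _ iRN.
apply: ae_eq_integral => //; do ?exact: emeasurable_funM.
have : ae_eq mu setT (Radon_Nikodym (charge_of_finite_measure density_measure) mu)
    (EFin \o h).
  apply: integral_ae_eq => //.
    move=> A _ mA.
    by rewrite -Radon_Nikodym_integral//; exact: density_dominated.
by apply: filterS => x /(_ I) e _; rewrite e.
Qed.

Lemma cintegrable_density (f : T -> R[i]) : ae_cbounded mu f ->
  cintegrable density_measure f.
Proof.
move=> [mf [M fM]].
have M0 : ({ae density_measure, forall x, normc (f x) <= `|M|})%R.
  apply: density_ae; apply: filterS fM => x /le_trans; apply; exact: ler_norm.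
have iM : density_measure.-integrable setT (EFin \o cst `|M|).
  exact: finite_measure_integrable_cst.
have key (g : T -> R) : measurable_fun setT g ->
    (forall x, `|g x| <= normc (f x)) -> density_measure.-integrable setT (EFin \o g).
  move=> mg gf; apply/integrableP; split; first exact/measurable_EFinP.
  have miM := measurable_int _ iM.
  move/integrableP : iM => [_]; apply: le_lt_trans.
  apply: ae_ge0_le_integral => //.
  - by apply: measurableT_comp => //; exact/measurable_EFinP.
  - by apply: measurableT_comp => //; exact: miM.
  - by apply: filterS M0 => x fx _; rewrite /= lee_fin normr_id (le_trans (gf x)).
split; apply: key; [exact: mf.1|by move=> x; exact: ler_Re_normc
  |exact: mf.2|by move=> x; exact: ler_Im_normc].
Qed.

Lemma cintegral_density (f : T -> R[i]) : ae_cbounded mu f ->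
  cintegral density_measure f = cintegral mu (fun x => f x * (h x)%:C%C).
Proof.
move=> bf; have [ir ii] := cintegrable_density bf.
rewrite /cintegral /Rintegral !integral_density//; congr (Complex (fine _) (fine _)).
  by apply: eq_integral => x _; rewrite mulrC Re_realM mulrC EFinM.
by apply: eq_integral => x _; rewrite mulrC Im_realM mulrC EFinM.
Qed.

End Density.

Section Multiplication.
Context d (T : measurableType d) (R : realType) (mu : probability T R).
Local Notation L2 := (L2 mu).
Local Notation dot := (@L2dot _ _ _ mu).
Implicit Types (F G : L2) (f g m : T -> R[i]).

Definition mulop m F : L2 := mkL2 mu (fun x => m x * F x).

Lemma mulop_repr m F f : ae_cbounded mu m -> L2represents F f ->
  L2represents (mulop m F) (fun x => m x * f x).
Proof.
move=> bm Ff; apply: filterS2 (mkL2P (square_integrableM bm (L2P F))) Ff.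
by move=> x -> ->.
Qed.

Lemma mulop_mk m f : ae_cbounded mu m -> square_integrable mu f ->
  mulop m (mkL2 mu f) = mkL2 mu (fun x => m x * f x).
Proof.
move=> bm f2; apply: L2represents_eq; first exact: square_integrableM.
exact/mulop_repr/mkL2P.
Qed.

Lemma mulop_linear m : ae_cbounded mu m -> linear (mulop m).
Proof.
move=> bm a F G; have FG := square_integrableD (square_integrableZ a (L2P F)) (L2P G).
have -> : a *: F + G = mkL2 mu (fun x => a * L2repr F x + L2repr G x).
  by rewrite mkL2_lin ?mkL2_repr//; exact: L2P.
rewrite mulop_mk// /mulop -mkL2_lin; last 2 first.
- exact/square_integrableM/L2P.
- exact/square_integrableM/L2P.
by congr mkL2; apply/funext => x; ring.
Qed.

Lemma mulop_comp m m' F : ae_cbounded mu m -> ae_cbounded mu m' ->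
  mulop m (mulop m' F) = mulop (fun x => m x * m' x) F.
Proof.
move=> bm bm'; rewrite mulop_mk//; last exact/square_integrableM/L2P.
by congr mkL2; apply/funext => x; ring.
Qed.

Lemma mulop1 F : mulop (fun=> 1) F = F.
Proof. by rewrite -[RHS]mkL2_repr /mulop; congr mkL2; apply/funext => x; rewrite mul1r. Qed.

Lemma mulop_dot m F G : ae_cbounded mu m ->
  dot (mulop m F) G = cintegral mu (fun x => m x * F x * Num.conj (G x)).
Proof.
move=> bm; rewrite -{1}[G]mkL2_repr L2dot_mk//; last exact: L2P.
exact/square_integrableM/L2P.
Qed.

Lemma mulop_dotr m F G : ae_cbounded mu m ->
  dot F (mulop m G) = cintegral mu (fun x => F x * Num.conj (m x * G x)).
Proof.
move=> bm; rewrite -{1}[F]mkL2_repr L2dot_mk//; first exact: L2P.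
exact/square_integrableM/L2P.
Qed.

Lemma mulop_dot_diag m F : ae_cbounded mu m ->
  dot (mulop m F) F = cintegral mu (fun x => m x * (normc (F x) ^+ 2)%:C%C).
Proof.
move=> bm; rewrite mulop_dot//; congr cintegral; apply/funext => x.
by rewrite -mulrA mulcJ.
Qed.

Lemma mulop_bounded m : ae_cbounded mu m -> bounded_operator dot (mulop m).
Proof.
move=> bm; split; first exact: mulop_linear.
have [mm [M mM]] := bm; exists `|M| => F.
rewrite -(ler_pXn2r (n := 2)) ?nnegrE ?hnorm_ge0 ?mulr_ge0 ?hnorm_ge0//.
have mF2 := square_integrableM bm (L2P F).
rewrite exprMn sqr_hnorm_mk// sqr_hnorm -lee_fin EFinM.
rewrite (EFin_Rintegral_sqr mF2) (EFin_Rintegral_sqr (L2P F)).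
apply: integral_mul_le => //; last exact: L2P.
by apply: filterS mM => x /le_trans; apply; exact: ler_norm.
Qed.

End Multiplication.

Section Composition.
Context d (T : measurableType d) (R : realType) (mu : probability T R).
Local Notation L2 := (L2 mu).
Local Notation dot := (@L2dot _ _ _ mu).
Implicit Types (F G : L2) (f g : T -> R[i]).
Variables (phi : T -> T) (mphi : measurable_fun setT phi).
Hypothesis phi_mu : forall A, measurable A -> mu (phi @^-1` A) = mu A.

Definition compop F : L2 := mkL2 mu (fun x => F (phi x)).

(** Null sets pull back to null sets, so composition with [phi] does not depend on the
    representative. *)
Lemma ae_comp (P : set T) : {ae mu, forall x, P x} -> {ae mu, forall x, P (phi x)}.
Proof.
move=> [A [mA A0 PA]]; exists (phi @^-1` A); split.
- by rewrite -[X in measurable X]setTI; exact: mphi.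
- by rewrite phi_mu.
- by move=> x /= nP; exact: PA.
Qed.

Lemma square_integrable_comp f : square_integrable mu f ->
  square_integrable mu (fun x => f (phi x)).
Proof.
move=> [mf fi]; split; first exact: (cmeasurable_comp mphi mf).
apply: le_lt_trans fi; rewrite le_eqVlt; apply/orP; left; apply/eqP.
transitivity (\int[image_measure mphi mu]_x (normc (f x) ^+ 2)%:E)%E.
  rewrite ge0_integral_pushforward//; first exact: measurable_sqr_normc.
  by move=> x _; rewrite lee_fin sqr_ge0.
by apply: eq_measure_integral => A mA _; exact: phi_mu.
Qed.

Lemma cintegral_comp f : cintegrable mu f -> cmeasurable f ->
  cintegrable mu (fun x => f (phi x)) ->
  cintegral mu (fun x => f (phi x)) = cintegral mu f.
Proof.
move=> fi mf fpi; rewrite -(cintegral_image mphi mf fpi).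
by apply: eq_measure_cintegral => A mA; exact: phi_mu.
Qed.

Lemma compop_repr F f : L2represents F f ->
  L2represents (compop F) (fun x => f (phi x)).
Proof.
move=> Ff; apply: filterS2 (mkL2P (square_integrable_comp (L2P F))) (ae_comp Ff).
by move=> x -> ->.
Qed.

Lemma compop_mk f : square_integrable mu f ->
  compop (mkL2 mu f) = mkL2 mu (fun x => f (phi x)).
Proof.
move=> f2; apply: L2represents_eq; first exact: square_integrable_comp.
exact/compop_repr/mkL2P.
Qed.

Lemma compop_linear : linear compop.
Proof.
move=> a F G; have FG := square_integrableD (square_integrableZ a (L2P F)) (L2P G).
have -> : a *: F + G = mkL2 mu (fun x => a * L2repr F x + L2repr G x).
  by rewrite mkL2_lin ?mkL2_repr//; exact: L2P.
rewrite compop_mk// /compop -mkL2_lin//; exact/square_integrable_comp/L2P.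
Qed.

Lemma compop_dot F G : dot (compop F) (compop G) = dot F G.
Proof.
have cF := square_integrable_comp (L2P F); have cG := square_integrable_comp (L2P G).
rewrite L2dot_mk// (@cintegral_comp (fun x => F x * Num.conj (G x)))//.
- exact: cintegrableM (L2P F) (L2P G).
- exact: cmeasurableM (L2P F).1 (cmeasurableJ (L2P G).1).
- exact: (cintegrableM cF cG).
Qed.

Lemma ae_cbounded_comp (m : T -> R[i]) : ae_cbounded mu m ->
  ae_cbounded mu (fun x => m (phi x)).
Proof.
move=> [mm [M mM]]; split; first exact: (cmeasurable_comp mphi mm).
by exists M; exact: (ae_comp mM).
Qed.

Lemma compop_mulop (m : T -> R[i]) F : ae_cbounded mu m ->
  compop (mulop m F) = mulop (fun x => m (phi x)) (compop F).
Proof.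
move=> bm; rewrite {1}/mulop compop_mk; last exact: square_integrableM (L2P F).
rewrite /compop mulop_mk//; first exact: ae_cbounded_comp.
exact: (square_integrable_comp (L2P F)).
Qed.

End Composition.

(** * Closed subspaces stable under indicator functions *)

Section Module.
Context d (T : measurableType d) (R : realType) (mu : probability T R).
Local Notation L2 := (L2 mu).
Local Notation dot := (@L2dot _ _ _ mu).
Variable V : set L2.
Hypothesis closedV : closed_subspace dot V.

(** Membership in [V] as a predicate on functions rather than on classes, so that it can play the
    part of [Q] in the monotone class argument. *)
Definition L2in (h : T -> R[i]) : Prop := square_integrable mu h /\ V (mkL2 mu h).

Lemma L2in_lin (a : R[i]) f g : L2in f -> L2in g -> L2in (fun x => a * f x + g x).
Proof.
move=> [f2 Vf] [g2 Vg]; split; first exact/square_integrableD/g2/square_integrableZ.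
by rewrite mkL2_lin//; have [_ + _] := closedV; apply.
Qed.

Lemma L2in0 h : L2in h -> L2in (fun=> 0).
Proof.
move=> Qh; have := L2in_lin (-1) Qh Qh; congr L2in; apply/funext => x.
by rewrite mulN1r addNr.
Qed.

(** Only the products, not [h] itself, are asked to lie in [V]. This allows [h] to be the function
    whose membership is sought, or the constant 1. *)
Lemma L2in_cvg (f : nat -> T -> R) (l : T -> R) h : square_integrable mu h ->
  (forall n x, `|f n x| <= 1) -> (forall n, L2in (fun x => (f n x)%:C%C * h x)) ->
  (forall x, f ^~ x @ \oo --> l x) -> L2in (fun x => (l x)%:C%C * h x).
Proof.
move=> h2 f1 Qf fl.
have [lh2 cv] := mkL2_cvg h2 f1 (fun n => (Qf n).1) fl; split => //.
by have [_ _ cl] := closedV; apply: cl cv => n; exact: (Qf n).2.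
Qed.

Lemma L2in_lim (f : nat -> T -> R) (l : T -> R) h : L2in h ->
  (forall n x, `|f n x| <= 1) -> (forall n, L2in (fun x => (f n x)%:C%C * h x)) ->
  (forall x, f ^~ x @ \oo --> l x) -> L2in (fun x => (l x)%:C%C * h x).
Proof. by move=> [h2 _]; exact: L2in_cvg. Qed.

Hypothesis V_indic : forall A, measurable A -> multiplier_set L2in A.

Import HBNNSimple.

Lemma L2in_nnsfun (f : {nnsfun T >-> R}) h : L2in h ->
  L2in (fun x => (f x)%:C%C * h x).
Proof.
move=> Qh.
have key (s : seq R) : L2in (fun x =>
    (\sum_(y <- s) y * \1_(f @^-1` [set y]) x)%:C%C * h x).
  elim: s => [|y s IH].
    under eq_fun do rewrite big_nil mul0r; exact: L2in0 Qh.
  have mA : measurable (f @^-1` [set y]) by exact: measurable_funPTI.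
  have := L2in_lin y%:C%C (V_indic mA Qh) IH; congr L2in.
  by apply/funext => x; rewrite big_cons rmorphD rmorphM mulrDl mulrA.
have := key (finmap.enum_fset (fset_set (range f))); congr L2in.
apply/funext => x; congr (_%:C%C * _).
by rewrite [RHS](fimfunE f x) fsbig_finite//; exact: fimfunP.
Qed.

Lemma L2in_ge0 (f : T -> R) h : L2in h -> measurable_fun setT f ->
  (forall x, 0 <= f x) -> square_integrable mu (fun x => (f x)%:C%C * h x) ->
  L2in (fun x => (f x)%:C%C * h x).
Proof.
move=> Qh mf f0 fh2.
have mEf : measurable_fun setT (EFin \o f) by exact/measurable_EFinP.
pose g n := nnsfun_approx measurableT mEf n.
have gf n x : g n x <= f x.
  rewrite -lee_fin /g nnsfun_approxE.
  by apply: (@le_approx _ _ _ setT) => // y _; rewrite lee_fin.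
have gcv x : g n x @[n --> \oo] --> f x.
  have f0' y : setT y -> (0 <= (EFin \o f) y)%E by rewrite lee_fin.
  by have /fine_cvg := cvg_nnsfun_approx measurableT mEf f0' (I : setT x).
(* As f may be unbounded, the simple approximants are written g_n h = (g_n / f) (f h), with factors
   in [0, 1]. Where f = 0, also g_n = 0, and division by 0 gives 0. *)
have := @L2in_cvg (fun n x => g n x / f x) (fun x => f x / f x) _ fh2.
have fK (c : R) x : f x = 0 -> (c / f x)%:C%C * ((f x)%:C%C * h x) = 0.
  by move=> ->; rewrite mul0r mulr0.
have fK2 (c : R) x : f x != 0 -> (c / f x)%:C%C * ((f x)%:C%C * h x) = c%:C%C * h x.
  by move=> fx; rewrite mulrA -rmorphM divfK.
have fl : (fun x => (f x / f x)%:C%C * ((f x)%:C%C * h x)) = (fun x => (f x)%:C%C * h x).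
  apply/funext => x; have [fx|fx] := eqVneq (f x) 0; last by rewrite fK2.
  by rewrite fK// fx mul0r.
rewrite fl; apply.
- move=> n x; have [->|fx] := eqVneq (f x) 0; first by rewrite invr0 mulr0 normr0.
  have fx0 : 0 < f x by rewrite lt_neqAle eq_sym fx f0.
  by rewrite ger0_norm ?divr_ge0// ler_pdivrMr// mul1r.
- move=> n; have := L2in_nnsfun (g n) Qh; congr L2in; apply/funext => x.
  have [fx|fx] := eqVneq (f x) 0; last by rewrite fK2.
  rewrite fK//; have := gf n x; rewrite fx => gx.
  have -> : g n x = 0 by apply/eqP; rewrite eq_le gx/=.
  by rewrite mul0r.
- by move=> x; apply: cvgM; [exact: gcv|exact: cvg_cst].
Qed.

Lemma L2inM (m : T -> R[i]) h : L2in h -> cmeasurable m ->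
  square_integrable mu (fun x => m x * h x) -> L2in (fun x => m x * h x).
Proof.
move=> Qh [mr mi] mh2.
have key (f : T -> R) : measurable_fun setT f -> (forall x, 0 <= f x) ->
    (forall x, f x <= normc (m x)) -> L2in (fun x => (f x)%:C%C * h x).
  move=> mf f0 fm; apply: L2in_ge0 => //.
  have [_ i2] := (square_integrableE mu _).1 mh2.
  have mfh : cmeasurable (fun x => (f x)%:C%C * h x).
    apply: cmeasurableM Qh.1.1; split => //=; exact: measurable_cst.
  apply/square_integrableE; split => //; apply: le_integrable i2 => //.
    exact: measurable_sqr_normc.
  move=> x _; rewrite /= lee_fin !ger0_norm ?sqr_ge0// !normcM !exprMn normc_real.
  by rewrite ler_wpM2r ?sqr_ge0// lerXn2r ?nnegrE ?normc_ge0// ger0_norm.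
have hle (u : R) (v : R) : `|u| <= v -> Num.max u 0 <= v /\ Num.max (- u) 0 <= v.
  move=> uv; have v0 := le_trans (normr_ge0 u) uv; move: uv; rewrite ler_norml => /andP[? ?].
  by rewrite !ge_max v0 !andbT; split => //; lra.
have mmax (f : T -> R) : measurable_fun setT f ->
    measurable_fun setT (fun x => Num.max (f x) 0).
  by move=> mf; apply: measurable_maxr => //; exact: measurable_cst.
have mN (f : T -> R) : measurable_fun setT f -> measurable_fun setT (fun x => - f x).
  by move=> mf; exact: measurable_funN.
have max0 (t : R) : 0 <= Num.max t 0 by rewrite le_max lexx orbT.
(* The positive and negative parts of Re m and Im m are each at most |m|, so their products with h
   stay square integrable; m is then reassembled. *)
have q1 := key _ (mmax _ mr) (fun x => max0 _) (fun x => (hle _ _ (ler_Re_normc (m x))).1).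
have q2 := key _ (mmax _ (mN _ mr)) (fun x => max0 _) (fun x => (hle _ _ (ler_Re_normc (m x))).2).
have q3 := key _ (mmax _ mi) (fun x => max0 _) (fun x => (hle _ _ (ler_Im_normc (m x))).1).
have q4 := key _ (mmax _ (mN _ mi)) (fun x => max0 _) (fun x => (hle _ _ (ler_Im_normc (m x))).2).
have := L2in_lin (Complex 0 (-1)) q4 (L2in_lin (Complex 0 1) q3 (L2in_lin (-1) q2 q1)).
congr L2in; apply/funext => x.
have E (t : R) : Num.max t 0 - Num.max (- t) 0 = t.
  have [t0|/ltW t0] := leP t 0.
    by rewrite max_l ?oppr_ge0// sub0r opprK.
  by rewrite max_r ?oppr_le0// subr0.
rewrite !mulrA -!mulrDl; congr (_ * _).
have mE : m x = Complex (Num.max (Re (m x)) 0 - Num.max (- Re (m x)) 0)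
    (Num.max (Im (m x)) 0 - Num.max (- Im (m x)) 0) by rewrite !E; case: (m x).
rewrite [RHS]mE; move: (Num.max _ _) (Num.max _ _) (Num.max _ _) (Num.max _ _) => a b c e.
by apply/eqP; rewrite eq_complex/=; apply/andP; split; apply/eqP; ring.
Qed.

Lemma invariant_setT : V (mkL2 mu (fun=> 1)) -> V = setT.
Proof.
move=> V1; apply/seteqP; split => // F _.
have muT : (mu setT < +oo)%E by rewrite probability_setT ltry.
have Q1 : L2in (fun=> 1) by split => //; exact/square_integrable_bounded/cbounded_cst.
have F1 : (fun x => F x * 1) = F by apply/funext => x; rewrite mulr1.
have [_] := L2inM Q1 (L2P F).1 (eq_rect_r (square_integrable mu) (L2P F) F1).
by rewrite F1 mkL2_repr.
Qed.

End Module.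

(** * The Baumslag-Solitar group *)

Section RootsOfUnity.
Variables (R : realType) (N : nat).
Hypothesis N0 : (0 < N)%N.

Lemma circle_roots (z : R[i]) : `|z| = 1 ->
  exists s : seq (circle R), [/\ uniq s, size s = N &
    forall w : circle R, (w \in s) = (circle_val w ^+ N == z)].
Proof.
move=> z1; have z0 : z != 0 by rewrite -normr_eq0 z1 oner_neq0.
have NC : N%:R != 0 :> R[i] by rewrite pnatr_eq0 -lt0n.
pose p : {poly R[i]} := 'X^N - z%:P.
have [r pr] := closed_field_poly_normal p.
have mp : p \is monic by rewrite monicXnsubC.
rewrite (monicP mp) scale1r in pr.
have sr : size r = N.
  by apply: succn_inj; rewrite -(size_prod_XsubC r id) -pr size_XnsubC.
have rr c : (c \in r) = (c ^+ N == z).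
  by rewrite -root_prod_XsubC -pr /root !hornerE subr_eq0.
have ur : uniq r.
  rewrite -separable_prod_XsubC -pr separable_poly.unlock; apply/Bezout_coprimepP.
  (* Bezout identity for p = X^N - z: -p + (X/N) p' = z, a nonzero constant, so p has no multiple
     root. *)
  exists (- 1, N%:R^-1%:P * 'X) => /=.
  have -> : - 1 * p + N%:R^-1%:P * 'X * p^`() = z%:P.
    rewrite /p derivB derivXn derivC subr0 mulrnAr -mulrA -exprS prednK//.
    rewrite -mulrnAl -polyCMn -[_ *+ N]mulr_natr mulVf// mul1r mulN1r opprB.
    by rewrite subrK.
  by rewrite polyC_eqp1.
have r1 c : c \in r -> `|c| = 1.
  rewrite rr => /eqP cz; apply/eqP; rewrite -(@eqrXn2 _ N)// expr1n -normrX cz z1.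
  by rewrite eqxx.
(* Lifts a root to the circle; the default [point] is never reached because every root has modulus
   1. *)
pose f (c : R[i]) : circle R := if pselect (`|c| = 1) is left h then Circle h else point.
have fK c : c \in r -> circle_val (f c) = c.
  by rewrite /f => /r1 c1; case: pselect.
exists [seq f c | c <- r]; split.
- rewrite map_inj_in_uniq// => a b ar br fab.
  by rewrite -(fK _ ar) -(fK _ br) fab.
- by rewrite size_map.
- move=> w; rewrite -rr; apply/mapP/idP => [[c cr ->]|wr]; first by rewrite fK.
  by exists (circle_val w) => //; apply: circle_inj; rewrite fK.
Qed.

Lemma quadrature_mirror1 : @quadrature_mirror R N (fun=> 1).
Proof.
split.
  split; first exact: cmeasurable_cst.
  by exists 1; apply: aeW => z; rewrite normc1.
apply: aeW => z.
have [s [us sN sE]] := circle_roots (circle_norm z).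
have -> : [set w : circle R | circle_val w ^+ N = circle_val z] = [set` s].
  by apply/seteqP; split => w /=; rewrite sE => /eqP.
rewrite -fsbig_seq//; under eq_bigr do rewrite normc1 expr1n.
by rewrite big_const_seq count_predT iter_addr_0 sN mulVf// pnatr_eq0 -lt0n.
Qed.

End RootsOfUnity.

Section PresentedAction.
Variables (X : choiceType) (rels : word X -> word X -> Prop) (H : Type).
Variable act : X * bool -> H -> H.
Hypothesis actK : forall x e h, act (x, e) (act (x, ~~ e) h) = h.

Definition word_act (v : word X) (h : H) : H := foldr act h v.

Hypothesis act_rel : forall v w, rels v w -> forall h, word_act v h = word_act w h.

Lemma word_act_cat v w h : word_act (v ++ w) h = word_act v (word_act w h).
Proof. by rewrite /word_act foldr_cat. Qed.

Lemma word_act_nseq n l h : word_act (nseq n l) h = iter n (act l) h.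
Proof. by elim: n => //= n ->. Qed.

(** The universal property of the presentation: letters that cancel and respect the relators act
    through the quotient, so the choice of [repr] is harmless. *)
Lemma word_act_pres v w : pres_eq rels v w -> forall h, word_act v h = word_act w h.
Proof.
elim=> {v w} [v|v w _ IH|v w x _ IH1 _ IH2|a x e b|a v w b vw] h //.
- by rewrite IH1 IH2.
- by rewrite !word_act_cat /= actK.
- by rewrite !word_act_cat (act_rel vw).
Qed.

Definition presented_act (g : presented rels) : H -> H := word_act (repr g).

Lemma presented_act_class v h : presented_act (pres_class rels v) h = word_act v h.
Proof. by apply: word_act_pres; apply/pres_classP; exact: pres_class_repr. Qed.

Lemma presented_actM (g k : presented rels) h :
  presented_act (g * k)%g h = presented_act g (presented_act k h).
Proof.
rewrite -[(g * k)%g]/(pres_mul g k) /pres_mul presented_act_class.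
exact: word_act_cat.
Qed.

Lemma presented_act1 h : presented_act 1%g h = h.
Proof. by rewrite -[1%g]/(pres_one rels) presented_act_class. Qed.

End PresentedAction.

Section Wavelet.
Variables (R : realType) (N : nat).
Hypothesis N_ge2 : (2 <= N)%N.
Local Notation sol := (solenoid R N).
Variable mu : probability sol R.
Hypothesis mu_haar : is_haar mu.
Local Notation L2 := (L2 mu).
Local Notation dot := (@L2dot _ _ _ mu).
Implicit Types (F G : L2) (f h : sol -> R[i]) (A B E : set sol).

Let N_gt0 : (0 < N)%N. Proof. exact: ltnW. Qed.

Fact solenoid_unshift_subproof (z : sol) (n : int) :
  z (n + 1 + 1) ^+ N = z (n + 1) /\ `|z (n + 1)| = 1.
Proof. exact: solenoidP. Qed.

Definition solenoid_unshift (z : sol) : sol :=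
  @Solenoid R N (fun n => z (n + 1)) (solenoid_unshift_subproof z).

Lemma solenoid_shiftK : cancel (@solenoid_shift R N) solenoid_unshift.
Proof. by move=> z; apply: solenoid_inj => n /=; rewrite addrK. Qed.

Lemma solenoid_unshiftK : cancel solenoid_unshift (@solenoid_shift R N).
Proof. by move=> z; apply: solenoid_inj => n /=; rewrite subrK. Qed.

Lemma measurable_unshift : measurable_fun setT solenoid_unshift.
Proof. by apply: measurable_fun_solenoid => // n; exact: cmeasurable_coord. Qed.

Lemma haar_unshift A : measurable A -> mu (solenoid_unshift @^-1` A) = mu A.
Proof.
move=> mA; have mB : measurable (solenoid_unshift @^-1` A).
  by rewrite -[X in measurable X]setTI; exact: measurable_unshift.
rewrite -(haar_shift N_ge2 mu_haar mB); congr (mu _).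
by apply/seteqP; split => z; rewrite /preimage/= solenoid_shiftK.
Qed.

Let mS := @measurable_shift R N N_ge2.
Let hS := @haar_shift R N N_ge2 mu mu_haar.
Let muT : (mu setT < +oo)%E := mu_finite mu.

Definition opU : L2 -> L2 := compop (@solenoid_shift R N).
Definition opUi : L2 -> L2 := compop solenoid_unshift.
Definition opT : L2 -> L2 := mulop (fun z : sol => z 0).
Definition opTi : L2 -> L2 := mulop (fun z : sol => Num.conj (z 0)).

Definition BS_letter (l : bool * bool) : L2 -> L2 :=
  if l.1 then if l.2 then opU else opUi else if l.2 then opT else opTi.

Lemma coord_norm (z : sol) n : `|z n| = 1. Proof. exact: (solenoidP z n).2. Qed.

Lemma cbounded_coord n : cbounded (fun z : sol => z n).
Proof.
split; first exact: cmeasurable_coord.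
by exists 1 => z; rewrite normc_circle// coord_norm.
Qed.

Lemma ae_cbounded_coord n : ae_cbounded mu (fun z : sol => z n).
Proof. exact/cbounded_ae/cbounded_coord. Qed.

Lemma ae_cbounded_coordJ n : ae_cbounded mu (fun z : sol => Num.conj (z n)).
Proof. exact/cbounded_ae/cboundedJ/cbounded_coord. Qed.

Lemma coordJ (z : sol) n : z n * Num.conj (z n) = 1.
Proof. by rewrite mulcJ normc_circle ?coord_norm// expr1n. Qed.

Lemma opUK F : opU (opUi F) = F.
Proof.
rewrite /opU /opUi (compop_mk mS hS); last first.
  exact: (square_integrable_comp measurable_unshift haar_unshift (L2P F)).
by rewrite -[RHS]mkL2_repr; congr mkL2; apply/funext => z; rewrite solenoid_shiftK.
Qed.

Lemma opUiK F : opUi (opU F) = F.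
Proof.
rewrite /opU /opUi (compop_mk measurable_unshift haar_unshift); last first.
  exact: (square_integrable_comp mS hS (L2P F)).
by rewrite -[RHS]mkL2_repr; congr mkL2; apply/funext => z; rewrite solenoid_unshiftK.
Qed.

Lemma opTK F : opT (opTi F) = F.
Proof.
rewrite /opT /opTi mulop_comp; [|exact: ae_cbounded_coord|exact: ae_cbounded_coordJ].
by rewrite -[RHS]mulop1; congr mulop; apply/funext => z; rewrite coordJ.
Qed.

Lemma opTiK F : opTi (opT F) = F.
Proof.
rewrite /opT /opTi mulop_comp; [|exact: ae_cbounded_coordJ|exact: ae_cbounded_coord].
by rewrite -[RHS]mulop1; congr mulop; apply/funext => z; rewrite mulrC coordJ.
Qed.

Lemma BS_letterK x e F : BS_letter (x, e) (BS_letter (x, ~~ e) F) = F.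
Proof.
by case: x; case: e; [exact: opUK|exact: opUiK|exact: opTK|exact: opTiK].
Qed.

Lemma opTX F n : iter n opT F = mulop (fun z : sol => z 0 ^+ n) F.
Proof.
elim: n => [|n IH]; first by rewrite -[LHS]mulop1.
rewrite iterS IH /opT mulop_comp; first by congr mulop; apply/funext => z; rewrite exprS.
  exact: ae_cbounded_coord.
apply: cbounded_ae; have := @cbounded_schar R N 0 n%:Z; congr cbounded.
Qed.

(** U T U^-1 is multiplication by the zeroth coordinate of the shifted point, which is z_(-1) =
    z_0^N. *)
Lemma BS_letter_rel v w : BS_rel N v w -> forall F,
  word_act BS_letter v F = word_act BS_letter w F.
Proof.
case=> F; have E := compop_mulop mS hS (opUi F) (ae_cbounded_coord 0).
rewrite -/opU opUK in E; rewrite [LHS]E.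
rewrite word_act_nseq opTX; congr mulop; apply/funext => z /=.
by rewrite -(solenoidP z (0 - 1)).1 subrK.
Qed.

Definition BS_rho (g : BS N) : L2 -> L2 := presented_act BS_letter g.

Lemma BS_rho_class v F : BS_rho (pres_class (BS_rel N) v) F = word_act BS_letter v F.
Proof. exact: (presented_act_class BS_letterK BS_letter_rel). Qed.

Lemma BS_rhoM (g k : BS N) F : BS_rho (g * k)%g F = BS_rho g (BS_rho k F).
Proof. exact: (presented_actM BS_letterK BS_letter_rel). Qed.

Lemma BS_rho1 F : BS_rho 1%g F = F.
Proof. exact: (presented_act1 BS_letterK BS_letter_rel). Qed.

Lemma BS_rho_u : BS_rho (BS_u N) = opU.
Proof. by apply/funext => F; exact: BS_rho_class. Qed.

Lemma BS_rho_t : BS_rho (BS_t N) = opT.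
Proof. by apply/funext => F; exact: BS_rho_class. Qed.

Lemma mulop_unitary (m : sol -> R[i]) : ae_cbounded mu m ->
  (forall z, m z * Num.conj (m z) = 1) ->
  forall F G, dot (mulop m F) (mulop m G) = dot F G.
Proof.
move=> bm m1 F G; rewrite L2dot_mk; last 2 first.
- exact: square_integrableM bm (L2P F).
- exact: square_integrableM bm (L2P G).
congr cintegral; apply/funext => z; rewrite rmorphM.
by rewrite mulrACA m1 mul1r.
Qed.

Lemma BS_letter_unitary l : unitary_operator dot (BS_letter l).
Proof.
have lin : linear (BS_letter l).
  case: l => [[] []] /=.
  - exact: (compop_linear mS hS).
  - exact: (compop_linear measurable_unshift haar_unshift).
  - exact/mulop_linear/ae_cbounded_coord.
  - exact/mulop_linear/ae_cbounded_coordJ.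
have iso F G : dot (BS_letter l F) (BS_letter l G) = dot F G.
  case: l {lin} => [[] []] /=.
  - exact: (compop_dot mS hS).
  - exact: (compop_dot measurable_unshift haar_unshift).
  - by apply: mulop_unitary => [|z]; [exact: ae_cbounded_coord|exact: coordJ].
  - apply: mulop_unitary => [|z]; first exact: ae_cbounded_coordJ.
    by rewrite conjCK mulrC coordJ.
split => // F; exists (BS_letter (l.1, ~~ l.2) F).
by case: l {lin iso} => x e; exact: BS_letterK.
Qed.

Lemma BS_rho_unitary g : unitary_operator dot (BS_rho g).
Proof.
rewrite /BS_rho /presented_act; elim: (repr g) => [|l v [lin iso surj]].
  by split => // F; exists F.
have [llin liso lsurj] := BS_letter_unitary l.
split => [a F G|F G|F] /=.
- by rewrite lin llin.
- by rewrite liso iso.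
- by have [G <-] := lsurj F; have [K <-] := surj G; exists K.
Qed.

Lemma BS_unitary_representation : unitary_representation dot BS_rho.
Proof.
split; [exact: L2_hilbert|exact: BS_rho_unitary|exact: BS_rho1|exact: BS_rhoM].
Qed.

End Wavelet.

(** * Spectral measure and irreducibility *)

Section SpectralMeasure.
Variables (R : realType) (N : nat).
Hypothesis N_ge2 : (2 <= N)%N.
Local Notation sol := (solenoid R N).
Variable mu : probability sol R.
Hypothesis mu_haar : is_haar mu.
Local Notation L2 := (L2 mu).
Local Notation dot := (@L2dot _ _ _ mu).
Local Notation p0 := (@circle_coord R N 0).
Implicit Types (F G : L2) (f : circle R -> R[i]) (B C : set (circle R)).

Let mp0 := @measurable_circle_coord R N 0.

Let pre_meas B : measurable B -> measurable (p0 @^-1` B).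
Proof. by move=> mB; rewrite -[X in measurable X]setTI; exact: mp0. Qed.

(** The law of z_0 is Lebesgue measure, so a null exceptional set of f pulls back to a null set. *)
Lemma Linfty_coord f : Linfty f -> ae_cbounded mu (fun z => f (p0 z)).
Proof.
move=> [mf [M [A [mA A0 fA]]]]; split; first exact: (cmeasurable_comp mp0 mf).
exists M, (p0 @^-1` A); split; first exact: pre_meas.
  by rewrite -A0; exact: haar_circle_coord.
by move=> z /= nz; exact: fA.
Qed.

Definition indic_coord B (z : sol) : R[i] := (\1_B (p0 z))%:C%C.

Lemma cbounded_indic_coord B : measurable B -> cbounded (indic_coord B).
Proof.
move=> mB; split; last first.
  by exists 1 => z; rewrite normc_real indicE ger0_norm// lern1; case: (_ \in _).
split; last exact: measurable_cst.
have mi : measurable_fun setT (\1_B : circle R -> R) by exact: measurable_indic.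
exact: (measurableT_comp mi mp0).
Qed.

Let ae_indic B : measurable B -> ae_cbounded mu (indic_coord B).
Proof. by move=> mB; exact/cbounded_ae/cbounded_indic_coord. Qed.

Definition coord_proj B : L2 -> L2 := mulop (indic_coord B).

Lemma sqr_normc_ge0 F x : 0 <= normc (F x) ^+ 2. Proof. exact: sqr_ge0. Qed.

Lemma sqr_normc_integrable F :
  mu.-integrable setT (EFin \o (fun x => normc (F x) ^+ 2)).
Proof. by have /square_integrableE[] := L2P F. Qed.

(** The scalar spectral measure of T at F: the law of z_0 under |F|^2 mu. Being a pushforward, it
    carries its countable additivity with it. *)
Definition coord_scalar F : {measure set (circle R) -> \bar R} :=
  image_measure mp0 (density_measure (sqr_normc_ge0 F) (sqr_normc_integrable F)).

Lemma coord_scalar_cintegral F f : Linfty f ->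
  cintegral (coord_scalar F) f =
  cintegral mu (fun z => f (p0 z) * (normc (F z) ^+ 2)%:C%C).
Proof.
move=> Lf; rewrite cintegral_image ?cintegral_density//; first exact: Linfty_coord.
  exact: Lf.1.
exact/cintegrable_density/Linfty_coord.
Qed.

Lemma coord_proj_orth B : measurable B -> orthogonal_projection dot (coord_proj B).
Proof.
move=> mB; have bB := ae_indic mB; split; first exact: mulop_linear.
- move=> F; rewrite /coord_proj mulop_comp//; congr mulop; apply/funext => z.
  by rewrite /indic_coord -rmorphM indicE; case: (_ \in _); rewrite ?mulr1 ?mulr0.
- move=> F G; apply: etrans (mulop_dot F G bB) (etrans _ (esym (mulop_dotr F G bB))).
  congr cintegral; apply/funext => z.
  rewrite rmorphM mulrA [L2repr F z * _]mulrC; congr (_ * _ * _).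
  by apply/eqP; rewrite eq_complex/= oppr0 !eqxx.
Qed.

Lemma coord_projT F : coord_proj setT F = F.
Proof.
rewrite -[RHS]mulop1; congr mulop; apply/funext => z.
by rewrite /indic_coord indicT.
Qed.

Lemma coord_projI B C : measurable B -> measurable C ->
  forall F, coord_proj (B `&` C) F = coord_proj B (coord_proj C F).
Proof.
move=> mB mC F; rewrite [RHS]mulop_comp; [|exact: ae_indic|exact: ae_indic].
by congr mulop; apply/funext => z; rewrite /indic_coord indicI rmorphM.
Qed.

Lemma coord_scalarE F B : measurable B ->
  coord_scalar F B = (Re (dot (coord_proj B F) F))%:E.
Proof.
move=> mB; rewrite image_measureE.
rewrite -[LHS]/(\int[mu]_(x in p0 @^-1` B) (normc (F x) ^+ 2)%:E)%E.
have mpB := pre_meas mB.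
rewrite /coord_proj mulop_dot_diag; last exact: ae_indic.
rewrite -[Re _]/(\int[mu]_x Re (indic_coord B x * (normc (F x) ^+ 2)%:C%C)).
have E : (fun x => (Re (indic_coord B x * (normc (F x) ^+ 2)%:C%C))%:E) =
    ((fun x => (normc (F x) ^+ 2)%:E) \_ (p0 @^-1` B)).
  apply/funext => x; rewrite Re_realM /= patchE indicE.
  rewrite (_ : (x \in p0 @^-1` B) = (p0 x \in B)); last by apply/idP/idP; rewrite !inE.
  by case: ifP; rewrite ?mul1r ?mul0r.
rewrite /Rintegral E -integral_mkcond fineK//.
apply: integrable_fin_num => //.
exact: (integrableS measurableT mpB (@subsetT _ _) (sqr_normc_integrable F)).
Qed.

Definition coord_pvm : pvm dot :=
  @PVM R L2 dot coord_proj coord_scalar coord_proj_orth coord_projT coord_projI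
    coord_scalarE.

Lemma coord_pvm_abs_continuous : pvm_abs_continuous coord_pvm.
Proof.
move=> B mB B0 F; apply: L2_eq.
have zB : {ae mu, forall z : sol, ~ B (p0 z)}.
  exists (p0 @^-1` B); split; first exact: pre_meas.
    by rewrite -B0; exact: haar_circle_coord.
  by move=> z /contrapT.
have FF : @L2represents _ _ _ mu F (L2repr F) by exact: aeW.
apply: filterS3 (L2repr0_ae mu) zB (mulop_repr (ae_indic mB) FF) => z -> nB ->.
by rewrite /indic_coord indicE memNset// mul0r.
Qed.

Lemma coord_pvm_integral f : Linfty f ->
  is_pvm_integral coord_pvm f (mulop (fun z => f (p0 z))).
Proof.
move=> Lf; have bf := Linfty_coord Lf; split; first exact: mulop_bounded.
move=> F; apply: etrans (mulop_dot_diag F bf) _.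
exact/esym/coord_scalar_cintegral.
Qed.

Lemma Linfty_circle_val : Linfty (@circle_val R).
Proof.
split; first exact: cmeasurable_circle_val.
by exists 1; apply: aeW => z; rewrite normc_circle// circle_norm.
Qed.

Lemma square_integrable1 : square_integrable mu (fun=> 1).
Proof. exact/(square_integrable_bounded (mu_finite mu))/cbounded_cst. Qed.

Lemma coord_vacuum f : Linfty f ->
  dot (mulop (fun z => f (p0 z)) (mkL2 mu (fun=> 1))) (mkL2 mu (fun=> 1)) =
  cintegral (@circle_measure R) f.
Proof.
move=> Lf; have bf := Linfty_coord Lf; have s1 := square_integrable1.
rewrite mulop_mk// L2dot_mk//; last exact: square_integrableM.
transitivity (cintegral (image_measure mp0 mu) f); last first.
  by apply: eq_measure_cintegral => A mA; exact: haar_circle_coord.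
rewrite cintegral_image.
- by congr cintegral; apply/funext => z; rewrite rmorph1 !mulr1.
- exact: Lf.1.
- have := cintegrableM (square_integrableM bf s1) s1; congr cintegrable.
  by apply/funext => z; rewrite rmorph1 !mulr1.
Qed.

End SpectralMeasure.

(** * Invariant subspaces, cyclicity and irreducibility *)

Section Irreducibility.
Variables (R : realType) (N : nat).
Hypothesis N_ge2 : (2 <= N)%N.
Local Notation sol := (solenoid R N).
Variable mu : probability sol R.
Hypothesis mu_haar : is_haar mu.
Local Notation L2 := (L2 mu).
Local Notation dot := (@L2dot _ _ _ mu).
Implicit Types (F G : L2) (h : sol -> R[i]) (A B E : set sol).

Let mS := @measurable_shift R N N_ge2.
Let hS := @haar_shift R N N_ge2 mu mu_haar.
Let mSi := @measurable_unshift R N N_ge2.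
Let hSi := @haar_unshift R N N_ge2 mu mu_haar.

Section InvariantSubspace.
Variable V : set L2.
Hypothesis closedV : closed_subspace dot V.
Hypothesis invV : forall g F, V F -> V (@BS_rho R N mu g F).

Lemma invariant_word v F : V F -> V (word_act (@BS_letter R N mu) v F).
Proof. by move=> VF; rewrite -(BS_rho_class N_ge2 mu_haar); exact: invV. Qed.

Let V_U F : V F -> V (opU F).
Proof. exact: (@invariant_word [:: (true, true)]). Qed.

Let V_Ui F : V F -> V (opUi F).
Proof. exact: (@invariant_word [:: (true, false)]). Qed.

Let V_T F : V F -> V (opT F).
Proof. exact: (@invariant_word [:: (false, true)]). Qed.

Let V_Ti F : V F -> V (opTi F).
Proof. exact: (@invariant_word [:: (false, false)]). Qed.

(* Conjugating by [U] turns multiplication by [z_n] into multiplication by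
   [z_(n+1)]. *)
Let V_unshift (m : sol -> R[i]) : ae_cbounded mu m ->
  (forall F, V F -> V (mulop m F)) ->
  forall F, V F -> V (mulop (fun z => m (solenoid_unshift z)) F).
Proof.
move=> bm Vm F VF.
have /V_U/Vm/V_Ui := VF; rewrite [X in V X -> _](compop_mulop mSi hSi)//.
by rewrite -/(opUi _) opUiK.
Qed.

Let V_coord (n : nat) F : V F -> V (mulop (fun z : sol => z n%:Z) F).
Proof.
elim: n F => [|n IH] F; first exact: V_T.
move=> /(V_unshift (ae_cbounded_coord _ _) IH).
congr (V (mulop _ _)); apply/funext => z /=; congr (z _); lia.
Qed.

Let V_coordJ (n : nat) F : V F -> V (mulop (fun z : sol => Num.conj (z n%:Z)) F).
Proof.
elim: n F => [|n IH] F; first exact: V_Ti.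
move=> /(V_unshift (ae_cbounded_coordJ _ _) IH).
congr (V (mulop _ _)); apply/funext => z /=; congr (Num.conj (z _)); lia.
Qed.

(** [V] is stable under z_n and its conjugate for n >= 0, and discs in these coordinates generate
    the Borel sets. *)
Lemma invariant_indic A : measurable A -> multiplier_set (L2in V) A.
Proof.
move=> mA; apply: (sigma_solenoid _ _ _ mA); first exact: ltnW.
  apply: sigma_algebra_multiplier_set; first exact: L2in_lin.
  exact: L2in_lim.
move=> n q r; apply: multiplier_sqdist.
- exact: L2in_lin.
- exact: L2in_lim.
- by move=> z; rewrite normc_circle// coord_norm.
- move=> h [h2 Vh]; have bn := ae_cbounded_coord mu n%:Z.
  split; first exact: (square_integrableM bn h2).
  by rewrite -(mulop_mk bn h2); exact: V_coord.
- move=> h [h2 Vh]; have bn := ae_cbounded_coordJ mu n%:Z.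
  split; first exact: (square_integrableM bn h2).
  by rewrite -(mulop_mk bn h2); exact: V_coordJ.
Qed.

Lemma invariant_vacuum : V (mkL2 mu (fun=> 1)) -> V = setT.
Proof. exact: invariant_setT invariant_indic. Qed.

Let indicC A : sol -> R[i] := fun z => (\1_A z)%:C%C.

Let cbounded_indic A : measurable A -> cbounded (indicC A).
Proof.
move=> mA; split.
  by split; [exact: measurable_indic|exact: measurable_cst].
by exists 1 => z; rewrite normc_real indicE ger0_norm// lern1; case: (_ \in _).
Qed.

Let square_indic A : measurable A -> square_integrable mu (indicC A).
Proof.
by move=> mA; exact/(square_integrable_bounded (mu_finite mu))/cbounded_indic.
Qed.

Let V_set A : Prop := measurable A /\ L2in V (indicC A).

(** The element F only serves to show that the indicator predicate has something to start from; the
    same role recurs in [V_bigcup]. *)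
Let V_set0 F : V F -> V_set set0.
Proof.
move=> VF; split => //; have Q : L2in V F by split; [exact: L2P|rewrite mkL2_repr].
have := L2in0 closedV Q; congr L2in; apply/funext => z.
by rewrite /indicC indic0.
Qed.

Let V_setU A B : V_set A -> V_set B -> V_set (A `|` B).
Proof.
move=> [mA QA] [mB QB]; split; first exact: measurableU.
have QAB := invariant_indic mA QB.
have := L2in_lin closedV (-1) QAB (L2in_lin closedV 1 QA QB).
congr L2in; apply/funext => z; rewrite /indicC !indicE in_setU.
by case: (_ \in A); case: (_ \in B) => /=; rewrite ?rmorph1 ?rmorph0; ring.
Qed.

Let V_bigcup (A : nat -> set sol) F : V F -> (forall n, V_set (A n)) ->
  V_set (\bigcup_n A n).
Proof.
move=> VF VA; have mA n := (VA n).1; split; first exact: bigcup_measurable.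
pose B n := \bigcup_(i < n) A i.
have VB n : V_set (B n).
  rewrite /B bigcup_mkord; elim: n => [|n IH]; first by rewrite big_ord0; exact: V_set0 VF.
  by rewrite big_ord_recr/=; apply: V_setU.
have E C : (fun z => (\1_C z)%:C%C * 1) = indicC C by apply/funext => z; rewrite mulr1.
(* Here h = 1, which is not yet known to lie in [V]; only its products with the indicators of the
   finite unions are. *)
have := @L2in_cvg _ _ _ mu V closedV (fun n => \1_(B n)) \1_(\bigcup_n A n) (fun=> 1)
  (square_integrable1 mu).
rewrite E; apply.
- by move=> n z; rewrite indicE ger0_norm// lern1; case: (_ \in _).
- by move=> n; rewrite E; exact: (VB n).2.
- by move=> z; exact: cvg_indic_bigcup.
Qed.

Let V_preim (phi : sol -> sol) (mphi : measurable_fun setT phi)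
    (hphi : forall A, measurable A -> mu (phi @^-1` A) = mu A) A :
  (forall F, V F -> V (compop phi F)) -> V_set A -> V_set (phi @^-1` A).
Proof.
move=> Vphi [mA [A2 VA]].
have mB : measurable (phi @^-1` A) by rewrite -[X in measurable X]setTI; exact: mphi.
split => //; split; first exact: square_indic.
by have := Vphi _ VA; rewrite compop_mk.
Qed.

Lemma nonzero_indic F : V F -> F != 0 ->
  exists B, [/\ measurable B, mu B != 0%E & L2in V (indicC B)].
Proof.
move=> VF F0.
have mF := (L2P F).1.
have mn2 : measurable_fun setT (fun z => normc (F z) ^+ 2).
  exact/measurable_EFinP/measurable_sqr_normc.
pose B (n : nat) : set sol := [set z | n.+1%:R^-1 < normc (F z) ^+ 2].
have mB n : measurable (B n).
  rewrite -[B n]setTI; apply: (measurable_fun_ltr (f := cst n.+1%:R^-1)) => //.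
(* The sets [B n] exhaust {F <> 0}; if all were null, F would vanish almost everywhere. *)
have [n Bn] : exists n, mu (B n) != 0%E.
  apply: contrapT => /forallNP Bz; move/eqP : F0; apply; apply: L2_eq.
  have zB n : {ae mu, forall z : sol, ~ B n z}.
    exists (B n); split => //; first by have /negP/negPn/eqP := Bz n.
    by move=> z /contrapT.
  have /ae_foralln zBn := zB.
  apply: filterS2 (L2repr0_ae mu) zBn => z -> nB; apply: eq0_normc; apply/eqP; rewrite -sqrf_eq0.
  apply/negPn/negP => c0.
  have cc : 0 < normc (F z) ^+ 2 by rewrite lt_neqAle eq_sym c0 sqr_ge0.
  have /archi_boundP : 0 <= (normc (F z) ^+ 2)^-1 by rewrite invr_ge0 ltW.
  set M := Num.bound _ => cM; apply: (nB M); rewrite /B/=.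
  rewrite invf_plt ?posrE ?ltr0n//; apply: lt_trans cM _; by rewrite ltr_nat.
exists (B n); split => //.
(* Chosen so that m F is the indicator of [B n]: on that set conj(F)/|F|^2 inverts F. *)
pose m (z : sol) : R[i] := (\1_(B n) z * (normc (F z) ^+ 2)^-1)%:C%C * Num.conj (F z).
have mm : cmeasurable m.
  apply: cmeasurableM; last exact: cmeasurableJ.
  split; last exact: measurable_cst.
  apply: measurable_funM; first exact: measurable_indic.
  under eq_fun do rewrite -powR_inv1 ?sqr_ge0//.
  exact: (measurableT_comp (measurable_powR (-1)) mn2).
have E : (fun z => m z * F z) = indicC (B n).
  apply/funext => z; rewrite /m /indicC -mulrA [Num.conj _ * _]mulrC mulcJ -rmorphM.
  rewrite indicE; have [zB|] := boolP (z \in B n); last by rewrite !mul0r.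
  rewrite mul1r mulVf//; move: zB; rewrite inE /B/= => /(lt_trans _) h.
  by rewrite gt_eqF// h// invr_gt0 ltr0n.
have QF : L2in V F by split; [exact: L2P|rewrite mkL2_repr].
rewrite -E; apply: L2inM => //; [exact: invariant_indic|].
by rewrite E; exact: square_indic.
Qed.

Lemma invariant_nonzero F : V F -> F != 0 -> V = setT.
Proof.
move=> VF F0; have [B [mB B0 QB]] := nonzero_indic VF F0.
apply: invariant_vacuum.
pose s := @solenoid_shift R N; pose si := @solenoid_unshift R N.
pose P n := iter n s @^-1` B; pose P' n := iter n si @^-1` B.
(* Both forward and backward iterates enter, so that [E] is strictly invariant, as ergodicity is
   stated for the equality of [E] and its preimage. *)
pose E := \bigcup_n (P n `|` P' n).
have VP n : V_set (P n).
  elim: n => [|n IH]; first by [].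
  have := V_preim mS hS V_U IH; congr V_set.
  by apply/funext => z; rewrite /P /preimage /mkset iterSr.
have VP' n : V_set (P' n).
  elim: n => [|n IH]; first by [].
  have := V_preim mSi hSi V_Ui IH; congr V_set.
  by apply/funext => z; rewrite /P' /preimage /mkset iterSr.
have [mE QE] : V_set E by apply: (V_bigcup VF) => n; exact: V_setU.
have shiftE : s @^-1` E = E.
  apply/seteqP; split => z [n _]; rewrite /P /P' /preimage/=.
    rewrite -iterSr => -[Bz|]; first by exists n.+1 => //; left.
    case: n => [|n] /=; first by exists 1%N => //; left.
    by rewrite -iterS iterSr /s /si solenoid_shiftK; exists n => //; right.
  (* At n = 0 the point lies in [B] itself and is reached as a first backward iterate; otherwise one
     shift cancels. *)
  case.
    case: n => [|n]; last by rewrite iterSr; exists n => //; left.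
    by move=> Bz; exists 1%N => //; right; rewrite /P' /preimage/= /s /si solenoid_shiftK.
  move=> Bz; exists n.+1 => //; right.
  by rewrite /P' /preimage/= -/(iter n.+1 si _) iterSr /s /si solenoid_shiftK.
have BE : B `<=` E by move=> z Bz; exists 0%N => //; left.
have muE : mu E = 1%E.
  have [E0|//] := solenoid_ergodic N_ge2 mu_haar mE shiftE.
  move/negP : B0; case; rewrite eq_le measure_ge0 andbT -E0.
  by apply: le_measure; rewrite ?inE.
(* As [E] has full measure, its indicator and the constant 1 define the same class. *)
have [_ VE] := QE; rewrite (_ : mkL2 _ _ = mkL2 mu (indicC E))//.
apply: eq_mkL2; [exact: square_integrable1|exact: square_indic|].
exists (~` E); split; first exact: measurableC.
  apply: etrans (probability_setC mu mE) _.
  by rewrite muE subee.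
move=> z /= nz Ez; apply: nz; by rewrite /indicC indicE mem_set.
Qed.

End InvariantSubspace.

(** A closed subspace [V] containing the orbit of 1 need not be given as invariant, so the argument
    runs on [W], the largest invariant subspace inside [V]: it is closed and contains 1. *)
Lemma BS_cyclic : cyclic_vector dot (@BS_rho R N mu) (mkL2 mu (fun=> 1)).
Proof.
move=> V [V0 Vlin Vcl] V1.
pose W : set L2 := [set F | forall g, V (BS_rho g F)].
have rlin g := BS_rho_unitary N_ge2 mu_haar g.
have cW : closed_subspace dot W.
  split.
  - move=> g; have [lin _ _] := rlin g.
    (* Linearity in the form a F + G gives the image of 0 through a = -1 and F = G = 0. *)
    have := lin (-1) (0 : L2) (0 : L2).
    by rewrite scaleN1r oppr0 addr0 scaleN1r addNr => ->.
  - move=> a F G WF WG g; have [lin _ _] := rlin g.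
    by rewrite lin; apply: Vlin; [exact: WF|exact: WG].
  - move=> u F Wu uF g; apply: (Vcl (fun n => BS_rho g (u n))) => [n|]; first exact: Wu.
    have [lin iso _] := rlin g.
    have E G G' : hnorm dot (BS_rho g G - BS_rho g G') = hnorm dot (G - G').
      have -> : BS_rho g G - BS_rho g G' = BS_rho g (G - G').
        by rewrite addrC -scaleN1r -lin scaleN1r addrC.
      by rewrite /hnorm iso.
    by rewrite /hcvg; under eq_fun do rewrite E.
have WT : W = setT.
  apply: (invariant_vacuum cW) => [g F WF k|g]; last exact: V1.
  by rewrite -(BS_rhoM N_ge2 mu_haar); exact: WF.
apply/seteqP; split => // F _.
have : W F by rewrite WT.
by move=> /(_ 1%g); rewrite (BS_rho1 N_ge2 mu_haar).
Qed.

Lemma BS_irreducible : irreducible_representation dot (@BS_rho R N mu).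
Proof.
split.
  exists (mkL2 mu (fun=> 1)); apply/eqP => e0.
  (* The vector 1 is nonzero because its inner product with itself is the total mass 1. *)
  have := L2dot_mk (square_integrable1 mu) (square_integrable1 mu).
  have -> : (fun _ : sol => 1 * Num.conj (1 : R[i])) = schar 0 0.
    by apply/funext => z; rewrite rmorph1 mulr1.
  rewrite cintegral_schar0 e0 linear0l (_ : fine _ = 1).
    by move=> /esym/eqP; rewrite oner_eq0.
  exact: (congr1 fine (probability_setT mu)).
move=> V cV invV; have [V0|/existsNP[F /not_implyP[VF F0]]] := pselect (forall F, V F -> F = 0).
  left; apply/seteqP; split => F /=; first exact: V0.
  by move=> ->; have [] := cV.
right; by apply: (invariant_nonzero cV invV VF); exact/eqP.
Qed.

End Irreducibility.

Theorem proposition5p9 (R : realType) (N : nat) (N_ge2 : (2 <= N)%N)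
    (mu : probability (solenoid R N) R) (mu_haar : is_haar mu) :
  exists (rho : BS N -> L2 mu -> L2 mu) (phi : L2 mu),
    [/\ forall (F : L2 mu) (f : solenoid R N -> R[i]), L2represents F f ->
          L2represents (rho (BS_u N) F) (fun z => f (solenoid_shift z)),
        forall (F : L2 mu) (f : solenoid R N -> R[i]), L2represents F f ->
          L2represents (rho (BS_t N) F) (fun z => z 0 * f z),
        L2represents phi (fun=> 1),
        wavelet_representation (fun=> 1) (@L2dot _ _ _ mu) rho phi &
        irreducible_representation (@L2dot _ _ _ mu) rho].
Proof.
have mS := @measurable_shift R N N_ge2; have hS := haar_shift N_ge2 mu_haar.
have s1 := square_integrable1 mu.
have rT := BS_rho_t N_ge2 mu_haar; have rU := BS_rho_u N_ge2 mu_haar.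
exists (@BS_rho R N mu), (mkL2 mu (fun=> 1)); split.
- by move=> F f Ff; rewrite rU; exact: (compop_repr mS hS Ff).
- by move=> F f Ff; rewrite rT; apply: mulop_repr Ff; exact: ae_cbounded_coord.
- exact: mkL2P.
- split.
  + by apply: quadrature_mirror1; exact: ltnW.
  + exact: BS_unitary_representation.
  + exact: BS_cyclic.
  (* The functional calculus of T is multiplication by f(z_0). *)
  + exists (coord_pvm mu), (fun f => mulop (fun z => f (circle_coord 0 z))).
    split.
    * rewrite rT; exact: (coord_pvm_integral N_ge2 mu_haar (Linfty_circle_val R)).
    * exact: coord_pvm_abs_continuous.
    * by move=> f; exact: coord_pvm_integral.
    * rewrite rU mulop1 [LHS](compop_mk mS hS)//.
    * by move=> f; exact: coord_vacuum.
- exact: BS_irreducible.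
Qed.
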